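(* Assume the Kalman condition $\mathrm{rank}(B,AB,\dots,A^{n-1}B)=n$ and let $(v(b))_{b\in\mathcal{T}}$, $(u(b))_{b\in\mathcal{T}}$ be as constructed below. Then: (1) There exist constants $C,C'>0$ depending on $A$, $B$, $T$ (and the chosen norms) such that if $$C'|\lambda|\,\|\Phi(\circ)\|\,\|u(\circ)\|^{-1}\,|F|\big(C\|u(\circ)\|\big)<1,$$ then $\sum_{b\in\mathcal{T}}|\lambda|^{|b|}\|v(b)\|_{L^2}$ converges and $|u|:=\sum_{b\in\mathcal{T}}|\lambda|^{|b|}\|u(b)\|$ satisfies $$|u|\le\frac{16\|u(\circ)\|}{1-C'|\lambda|\,\|\Phi(\circ)\|\,\|u(\circ)\|^{-1}|F|\big(C\|u(\circ)\|\big)}.$$ (2) If moreover $|u|<\infty$ and $|\lambda|\,|u|^{-1}\,|F|\big(16\|\Phi(\circ)\|\,|u|\big)<1$, then $v:=\sum_{b\in\mathcal{T}}\lambda^{|b|}v(b)$ converges in $L^2((0,T),\mathbb{R}^m)$, and the solution $x\in\mathcal{S}$ of $x'=Ax+Bv+\lambda F(x)$, $x(0)=x^0$, satisfies $x(T)=0$.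
   Context: Setting: $T>0$, $n,m\in\mathbb{N}^*$, $A\in\mathcal{M}_n(\mathbb{R})$, $B$ a nonzero real $n\times m$ matrix with transpose $B^*$, $x^0\in\mathbb{R}^n$ with $x^0\ne0$, $\lambda\in\mathbb{R}$. $\mathcal{S}:=\mathcal{C}^0([0,T],\mathbb{R}^n)\cap H^1([0,T],\mathbb{R}^n)$, $\mathcal{I}:=\mathbb{R}^n\times L^2((0,T),\mathbb{R}^n)$ with fixed Banach norms. Hypothesis (H1): $F(x)=\sum_{p\ge2}F_p(x,\dots,x)$ with $F_p:\mathcal{S}^p\to L^2((0,T),\mathbb{R}^n)$ continuous $p$-linear, and $|F|(z):=\sum_{p\ge0}\|F_p\|z^p$ ($F_0=F_1=0$) converges for all $z\in\mathbb{C}$. Adjoint problem $(\mathcal{P}')$: $y\in\mathcal{S}$, $-y'=A^*y$, $y(0)=y^0$. Trees: $\mathcal{T}$ = planar rooted trees (children ordered) in which every internal vertex has $\ge2$ children; $\|b\|$ = number of leaves, $|b|$ = number of internal vertices; $\circ$ = one-vertex tree; $B_+(b_1,\dots,b_r)$ ($r\ge2$) attaches roots of $b_1,\dots,b_r$ to a new root, every $b\ne\circ$ being uniquely of this form, and then $B_-(b)=b_1\bullet\cdots\bullet b_r$; $E\propto c$ replaces the $i$-th leaf of $c$ by $E_i$. $\Phi(\circ):\mathcal{I}\to\mathcal{S}$, $(x^0,f)\mapsto$ solution of $x'=Ax+f$, $x(0)=x^0$, with operator norm $\|\Phi(\circ)\|$; $\Phi(B_+(b_1,\dots,b_r))(w):=\Phi(\circ)(0,F_r(\Phi(b_1)(w^{(1)}),\dots,\Phi(b_r)(w^{(r)})))$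 with $w^{(j)}$ consecutive blocks of lengths $\|b_j\|$. $(\Phi\ast u)(b):=\sum_{c\in\mathcal{T}}\sum_{E\in\mathcal{T}^{\|c\|},E\propto c=b}\Phi(c)(u(E_1),\dots,u(E_{\|c\|}))$ and $F[(\Phi\ast u)(b_1\bullet\cdots\bullet b_r)]:=F_r((\Phi\ast u)(b_1),\dots,(\Phi\ast u)(b_r))$. Construction: recursively on $|b|$, $v(b):=B^*\tilde y(b)\in L^2((0,T),\mathbb{R}^m)$ where $\tilde y(b)$ solves $(\mathcal{P}')$ with initial value a minimizer of $J(b):\mathbb{R}^n\to\mathbb{R}$, where $J(\circ)(y^0)=\frac12\int_0^T|B^*\tilde y|^2dt+\langle x^0,y^0\rangle$ and, for $b\ne\circ$, $J(b)(y^0)=\frac12\int_0^T|B^*\tilde y|^2dt+\int_0^T\langle\tilde y,F[(\Phi\ast u)(B_-(b))]\rangle dt$, $\tilde y$ being the solution of $(\mathcal{P}')$ with initial value $y^0$; here $u(\circ):=(x^0,Bv(\circ))$ and $u(c):=(0,Bv(c))$ for $c\ne\circ$.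
   Formalization: ''The solution x'' is read as ''there is a solution x with x(T)=0'', since (H1) does not ensure uniqueness; the fixed norms are sup norm plus L² norm of the derivative on 𝒮 and Euclidean plus L² norm on ℐ, because part (2) fails for arbitrarily rescaled norms. *)

(* Defs.v *)
From HB Require Import structures.
From mathcomp Require Import all_boot all_order all_algebra.
From mathcomp Require Import all_classical all_reals all_analysis.
Set Implicit Arguments. Unset Strict Implicit. Unset Printing Implicit Defensive.
Import Order.TTheory GRing.Theory Num.Theory.
Import numFieldNormedType.Exports.
Local Open Scope classical_set_scope.
Local Open Scope ring_scope.

(* Planar rooted trees.  A tree is a node with an ordered list of      *)
(* children; the one-vertex tree is [Node [::]].  Membership in the     *)
(* paper's set \mathcal{T} is the predicate [validb] (every internal    *)
(* vertex has at least 2 children).                                     *)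
Inductive tree := Node of seq tree.

Definition leaf : tree := Node [::].
Definition children (b : tree) : seq tree := let: Node cs := b in cs.

Fixpoint enc (b : tree) : GenTree.tree unit :=
  let: Node cs := b in GenTree.Node 0 (map enc cs).
Fixpoint dec (t : GenTree.tree unit) : tree :=
  match t with
  | GenTree.Leaf _ => Node [::]
  | GenTree.Node _ ts => Node (map dec ts)
  end.
Fixpoint encK_aux (b : tree) : dec (enc b) = b :=
  match b return dec (enc b) = b with
  | Node cs => f_equal Node
      ((fix go (cs : seq tree) : map dec (map enc cs) = cs :=
          match cs return map dec (map enc cs) = cs with
          | [::] => erefl
          | c :: cs' => f_equal2 cons (encK_aux c) (go cs')
          end) cs)
  end.
Lemma encK : cancel enc dec. Proof. exact: encK_aux. Qed.
HB.instance Definition _ := Countable.copy tree (can_type encK).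

Fixpoint validb (b : tree) : bool :=
  let: Node cs := b in (size cs != 1)%N && all validb cs.
Fixpoint nleaves (b : tree) : nat :=
  let: Node cs := b in if cs is [::] then 1%N else sumn (map nleaves cs).
Fixpoint ninner (b : tree) : nat :=
  let: Node cs := b in if cs is [::] then 0%N else (sumn (map ninner cs)).+1.

(* All decompositions b = E \propto c: pairs (c, E) where c is a tree and *)
(* E the list of trees grafted on the leaves of c (in order).            *)
Fixpoint cuts (b : tree) : seq (tree * seq tree) :=
  let: Node cs := b in
  if cs is [::] then [:: (leaf, [:: b])] else
  (leaf, [:: b]) ::
  [seq (Node q.1, q.2) | q <-
     (fix go (cs : seq tree) : seq (seq tree * seq tree) :=
        match cs with
        | [::] => [:: ([::], [::])]
        | c :: cs' => [seq (p.1 :: q.1, p.2 ++ q.2) | p <- cuts c, q <- go cs']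
        end) cs].

Section Spaces.
Variables (R : realType) (T : R).

Definition mu := @lebesgue_measure R.
Definition I0T : set R := `[0, T].

Definition enorm k (x : 'cV[R]_k) : R := Num.sqrt (\sum_i x i 0 ^+ 2).
Definition dotv k (x y : 'cV[R]_k) : R := \sum_i x i 0 * y i 0.

Definition Rint (a b : R) (f : R -> R) : R := Rintegral mu `[a, b] f.
Definition vint k (f : R -> 'cV[R]_k) (a b : R) : 'cV[R]_k :=
  \col_i Rint a b (fun s => f s i 0).

Definition isL2 k (f : R -> 'cV[R]_k) : Prop :=
  (forall i, measurable_fun `[0, T] (fun t => f t i 0)) /\
  (\int[mu]_(t in I0T) ((enorm (f t)) ^+ 2)%:E < +oo)%E.
Definition L2norm k (f : R -> 'cV[R]_k) : R :=
  Num.sqrt (Rint 0 T (fun t => enorm (f t) ^+ 2)).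

Definition eqS k (x y : R -> 'cV[R]_k) : Prop :=
  forall t, 0 <= t <= T -> x t = y t.
Definition eqL k (f g : R -> 'cV[R]_k) : Prop :=
  mu.-negligible [set t | 0 <= t <= T /\ f t <> g t].

Definition isPrim k (x g : R -> 'cV[R]_k) : Prop :=
  isL2 g /\ forall t, 0 <= t <= T -> x t = x 0 + vint g 0 t.
(* S = C^0([0,T]) \cap H^1([0,T]) *)
Definition isS k (x : R -> 'cV[R]_k) : Prop := exists g, isPrim x g.
(* fixed Banach norm on S : sup norm + L^2 norm of the derivative *)
Definition Snorm k (x : R -> 'cV[R]_k) : R :=
  sup [set enorm (x t) | t in `[0, T]] + inf [set L2norm g | g in isPrim x].

End Spaces.

Section Control.
Variables (R : realType) (n m : nat) (T : R) (A : 'M[R]_n) (B : 'M[R]_(n, m)).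

Definition fn := R -> 'cV[R]_n.
Definition fm := R -> 'cV[R]_m.
(* I = R^n x L^2((0,T),R^n) *)
Definition Iset := ('cV[R]_n * fn)%type.
Definition Inorm (w : Iset) : R := enorm w.1 + L2norm T w.2.

Definition isSolLin (x0 : 'cV[R]_n) (f : fn) (x : fn) : Prop :=
  isS T x /\ forall t, 0 <= t <= T -> x t = x0 + vint (fun s => A *m x s + f s) 0 t.
Definition Phi0 (w : Iset) : fn := get [set x | isSolLin w.1 w.2 x].
Definition normPhi0 : R :=
  inf [set M : R | 0 <= M /\
        forall w : Iset, isL2 T w.2 -> Snorm T (Phi0 w) <= M * Inorm w].

(* the nonlinearity: F p is F_p : S^p -> L^2 *)
Definition Fam := forall p : nat, ('I_p -> fn) -> fn.

Definition upd p (w : 'I_p -> fn) (i : 'I_p) (z : fn) : 'I_p -> fn :=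
  fun j => if j == i then z else w j.

Definition opF (F : Fam) (p : nat) : R :=
  inf [set M : R | 0 <= M /\ forall w : 'I_p -> fn, (forall i, isS T (w i)) ->
        L2norm T (F p w) <= M * \prod_i Snorm T (w i)].
Definition absF (F : Fam) (z : R) : R :=
  limn (fun N => \sum_(p < N) opF F p * z ^+ p).

Definition H1 (F : Fam) : Prop :=
  (forall p (w : 'I_p -> fn), (p < 2)%N -> eqL T (F p w) (fun=> 0)) /\
  (* F_p is well defined on S^p with values in L^2 *)
  (forall p (w w' : 'I_p -> fn), (forall i, isS T (w i)) ->
      (forall i, eqS T (w i) (w' i)) -> eqL T (F p w) (F p w')) /\
  (forall p (w : 'I_p -> fn), (forall i, isS T (w i)) -> isL2 T (F p w)) /\
  (forall p (w : 'I_p -> fn) (i : 'I_p) (a : R) (x y : fn),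
      (forall j, isS T (w j)) -> isS T x -> isS T y ->
      eqL T (F p (upd w i (fun t => a *: x t + y t)))
            (fun t => a *: F p (upd w i x) t + F p (upd w i y) t)) /\
  (* continuous (= bounded) *)
  (forall p, exists M : R, 0 <= M /\ forall w : 'I_p -> fn, (forall i, isS T (w i)) ->
        L2norm T (F p w) <= M * \prod_i Snorm T (w i)) /\
  (* |F|(z) converges for every z (equivalently every z >= 0) *)
  (forall z : R, 0 <= z -> cvgn (fun N => \sum_(p < N) opF F p * z ^+ p)).

Definition Fseq (F : Fam) (ws : seq fn) : fn :=
  F (size ws) (fun i => nth (fun=> 0) ws i).

Fixpoint Phi (F : Fam) (c : tree) (w : seq Iset) : fn :=
  let: Node cs := c in
  if cs is [::] then Phi0 (head (0, fun=> 0) w) else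
  Phi0 (0, Fseq F
    ((fix go (cs : seq tree) (w : seq Iset) : seq fn :=
        match cs with
        | [::] => [::]
        | c1 :: cs' => Phi F c1 (take (nleaves c1) w) :: go cs' (drop (nleaves c1) w)
        end) cs w)).

Definition PhiStar (F : Fam) (u : tree -> Iset) (b : tree) : fn :=
  fun t => \sum_(ce <- cuts b) Phi F ce.1 (map u ce.2) t.

Definition uof (x0 : 'cV[R]_n) (v : tree -> fm) (b : tree) : Iset :=
  (if children b is [::] then x0 else 0, fun t => B *m v b t).

Definition Gterm (F : Fam) (u : tree -> Iset) (b : tree) : fn :=
  Fseq F [seq PhiStar F u c | c <- children b].

Definition isAdj (y : fn) : Prop :=
  forall t, 0 <= t <= T -> y t = y 0 - vint (fun s => A^T *m y s) 0 t.

Definition Jval (x0 : 'cV[R]_n) (F : Fam) (v : tree -> fm) (b : tree) (y : fn) : R :=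
  2^-1 * Rint 0 T (fun t => enorm (B^T *m y t) ^+ 2) +
  (if children b is [::] then dotv x0 (y 0)
   else Rint 0 T (fun t => dotv (y t) (Gterm F (uof x0 v) b t))).

Definition constructed (x0 : 'cV[R]_n) (F : Fam) (v : tree -> fm) : Prop :=
  forall b, validb b -> exists y : fn,
    isAdj y /\ eqS T (v b) (fun t => B^T *m y t) /\
    forall y' : fn, isAdj y' -> Jval x0 F v b y <= Jval x0 F v b y'.

Definition tsum (a : tree -> R) : \bar R := \esum_(b in [set b | validb b]) (a b)%:E.

Definition sumconv (lam : R) (v : tree -> fm) (vs : fm) : Prop :=
  forall e : R, 0 < e -> exists F0 : seq tree, all validb F0 /\
    forall Fs : seq tree, uniq Fs -> all validb Fs -> {subset F0 <= Fs} ->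
      L2norm T (fun t => \sum_(b <- Fs) lam ^+ ninner b *: v b t - vs t) < e.

Definition isSolNL (x0 : 'cV[R]_n) (lam : R) (F : Fam) (vs : fm) (x : fn) : Prop :=
  isS T x /\ exists g : fn, isL2 T g /\
    (fun N => L2norm T (fun t => \sum_(p < N) F p (fun=> x) t - g t)) @ \oo --> (0 : R) /\
    forall t, 0 <= t <= T ->
      x t = x0 + vint (fun s => A *m x s + B *m vs s + lam *: g s) 0 t.

Definition kalman : Prop := \rank (\mxrow_(k < n) (A ^+ k *m B)) = n.

End Control.

(* Main.v *)
Require Import Defs.
From HB Require Import structures.
From mathcomp Require Import all_boot all_order all_algebra.
From mathcomp Require Import all_classical all_reals all_analysis.
From mathcomp Require Import measurable_realfun.
From mathcomp Require Import ring lra.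
Import Order.TTheory GRing.Theory Num.Theory.
Import numFieldNormedType.Exports.
Local Open Scope classical_set_scope.
Local Open Scope ring_scope.
Set Implicit Arguments. Unset Strict Implicit. Unset Printing Implicit Defensive.

(** Write [X b = (Phi * u)(b)]. Expanding the grafting sum by multilinearity,
    [X (B_+(b_1,..,b_r))] is the response of the linear system to the control [v b] and the
    forcing [F_r (X b_1,..,X b_r)]. The Euler-Lagrange equation of [J b], paired with the adjoint
    flow, says that [X b] vanishes at time [T], and the invertibility of the controllability
    Gramian bounds [v b] linearly by the forcing. Hence the numbers [|lam|^|b| * |X b|] satisfy a
    recursive inequality on trees, and every [M] with [theta + kappa * |F|(M) <= M] bounds all
    their finite sums; this gives part (1). For part (2), the same majorant makes the series of
    the [v b] and of the forcings converge in [L^2]; since [|b| - 1] is the sum of the [|b_i|],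
    the forcings add up to [F(x)] for the sum [x] of the [X b], which vanishes at time [T]
    because every [X b] does. *)

(** * Integrals of scalar functions *)

Section ScalarIntegrals.
Variable R : realType.
Local Notation leb := (@lebesgue_measure R).
Local Notation RI := (@Defs.Rint R 0).

(** Two features of the setting shape the proof. The adjoint solutions over which [J b] is minimized
    are specified only by an integral identity, in which a divergent integral reads as 0; they first
    have to be identified with [mexp (- A^T) t *m y 0]. And elements of L^2 are plain functions, so
    identities for F_p hold only almost everywhere on [0, T], whereas solutions are to agree at
    every time: [Phi0_eqL] passes from the one to the other.

    The majorant argument counts no trees: a finite family is enclosed in the family of all trees
    whose root subtrees come from a finite set W, and over that family the recursive bound factors
    into a partial sum of |F|. With K the norm of the solution operator, U the norm of u at the
    leaf, |B| the entry sum of B and c the Gramian constant, part (1) uses the majorant M = (K + 1)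
    U, whence C = K + 1; and C' = (1 + |B| c)(1 + 1/K) makes q equal to (1 + |B| c)(K + 1) |lam|
    |F|(M) / U. In part (2) the number of terms of F is fixed before the finite set of trees is
    chosen, because the Lipschitz constants depend on it. *)

Definition intg (t : R) (f : R -> R) := leb.-integrable `[0, t] (EFin \o f).

(** Preimages of rays under a monotone function are intervals. *)
Lemma nondecreasing_emeasurable (h : R -> \bar R) :
  {homo h : x y / x <= y >-> (x <= y)%E} -> measurable_fun [set: R] h.
Proof.
move=> h_nd mD; apply: (measurability _ (ErealGenCInfty.measurableE R)) => //.
move=> _ [_ [r ->] <-]; apply: measurableI => //; apply: is_interval_measurable.
move=> s t /=; rewrite !in_itv/= !andbT => fs ft u /andP[su ut].
by rewrite in_itv/= andbT (le_trans fs)// h_nd.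
Qed.

(** The comparison is made on the suprema over simple functions that define the integrals, since [g]
    is not assumed measurable. *)
Lemma ge0_integral_itv_homo (g : R -> \bar R) : (forall x, (0 <= g x)%E) ->
  {homo (fun t : R => \int[leb]_(s in `[0%R, t]) g s)%E : x y / x <= y >-> (x <= y)%E}.
Proof.
move=> g0 x y xy /=; rewrite !ge0_integralE//.
rewrite ge_ereal_sup// => _ [h/= hfS] <-.
apply: ereal_sup_ubound; exists h => // z.
apply: le_trans (hfS z) _; rewrite !patchE.
case: ifPn => [zx|_]; last by case: ifP.
rewrite ifT//; move: zx; rewrite !inE/= !in_itv/= => /andP[-> /le_trans]; exact.
Qed.

(** Holds with no condition on [f]: the integrals of its positive and negative parts are monotone in
    [t]. Adjoint solutions owe their measurability to this. *)
Lemma measurable_Rint (f : R -> R) : measurable_fun [set: R] (fun t => RI t f).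
Proof.
rewrite /Defs.Rint /Rintegral.
apply: (@measurableT_comp _ _ _ _ _ _ fine); first exact: fine_measurable.
under eq_fun do rewrite integralE.
by apply: emeasurable_funB; apply: nondecreasing_emeasurable;
  apply: ge0_integral_itv_homo => x; rewrite ?funepos_ge0 ?funeneg_ge0.
Qed.

Lemma intgS (s t : R) f : s <= t -> intg t f -> intg s f.
Proof.
move=> st; apply: integrableS => //.
by move=> x /=; rewrite !in_itv/= => /andP[-> /le_trans]; apply.
Qed.

Lemma eq_intg t f g : (forall s, 0 <= s <= t -> f s = g s) -> intg t f -> intg t g.
Proof.
move=> fg; apply: eq_integrable => // s; rewrite inE/= in_itv/= => /fg st.
by rewrite /= st.
Qed.

Lemma eq_RI t f g : (forall s, 0 <= s <= t -> f s = g s) -> RI t f = RI t g.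
Proof.
by move=> fg; apply: eq_Rintegral => s; rewrite inE/= in_itv/= => /fg.
Qed.

Lemma intgD t f g : intg t f -> intg t g -> intg t (fun s => f s + g s).
Proof. by move=> ? ?; apply: (@integrableD _ _ _ leb _ _ (EFin \o f) (EFin \o g)). Qed.

Lemma intgZ t a f : intg t f -> intg t (fun s => a * f s).
Proof. by move=> ?; apply: (@integrableZl _ _ _ leb _ _ a (EFin \o f)). Qed.

Lemma intg0 t : intg t (fun=> 0).
Proof. exact: integrable0. Qed.

Lemma intg_sum t (I : Type) (r : seq I) (F : I -> R -> R) :
  (forall i, intg t (F i)) -> intg t (fun s => \sum_(i <- r) F i s).
Proof.
move=> iF; elim: r => [|i r IH].
  by apply: eq_intg (intg0 t) => s _; rewrite big_nil.
by apply: eq_intg (intgD (iF i) IH) => s _; rewrite big_cons.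
Qed.

Lemma intg_norm t f : intg t f -> intg t (fun s => `|f s|).
Proof. by move=> ?; apply: integrable_norm. Qed.

Lemma intg_measurable t f : intg t f -> measurable_fun `[0, t] f.
Proof. by case/integrableP => /measurable_EFinP. Qed.

Lemma le_intg (t : R) (f g : R -> R) : measurable_fun `[0, t] f ->
  (forall s, 0 <= s <= t -> `|f s| <= g s) -> intg t g -> intg t f.
Proof.
move=> mf fg; apply: le_integrable => //; first exact/measurable_EFinP.
move=> s /=; rewrite in_itv/= => /fg fgs; rewrite lee_fin.
by rewrite (le_trans fgs)// ler_norm.
Qed.

Lemma intg_cst t c : intg t (fun=> c).
Proof.
apply: measurable_bounded_integrable => //.
  by rewrite /= lebesgue_measure_itv/=; case: ifP => _; rewrite ltry.
exists `|c|; split; first exact: num_real.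
by move=> M cM s _ /=; apply: ltW.
Qed.

Lemma bounded_intg (t : R) (f : R -> R) M : measurable_fun `[0, t] f ->
  (forall s, 0 <= s <= t -> `|f s| <= M) -> intg t f.
Proof. by move=> mf fM; apply: le_intg mf fM (intg_cst _ _). Qed.

Lemma intg_bM (t : R) (f g : R -> R) M : measurable_fun `[0, t] f ->
  (forall s, 0 <= s <= t -> `|f s| <= M) -> intg t g ->
  intg t (fun s => f s * g s).
Proof.
move=> mf fM ig; apply: (@le_intg _ _ (fun s => M * `|g s|)).
- by apply: measurable_funM => //; apply: intg_measurable.
- by move=> s st; rewrite normrM ler_wpM2r// fM.
- by apply/intgZ/intg_norm.
Qed.

Lemma RID t f g : intg t f -> intg t g ->
  RI t (fun s => f s + g s) = RI t f + RI t g.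
Proof. by move=> ? ?; apply: RintegralD. Qed.

Lemma RIB t f g : intg t f -> intg t g ->
  RI t (fun s => f s - g s) = RI t f - RI t g.
Proof. by move=> ? ?; apply: RintegralB. Qed.

Lemma RIZ t a f : intg t f -> RI t (fun s => a * f s) = a * RI t f.
Proof. by move=> ?; apply: RintegralZl. Qed.

Lemma RIN t f : intg t f -> RI t (fun s => - f s) = - RI t f.
Proof.
move=> fi; rewrite -mulN1r -RIZ//; apply: eq_RI => s _; by rewrite mulN1r.
Qed.

Lemma RI0 t : RI t (fun=> 0) = 0.
Proof. by rewrite /Defs.Rint /Rintegral integral0. Qed.

Lemma RI_sum t (I : Type) (r : seq I) (F : I -> R -> R) :
  (forall i, intg t (F i)) ->
  RI t (fun s => \sum_(i <- r) F i s) = \sum_(i <- r) RI t (F i).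
Proof.
move=> iF; elim: r => [|i r IH].
  rewrite big_nil -[RHS](RI0 t); apply: eq_Rintegral => s _; exact: big_nil.
rewrite big_cons -IH -RID//; last exact: intg_sum.
by apply: eq_RI => s _; rewrite big_cons.
Qed.

Lemma RI_pt f : RI 0 f = 0.
Proof. by rewrite /Defs.Rint set_itv1 Rintegral_set1. Qed.

Lemma RI_ge0 t f : (forall s, 0 <= s <= t -> 0 <= f s) -> 0 <= RI t f.
Proof.
by move=> f0; apply: Rintegral_ge0 => s /=; rewrite in_itv/=; apply: f0.
Qed.

Lemma le_RI t f g : intg t f -> intg t g ->
  (forall s, 0 <= s <= t -> f s <= g s) -> RI t f <= RI t g.
Proof.
by move=> fi gi fg; apply: le_Rintegral => // s /=; rewrite in_itv/=; apply: fg.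
Qed.

Lemma norm_RI t f : intg t f -> `|RI t f| <= RI t (fun s => `|f s|).
Proof. by move=> ?; apply: le_normr_Rintegral. Qed.

Lemma RI_cst (t c : R) : 0 <= t -> RI t (fun=> c) = c * t.
Proof.
move=> t0; rewrite /Defs.Rint Rintegral_cst//; congr (_ * _).
have := @lebesgue_measure_itv R `[0, t]; rewrite /= lte_fin sube0 => h.
apply: (etrans (congr1 fine h)); move: t0.
by rewrite le_eqVlt => /predU1P[<-|->]//; rewrite ltxx.
Qed.

Lemma RI_homo s t f : 0 <= s <= t -> intg t f ->
  (forall r, 0 <= r <= t -> 0 <= f r) -> RI s f <= RI t f.
Proof.
move=> /andP[s0 st] fi f0.
have is_ : intg s f by apply: intgS fi.
rewrite /Defs.Rint /Rintegral fine_le//.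
- exact: integrable_fin_num.
- exact: integrable_fin_num.
apply: ge0_subset_integral => //.
- by case/integrableP: fi.
- by move=> r /=; rewrite !in_itv/= => /andP[-> /le_trans]; apply.
Qed.

Lemma continuous_measurable_itv (f : R -> R) (D : set R) : measurable D ->
  continuous f -> measurable_fun D f.
Proof.
move=> mD cf; apply: (measurable_funS (E := setT)) => //.
exact: continuous_measurable_fun.
Qed.

Lemma continuous_bounded (f : R -> R) t : continuous f ->
  exists2 M, 0 <= M & forall s, 0 <= s <= t -> `|f s| <= M.
Proof.
move=> cf.
have : compact (f @` `[0, t]).
  apply: continuous_compact; last exact: segment_compact.
  by apply: continuous_subspaceT.
move=> /compact_bounded[M [_ fM]].
exists (`|M| + 1) => // s st.
apply: (fM (`|M| + 1)); last by exists s => //=; rewrite in_itv.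
by rewrite (le_lt_trans (ler_norm _))// ltrDl.
Qed.

Lemma continuous_intg f t : continuous f -> intg t f.
Proof.
move=> cf; have [M _ fM] := continuous_bounded t cf.
by apply: bounded_intg fM; apply: continuous_measurable_itv.
Qed.

(** Differentiability is asked on the whole line, which avoids one-sided conditions at the ends of
    an interval; entries of matrix exponentials satisfy it. *)
Definition C1 (phi psi : R -> R) :=
  (forall x : R, is_derive x (1 : R) phi (psi x)) /\ continuous psi.

Lemma C1_continuous phi psi : C1 phi psi -> continuous phi.
Proof.
move=> [d _] x; apply: differentiable_continuous.
by apply/derivable1_diffP; apply: ex_derive.
Qed.

Lemma C1_Rint phi psi (r t : R) : C1 phi psi -> r <= t ->
  Defs.Rint r t psi = phi t - phi r.
Proof.
move=> Cphi; have cphi := C1_continuous Cphi; have [d c] := Cphi.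
rewrite le_eqVlt => /predU1P[->|rt].
  by rewrite subrr /Defs.Rint set_itv1 Rintegral_set1.
rewrite /Defs.Rint /Rintegral (@continuous_FTC2 _ _ phi)//.
- exact: continuous_subspaceT.
- split.
  + by move=> x _; apply: ex_derive.
  + exact: cvg_at_right_filter (cphi r).
  + exact: cvg_at_left_filter (cphi t).
- by move=> x _; rewrite derive1E; apply: derive_val.
Qed.

Lemma RI_restrict (t : R) (f : R -> R) :
  (\int[leb]_x ((f \_ `[0%R, t]) x)%:E)%E = (\int[leb]_(x in `[0%R, t]) (f x)%:E)%E.
Proof. by rewrite [RHS]integral_mkcond restrict_EFin. Qed.

Lemma measurable_triangle : measurable_fun [set: R * R]
  (fun z : R * R => ((z.2 <= z.1)%R%:R : R)).
Proof.
have -> : (fun z : R * R => ((z.2 <= z.1)%R%:R : R)) =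
   \1_((fun z : R * R => z.1 - z.2) @^-1` `[0, +oo[).
  apply/funext => z; rewrite indicE; congr (_%:R); congr nat_of_bool.
  by apply/idP/idP; rewrite inE/= in_itv/= andbT subr_ge0.
apply: measurable_indic; rewrite -[X in measurable X]setTI.
by apply: measurable_funB.
Qed.

Lemma integrable_patchT (D : set R) (g : R -> R) : measurable D ->
  leb.-integrable D (EFin \o g) ->
  leb.-integrable setT (fun x => ((g \_ D) x)%:E).
Proof.
move=> mD ig; have -> : (fun x => ((g \_ D) x)%:E) = (EFin \o g) \_ D.
  by rewrite restrict_EFin.
by apply/integrable_restrict => //=; rewrite setTI.
Qed.

(** Both sides are the integral of [psi s * g r] over the triangle [0 <= r <= s <= t]; integrating
    [psi] over [[r, t]] gives [phi t - phi r]. *)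
Lemma Fubini_triangle (t : R) phi psi (g : R -> R) : C1 phi psi -> intg t g ->
  RI t (fun s => psi s * RI s g) = RI t (fun r => g r * (phi t - phi r)).
Proof.
move=> Cphi ig.
pose G := g \_ `[0, t]; pose Psi := psi \_ `[0, t].
(* Extension by zero and the indicator of the triangle make both iterated integrals run over the
   whole line. *)
pose k (z : R * R) : \bar R := (Psi z.1 * G z.2 * (z.2 <= z.1)%R%:R)%:E.
have mI : measurable (`[0, t]%classic : set R) by [].
have mG : measurable_fun [set: R] G.
  by apply/(measurable_restrictT _ mI); apply: intg_measurable.
have mPsi : measurable_fun [set: R] Psi.
  apply/(measurable_restrictT _ mI).
  by apply: continuous_measurable_itv => //; case: Cphi.
have mk : measurable_fun [set: R * R] k.
  apply/measurable_EFinP; apply: measurable_funM; last exact: measurable_triangle.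
  apply: measurable_funM.
    by apply: (@measurableT_comp _ _ _ _ _ _ Psi) => //; exact: measurable_fst.
  by apply: (@measurableT_comp _ _ _ _ _ _ G) => //; exact: measurable_snd.
have iG : leb.-integrable setT (EFin \o G).
  exact: integrable_patchT.
have iPsi : leb.-integrable setT (EFin \o Psi).
  by apply: integrable_patchT => //; apply: continuous_intg; case: Cphi.
pose c := fine (\int[leb]_r `|(G r)%:E|)%E.
have cE : (\int[leb]_r `|(G r)%:E|)%E = c%:E.
  by rewrite fineK//; apply: integrable_fin_num => //; exact: integrable_abse.
(* The kernel is dominated by a product of two integrable functions of one variable each. *)
have ik : (leb \x leb)%E.-integrable setT k.
  apply/integrable12ltyP => //.
  apply: (@le_lt_trans _ _ (\int[leb]_s (`|(Psi s)%:E| * c%:E))%E).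
    apply: ge0_le_integral => //.
    - by move=> s _; apply: integral_ge0.
    - apply: (@measurable_fun_fubini_tonelli_F _ _ _ _ _ leb (fun z => `|k z|)%E) => //.
      exact: measurableT_comp.
    - apply: emeasurable_funM => //; apply: measurableT_comp => //.
      exact/measurable_EFinP.
    - move=> s _; rewrite -cE -ge0_integralZl//.
      + apply: ge0_le_integral => //.
        * apply: measurableT_comp => //.
          exact: (@measurableT_comp _ _ _ _ _ _ k _ (fun r => (s, r)) mk (pair1_measurable s)).
        * apply: emeasurable_funM => //; apply: measurableT_comp => //.
          exact/measurable_EFinP.
        move=> r _; rewrite /k /= lee_fin !normrM ler_piMr//.
          by case: (r <= s); rewrite ?normr1 ?normr0.
      + by apply: measurableT_comp => //; exact/measurable_EFinP.
  rewrite ge0_integralZr//.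
  - have [_ hP] := integrableP _ _ _ iPsi.
    have := hP; rewrite -ge0_fin_numE ?integral_ge0// => /fineK <-.
    by rewrite -EFinM ltry.
  - by apply: measurableT_comp => //; exact/measurable_EFinP.
  - by rewrite -cE integral_ge0.
have := Fubini ik.
have -> : (\int[leb]_x \int[leb]_y k (x, y))%E =
   (\int[leb]_(s in `[0%R, t]) (psi s * RI s g)%:E)%E.
  rewrite -RI_restrict; apply: eq_integral => s _.
  rewrite patchE; case: ifPn => st; last first.
    apply: integral0_eq => r _; by rewrite /k /= /Psi patchE (negbTE st) !mul0r.
  move: (st); rewrite inE/= in_itv/= => /andP[s0 s_t].
  have igs : intg s g by apply: intgS ig.
  rewrite /Defs.Rint /Rintegral EFinM fineK; last first.
    exact: (@integrable_fin_num _ _ _ _ _ _ _ igs).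
  rewrite -RI_restrict -integralZl//; last first.
    exact: integrable_patchT.
  apply: eq_integral => r _; rewrite /k /= /Psi patchE st -EFinM /G !patchE.
  rewrite -mulrA; congr (_ * _)%:E.
  have -> : (r \in `[0, s]%classic) = (r \in `[0, t]%classic) && (r <= s).
    apply/idP/andP; rewrite !inE/= !in_itv/=.
      by move=> /andP[-> rs]; rewrite rs (le_trans rs).
    by move=> [/andP[-> _] ->].
  by case: (r \in _) => /=; rewrite ?mul0r//; case: (r <= s); rewrite ?mulr1 ?mulr0.
have -> : (\int[leb]_y \int[leb]_x k (x, y))%E =
   (\int[leb]_(r in `[0%R, t]) (g r * (phi t - phi r))%:E)%E.
  rewrite -RI_restrict; apply: eq_integral => r _.
  rewrite patchE; case: ifPn => rt; last first.
    by apply: integral0_eq => s _; rewrite /k /= /G patchE (negbTE rt) mulr0 mul0r.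
  move: (rt); rewrite inE/= in_itv/= => /andP[r0 r_t].
  have irt : leb.-integrable `[r, t] (EFin \o psi).
    have : intg t psi by apply: continuous_intg; case: Cphi.
    apply: integrableS => // x /=; rewrite !in_itv/= => /andP[rx ->].
    by rewrite (le_trans r0).
  rewrite -(C1_Rint Cphi r_t) /Defs.Rint /Rintegral EFinM fineK; last first.
    exact: (@integrable_fin_num _ _ _ _ _ _ _ irt).
  rewrite integral_mkcond restrict_EFin -integralZl//; last first.
    exact: integrable_patchT.
  apply: eq_integral => s _; rewrite /k /= /Psi /G !patchE rt -EFinM.
  rewrite -mulrA mulrCA; congr (_ * _)%:E.
  have -> : (s \in `[r, t]%classic) = (s \in `[0, t]%classic) && (r <= s).
    apply/idP/andP; rewrite !inE/= !in_itv/=.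
      by move=> /andP[rs ->]; rewrite rs (le_trans r0).
    by move=> [/andP[_ ->] ->].
  by case: (s \in _) => /=; rewrite ?mul0r//; case: (r <= s); rewrite ?mulr1 ?mulr0.
by move=> h; rewrite /Defs.Rint /Rintegral [X in fine X]h.
Qed.

Lemma RI_bounded (t : R) (g : R -> R) : intg t g ->
  forall s, 0 <= s <= t -> `|RI s g| <= RI t (fun r => `|g r|).
Proof.
move=> ig s /andP[s0 st]; apply: le_trans (norm_RI _) _; first exact: intgS ig.
by apply: RI_homo; [rewrite s0|exact: intg_norm|].
Qed.

Lemma RI_by_parts (t : R) phi psi (g P : R -> R) : 0 <= t -> C1 phi psi -> intg t g ->
  (forall s, 0 <= s <= t -> P s = P 0 + RI s g) ->
  phi t * P t = phi 0 * P 0 + RI t (fun s => psi s * P s + phi s * g s).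
Proof.
move=> t0 Cphi ig PE.
have cphi := C1_continuous Cphi; have [_ cpsi] := Cphi.
have [M _ psiM] := continuous_bounded t cpsi.
have [M' _ phiM] := continuous_bounded t cphi.
have mpsi : measurable_fun (`[0, t]%classic : set R) psi by apply: continuous_measurable_itv.
have mphi : measurable_fun (`[0, t]%classic : set R) phi by apply: continuous_measurable_itv.
have iP : intg t (fun s => RI s g).
  apply: (bounded_intg (M := RI t (fun r => `|g r|))); last exact: RI_bounded.
  by apply: (measurable_funS (E := setT)) => //; exact: measurable_Rint.
have i1 : intg t (fun s => psi s * RI s g) by apply: intg_bM psiM _.
have i2 : intg t (fun s => phi s * g s) by apply: intg_bM phiM _.
have i3 : intg t psi by exact: continuous_intg.
rewrite (eq_RI (g := fun s => (P 0 * psi s + psi s * RI s g) + phi s * g s)); last first.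
  by move=> s st; rewrite PE//; ring.
rewrite RID//; last by apply: intgD => //; exact: intgZ.
rewrite RID//; last exact: intgZ.
rewrite RIZ// (C1_Rint Cphi t0) (Fubini_triangle Cphi ig).
rewrite (eq_RI (f := fun r => g r * (phi t - phi r)) (g := fun r => phi t * g r - phi r * g r)); last first.
  by move=> s _; ring.
rewrite RIB//; last exact: intgZ.
rewrite RIZ// PE ?t0 ?lexx//; ring.
Qed.
End ScalarIntegrals.

(** * Matrix exponentials *)

(** A crude matrix norm: it bounds the entries of powers in [norm_expr_entry] and dominates the
    Euclidean operator norm in [enorm_mulmx]. *)
Definition entry_sum (R : realType) k l (M : 'M[R]_(k, l)) : R := \sum_i \sum_j `|M i j|.

Lemma entry_sum_ge0 (R : realType) k l (M : 'M[R]_(k, l)) : 0 <= entry_sum M.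
Proof. by do 2 (apply: sumr_ge0 => ? _). Qed.

Section MatrixExponential.
Variables (R : realType) (n : nat) (M : 'M[R]_n).

(** The exponential is built entry by entry from scalar power series, so that termwise
    differentiation of scalar series applies. *)
Definition mexp_coef (i j : 'I_n) (k : nat) : R := (M ^+ k) i j / k`!%:R.
Definition mexp (t : R) : 'M[R]_n := \matrix_(i, j) limn (pseries (mexp_coef i j) t).

Lemma norm_expr_entry k i j : `|(M ^+ k) i j| <= entry_sum M ^+ k.
Proof.
elim: k i j => [|k IH] i j.
  by rewrite !expr0 mxE; case: (_ == _); rewrite ?normr1 ?normr0.
rewrite !exprS mxE (le_trans (ler_norm_sum _ _ _))//.
apply: (@le_trans _ _ (\sum_l `|M i l| * entry_sum M ^+ k)).
  by apply: ler_sum => l _; rewrite normrM ler_wpM2l.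
rewrite -mulr_suml ler_wpM2r ?exprn_ge0 ?entry_sum_ge0//.
rewrite /entry_sum [leRHS](bigD1 i)//= lerDl.
by do 2 (apply: sumr_ge0 => ? _).
Qed.

Lemma is_cvg_mexp_coef i j t : cvgn (pseries (mexp_coef i j) t).
Proof.
apply: normed_cvg.
apply: (series_le_cvg (v_ := exp_coeff (entry_sum M * `|t|))) => //.
- by move=> k; exact: normr_ge0.
- by move=> k; rewrite /exp_coeff /= mulr_ge0 ?invr_ge0 ?ler0n ?exprn_ge0 ?mulr_ge0 ?entry_sum_ge0.
- move=> k /=; rewrite /exp_coeff /mexp_coef /= !normrM normfV normr_nat normrX exprMn.
  rewrite mulrAC ler_wpM2r ?invr_ge0 ?ler0n// ler_wpM2r ?exprn_ge0//.
  exact: norm_expr_entry.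
- exact: is_cvg_series_exp_coeff.
Qed.

Lemma pseries_diffs_mexp_coef i j :
  pseries_diffs (mexp_coef i j) = (fun k => \sum_l M i l * mexp_coef l j k).
Proof.
apply/funext => k; rewrite /pseries_diffs /mexp_coef exprS mxE.
under [RHS]eq_bigr do rewrite mulrA.
by rewrite -mulr_suml factS natrM invfM mulrCA mulVKf.
Qed.

(** The same formal derivative with the spare factor [M] on the right; comparing it with the left
    form gives [mexp_comm]. *)
Lemma pseries_diffs_mexp_coefr i j :
  pseries_diffs (mexp_coef i j) = (fun k => \sum_l mexp_coef i l k * M l j).
Proof.
apply/funext => k; rewrite pseries_diffs_mexp_coef /mexp_coef.
transitivity ((M ^+ k.+1) i j / k`!%:R).
  by rewrite exprS mxE mulr_suml; apply: eq_bigr => l _; rewrite mulrA.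
by rewrite exprSr mxE mulr_suml; apply: eq_bigr => l _; rewrite mulrAC.
Qed.

Lemma pseries_sum (I : finType) (a : I -> R) (c : I -> nat -> R) t :
  pseries (fun k => \sum_l a l * c l k) t = (fun N => \sum_l a l * pseries (c l) t N).
Proof.
apply/funext => N; rewrite /pseries /series /=.
under eq_bigr do rewrite mulr_suml.
rewrite exchange_big /=; apply: eq_bigr => l _.
by rewrite mulr_sumr; apply: eq_bigr => k _; rewrite mulrA.
Qed.

Lemma cvg_pseries_sum (I : finType) (a : I -> R) (c : I -> nat -> R) t :
  (forall l, cvgn (pseries (c l) t)) ->
  pseries (fun k => \sum_l a l * c l k) t @ \oo --> \sum_l a l * limn (pseries (c l) t).
Proof.
move=> cc; rewrite pseries_sum; apply: cvg_big => //=.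
- exact: add_continuous.
- by move=> l _; apply: cvgM; [exact: cvg_cst|exact: cc].
Qed.

Lemma mexp_derive t i j :
  is_derive t (1 : R) (fun s => mexp s i j) ((M *m mexp t) i j).
Proof.
have -> : (fun s => mexp s i j) = (fun s => limn (pseries (mexp_coef i j) s)).
  by apply/funext => s; rewrite mxE.
have c1 l j' s : cvgn (pseries (fun k => \sum_l' M l l' * mexp_coef l' j' k) s).
  by apply/cvg_ex; eexists; apply: cvg_pseries_sum => l'; exact: is_cvg_mexp_coef.
have -> : (M *m mexp t) i j = limn (pseries (pseries_diffs (mexp_coef i j)) t).
  rewrite pseries_diffs_mexp_coef; apply/esym/cvg_lim => //.
  rewrite mxE; under [X in _ --> X]eq_bigr do rewrite mxE.
  by apply: cvg_pseries_sum => l; exact: is_cvg_mexp_coef.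
(* The series converges everywhere, so any radius larger than the modulus of [t] will do. *)
apply: (@pseries_snd_diffs _ _ (`|t| + 1)).
- exact: is_cvg_mexp_coef.
- by rewrite pseries_diffs_mexp_coef; apply: c1.
- have -> : pseries_diffs (pseries_diffs (mexp_coef i j)) =
     (fun k => \sum_l M i l * pseries_diffs (mexp_coef l j) k).
    apply/funext => k; rewrite {1}pseries_diffs_mexp_coef {1}/pseries_diffs mulr_sumr.
    by apply: eq_bigr => l _; rewrite /pseries_diffs mulrCA.
  apply/cvg_ex; eexists; apply: cvg_pseries_sum => l.
  by rewrite pseries_diffs_mexp_coef.
- by rewrite [ltRHS]ger0_norm ?addr_ge0// ltrDl.
Qed.

Lemma mexp_comm t : M *m mexp t = mexp t *m M.
Proof.
apply/matrixP => i j; transitivity (limn (pseries (pseries_diffs (mexp_coef i j)) t)).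
  rewrite pseries_diffs_mexp_coef; apply/esym/cvg_lim => //.
  rewrite mxE; under [X in _ --> X]eq_bigr do rewrite mxE.
  by apply: cvg_pseries_sum => l; exact: is_cvg_mexp_coef.
rewrite pseries_diffs_mexp_coefr; apply/cvg_lim => //.
rewrite mxE; under [X in _ --> X]eq_bigr do rewrite mxE mulrC.
under [X in pseries X]funext => k do under eq_bigr do rewrite mulrC.
by apply: cvg_pseries_sum => l; exact: is_cvg_mexp_coef.
Qed.

Lemma mexp0 : mexp 0 = 1%:M.
Proof.
apply/matrixP => i j; rewrite mxE; apply/cvg_lim => //.
rewrite -cvg_shiftS /=; apply: cvg_near_cst; apply: nearW => k.
rewrite /pseries /series /= big_nat_recl//= big1 ?addr0.
  by rewrite /mexp_coef !expr0 fact0 divr1 mulr1.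
by move=> l _; rewrite expr0n mulr0.
Qed.

Lemma continuous_sum (I : Type) (r : seq I) (f : I -> R -> R) :
  (forall l, continuous (f l)) -> continuous (fun s => \sum_(l <- r) f l s).
Proof.
move=> fc; elim: r => [|l r IH] x.
  under [X in continuous_at _ X]funext do rewrite big_nil; exact: cvg_cst.
under [X in continuous_at _ X]funext do rewrite big_cons.
by apply: cvgD; [exact: fc|exact: IH].
Qed.

Lemma mexp_continuous i j : continuous (fun s => mexp s i j).
Proof.
move=> x; apply: differentiable_continuous; apply/derivable1_diffP.
by have d := mexp_derive x i j; apply: ex_derive.
Qed.

Lemma mexp_C1 i j : C1 (fun s => mexp s i j) (fun s => (M *m mexp s) i j).
Proof.
split => [x|]; first exact: mexp_derive.
under eq_fun do rewrite mxE; apply: continuous_sum => l x.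
by apply: cvgM; [exact: cvg_cst|exact: mexp_continuous].
Qed.

Lemma C1_opp (f g : R -> R) : C1 f g -> C1 (fun s => f (- s)) (fun s => - g (- s)).
Proof.
move=> [d c]; split => [x|x]; last first.
  by apply: cvgN; apply: (continuous_comp (f := -%R)); [exact: opp_continuous|exact: c].
have dN : is_derive x (1 : R) -%R (- 1) by apply: is_deriveN.
have := @is_derive1_comp _ f -%R x _ _ (d _) dN.
by rewrite mulrN1.
Qed.

Lemma mexpN_C1 i j :
  C1 (fun s => mexp (- s) i j) (fun s => - (mexp (- s) *m M) i j).
Proof.
have := C1_opp (mexp_C1 i j).
by under [X in C1 _ X -> _]eq_fun do rewrite mexp_comm.
Qed.

(** By the product rule each entry of the product has derivative zero, the two terms in [M]
    cancelling, and at time 0 the product is the identity. *)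
Lemma mexpNK t : mexp (- t) *m mexp t = 1%:M.
Proof.
apply/matrixP => i j.
pose h := \sum_(l < n) (fun s => mexp (- s) i l * mexp s l j).
have hE s : (mexp (- s) *m mexp s) i j = h s by rewrite mxE /h fct_sumE.
suff hc : h t = h 0 by rewrite hE hc -hE oppr0 mexp0 mulmx1.
apply: is_derive_0_is_cst => x.
have -> : (0 : R) = \sum_l (mexp (- x) i l * (M *m mexp x) l j
                            + mexp x l j * - (mexp (- x) *m M) i l).
  transitivity ((mexp (- x) *m (M *m mexp x)) i j - (mexp (- x) *m M *m mexp x) i j).
    by rewrite mulmxA subrr.
  rewrite [in X in X - _]mxE [in X in _ - X]mxE -sumrB; apply: eq_bigr => l _.
  by rewrite mulrN mulrC [X in _ - X]mulrC.
have dl l : is_derive x (1 : R) (fun s => mexp (- s) i l * mexp s l j)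
    (mexp (- x) i l * (M *m mexp x) l j + mexp x l j * - (mexp (- x) *m M) i l).
  apply: (is_deriveM (f := fun s => mexp (- s) i l) (g := fun s => mexp s l j)).
    by case: (mexpN_C1 i l).
  exact: mexp_derive.
exact: is_derive_sum.
Qed.

Lemma mexpKN t : mexp t *m mexp (- t) = 1%:M.
Proof. by have := mexpNK (- t); rewrite opprK. Qed.

End MatrixExponential.

(** * Linear systems and their adjoints *)

Section LinearODE.
Variable R : realType.
Local Notation RI := (@Defs.Rint R 0).

Definition vintg (k : nat) (t : R) (f : R -> 'cV[R]_k) := forall i, intg t (fun s => f s i 0).

Lemma vintgS k (s t : R) (f : R -> 'cV[R]_k) : s <= t -> vintg t f -> vintg s f.
Proof. by move=> st fi i; apply: intgS (fi i). Qed.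

Lemma vintgD k t (f g : R -> 'cV[R]_k) :
  vintg t f -> vintg t g -> vintg t (fun s => f s + g s).
Proof.
by move=> fi gi i; apply: eq_intg (intgD (fi i) (gi i)) => s _; rewrite mxE.
Qed.

Lemma vintgZ k t a (f : R -> 'cV[R]_k) : vintg t f -> vintg t (fun s => a *: f s).
Proof. by move=> fi i; apply: eq_intg (intgZ a (fi i)) => s _; rewrite mxE. Qed.

Lemma vintg_mul k l t (M : 'M[R]_(k, l)) (f : R -> 'cV[R]_l) :
  vintg t f -> vintg t (fun s => M *m f s).
Proof.
move=> fi i; apply: (eq_intg (f := fun s => \sum_j M i j * f s j 0)).
  by move=> s _; rewrite mxE.
by apply: intg_sum => j; apply: intgZ.
Qed.

Lemma vint0 k (f : R -> 'cV[R]_k) : vint f 0 0 = 0.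
Proof. by apply/matrixP => i j; rewrite !mxE RI_pt. Qed.

Lemma eq_vint k t (f g : R -> 'cV[R]_k) :
  (forall s, 0 <= s <= t -> f s = g s) -> vint f 0 t = vint g 0 t.
Proof.
by move=> fg; apply/matrixP => i j; rewrite !mxE; apply: eq_RI => s /fg ->.
Qed.

Lemma vint_eq0 k t (f : R -> 'cV[R]_k) :
  (forall s, 0 <= s <= t -> f s = 0) -> vint f 0 t = 0.
Proof.
move=> f0; apply/matrixP => i j; rewrite !mxE -[RHS](RI0 t).
by apply: eq_RI => s /f0 ->; rewrite mxE.
Qed.

Lemma vintN k t (f : R -> 'cV[R]_k) : vintg t f ->
  vint (fun s => - f s) 0 t = - vint f 0 t.
Proof.
move=> fi; apply/matrixP => i j; rewrite !mxE -RIN//.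
by apply: eq_RI => s _; rewrite mxE.
Qed.

Lemma vintD k t (f g : R -> 'cV[R]_k) : vintg t f -> vintg t g ->
  vint (fun s => f s + g s) 0 t = vint f 0 t + vint g 0 t.
Proof.
move=> fi gi; apply/matrixP => i j; rewrite !mxE -RID//.
by apply: eq_RI => s _; rewrite mxE.
Qed.

Lemma vintZ k t a (f : R -> 'cV[R]_k) : vintg t f ->
  vint (fun s => a *: f s) 0 t = a *: vint f 0 t.
Proof.
move=> fi; apply/matrixP => i j; rewrite !mxE -RIZ//.
by apply: eq_RI => s _; rewrite mxE.
Qed.

Lemma intg_contM t (phi g : R -> R) : continuous phi -> intg t g ->
  intg t (fun s => phi s * g s).
Proof.
move=> cphi ig; have [M _ phiM] := continuous_bounded t cphi.
by apply: intg_bM phiM ig; apply: continuous_measurable_itv.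
Qed.

Lemma intg_prim t (g P : R -> R) : intg t g ->
  (forall s, 0 <= s <= t -> P s = P 0 + RI s g) -> intg t P.
Proof.
move=> ig PE; apply: (eq_intg (f := fun s => P 0 + RI s g)).
  by move=> s /PE.
apply: intgD; first exact: intg_cst.
apply: (bounded_intg (M := RI t (fun r => `|g r|))); last exact: RI_bounded.
by apply: (measurable_funS (E := setT)) => //; exact: measurable_Rint.
Qed.

Section Solutions.
Variables (n : nat) (M : 'M[R]_n).

Lemma mx_by_parts t (E E' : R -> 'M[R]_n) (g P : R -> 'cV[R]_n) : 0 <= t ->
  (forall i j, C1 (fun s => E s i j) (fun s => E' s i j)) -> vintg t g ->
  (forall s, 0 <= s <= t -> P s = P 0 + vint g 0 s) ->
  E t *m P t = E 0 *m P 0 + vint (fun s => E' s *m P s + E s *m g s) 0 t.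
Proof.
move=> t0 EC ig PE; apply/matrixP => i j; rewrite !mxE ord1 {j}.
have PEj j s : 0 <= s <= t -> P s j 0 = P 0 j 0 + RI s (fun r => g r j 0).
  by move=> /PE ->; rewrite !mxE.
have iP j : intg t (fun s => P s j 0) by apply: intg_prim (ig j) (PEj j).
under eq_bigr => j _ do rewrite (RI_by_parts t0 (EC i j) (ig j) (PEj j)).
rewrite big_split /=; congr (_ + _).
rewrite -RI_sum => [|j].
  by apply: eq_RI => s _; rewrite !mxE -big_split /=; apply: eq_bigr => j _.
apply: intgD; apply: intg_contM => //; first by case: (EC i j).
exact: C1_continuous (EC i j).
Qed.

Lemma vintg_contM t (E : R -> 'M[R]_n) (f : R -> 'cV[R]_n) :
  (forall i j, continuous (fun s => E s i j)) -> vintg t f ->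
  vintg t (fun s => E s *m f s).
Proof.
move=> cE fi i; apply: (eq_intg (f := fun s => \sum_j E s i j * f s j 0)).
  by move=> s _; rewrite mxE.
by apply: intg_sum => j; apply: intg_contM.
Qed.

(** The integrating factor [mexp M (- s)] cancels the terms in [M]. Uniqueness for the linear
    problem follows without a Gronwall estimate. *)
Lemma variation_of_constants t (x0 : 'cV[R]_n) (f x : R -> 'cV[R]_n) : 0 <= t ->
  vintg t f -> vintg t x ->
  (forall s, 0 <= s <= t -> x s = x0 + vint (fun r => M *m x r + f r) 0 s) ->
  x t = mexp M t *m (x0 + vint (fun s => mexp M (- s) *m f s) 0 t).
Proof.
move=> t0 fi xi xE.
have x00 : x 0 = x0 by rewrite xE ?lexx// vint0 addr0.
have h := @mx_by_parts t (fun s => mexp M (- s)) (fun s => - (mexp M (- s) *m M))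
  (fun r => M *m x r + f r) x t0.
have {h}h : mexp M (- t) *m x t = x0 + vint (fun s => mexp M (- s) *m f s) 0 t.
  rewrite h.
  - rewrite oppr0 mexp0 mul1mx x00; congr (_ + _); apply: eq_vint => s _.
    by rewrite mulmxDr mulNmx mulmxA addrA addNr add0r.
  - by move=> i j; under [X in C1 _ X]eq_fun do rewrite mxE; exact: mexpN_C1.
  - by apply: vintgD => //; exact: vintg_mul.
  - by move=> s st; rewrite x00 xE.
by rewrite -h mulmxA mexpKN mul1mx.
Qed.

(** The converse of [variation_of_constants], by integrating [mexp M] by parts against the primitive
    [P] below. *)
Lemma duhamel_sol T (x0 : 'cV[R]_n) (f x : R -> 'cV[R]_n) :
  vintg T f ->
  (forall t, 0 <= t <= T ->
     x t = mexp M t *m (x0 + vint (fun s => mexp M (- s) *m f s) 0 t)) ->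
  forall t, 0 <= t <= T -> x t = x0 + vint (fun s => M *m x s + f s) 0 t.
Proof.
move=> fi xE t /andP[t0 tT].
pose P t := x0 + vint (fun s => mexp M (- s) *m f s) 0 t.
have P0 : P 0 = x0 by rewrite /P vint0 addr0.
have cN i j : continuous (fun s => mexp M (- s) i j).
  exact: C1_continuous (mexpN_C1 M i j).
have h := @mx_by_parts t (mexp M) (fun s => M *m mexp M s)
  (fun s => mexp M (- s) *m f s) P t0.
rewrite xE ?t0// h.
- rewrite mexp0 mul1mx P0; congr (_ + _); apply: eq_vint => s /andP[s0 st].
  rewrite xE ?s0 ?(le_trans st)// !mulmxA; congr (_ + _).
  by rewrite mexpKN mul1mx.
- by move=> i j; exact: mexp_C1.
- by apply: vintg_contM => //; apply: vintgS fi.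
- by move=> s _; rewrite P0.
Qed.

Lemma mexp_mul_C1 (y0 : 'cV[R]_n) i :
  C1 (fun s => (mexp M s *m y0) i 0) (fun s => (M *m (mexp M s *m y0)) i 0).
Proof.
have cE j : continuous (fun s => mexp M s i j) by exact: mexp_continuous.
have -> : (fun s => (mexp M s *m y0) i 0) = \sum_j (y0 j 0 \*: (fun s => mexp M s i j)).
  apply/funext => s; rewrite mxE fct_sumE; apply: eq_bigr => j _ /=.
  by rewrite /= mulrC.
split => [s|].
  have -> : (M *m (mexp M s *m y0)) i 0 = \sum_j (y0 j 0 *: ((M *m mexp M s) i j)).
    by rewrite mulmxA mxE; apply: eq_bigr => j _; rewrite mulrC.
  have dl l : is_derive s (1 : R) (y0 l 0 \*: (fun s => mexp M s i l)) (y0 l 0 *: ((M *m mexp M s) i l)).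
    by apply: is_deriveZ; exact: mexp_derive.
  exact: is_derive_sum.
under eq_fun do rewrite mulmxA mxE; apply: continuous_sum => j s.
apply: cvgM; last exact: cvg_cst.
by case: (mexp_C1 M i j) => _; apply.
Qed.

End Solutions.

Lemma dotvE k (x y : 'cV[R]_k) : dotv x y = (x^T *m y) 0 0.
Proof. by rewrite mxE; apply: eq_bigr => i _; rewrite mxE. Qed.

Lemma dotvC k (x y : 'cV[R]_k) : dotv x y = dotv y x.
Proof. by apply: eq_bigr => i _; rewrite mulrC. Qed.

Lemma dotvDr k (x y z : 'cV[R]_k) : dotv x (y + z) = dotv x y + dotv x z.
Proof. by rewrite !dotvE mulmxDr mxE. Qed.

Lemma dotvZr k a (x y : 'cV[R]_k) : dotv x (a *: y) = a * dotv x y.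
Proof. by rewrite !dotvE -scalemxAr mxE. Qed.

Lemma dotvDl k (x y z : 'cV[R]_k) : dotv (x + y) z = dotv x z + dotv y z.
Proof. by rewrite dotvC dotvDr !(dotvC z). Qed.

Lemma dotvZl k a (x y : 'cV[R]_k) : dotv (a *: x) y = a * dotv x y.
Proof. by rewrite dotvC dotvZr (dotvC y). Qed.

Lemma dotvNl k (x y : 'cV[R]_k) : dotv (- x) y = - dotv x y.
Proof. by rewrite -scaleN1r dotvZl mulN1r. Qed.

Lemma dotv_trmx k l (A : 'M[R]_(k, l)) (y : 'cV[R]_k) (x : 'cV[R]_l) :
  dotv (A^T *m y) x = dotv y (A *m x).
Proof. by rewrite !dotvE trmx_mul trmxK mulmxA. Qed.

(** When [x] is paired with a solution of the adjoint flow, the terms in [A] and [- A^T] cancel and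
    only the forcing is left. *)
Lemma duality n (A : 'M[R]_n) t (x0 y0 : 'cV[R]_n) (f x : R -> 'cV[R]_n) : 0 <= t ->
  vintg t f -> vintg t x ->
  (forall s, 0 <= s <= t -> x s = x0 + vint (fun r => A *m x r + f r) 0 s) ->
  dotv (x t) (mexp (- A^T) t *m y0) =
  dotv x0 y0 + RI t (fun s => dotv (mexp (- A^T) s *m y0) (f s)).
Proof.
move=> t0 fi xi xE.
have x00 : x 0 = x0 by rewrite xE ?lexx// vint0 addr0.
pose y s := mexp (- A^T) s *m y0.
have gi : vintg t (fun r => A *m x r + f r) by apply: vintgD => //; exact: vintg_mul.
have xEj j s : 0 <= s <= t -> x s j 0 = x 0 j 0 + RI s (fun r => (A *m x r + f r) j 0).
  by rewrite x00 => /xE ->; rewrite !mxE.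
have yC j := mexp_mul_C1 (- A^T) y0 j.
rewrite -/(y t) /dotv.
under eq_bigr => j _ do
  rewrite mulrC (RI_by_parts t0 (yC j) (gi j) (xEj j)).
rewrite big_split /=; congr (_ + _).
  by apply: eq_bigr => j _; rewrite mexp0 mul1mx x00 mulrC.
rewrite -RI_sum => [|j].
  apply: eq_RI => s _; rewrite -/(y s) big_split /= -/(dotv _ (x s)) -/(dotv (y s) _).
  by rewrite mulNmx dotvNl dotvDr dotv_trmx addrA addNr add0r.
apply: intgD; apply: intg_contM => //; first by case: (yC j).
exact: C1_continuous (yC j).
Qed.

(** Gives [isAdjP] one continuation step that is valid for all components at once. *)
Lemma common_pos (I : finType) (P : I -> R -> Prop) :
  (forall i e e', 0 < e' <= e -> P i e -> P i e') ->
  (forall i, exists2 e, 0 < e & P i e) -> exists2 e, 0 < e & forall i, P i e.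
Proof.
move=> Pd Pe.
have /choice[f fP] : forall i, exists e, 0 < e /\ P i e.
  by move=> i; have [e e0 Pie] := Pe i; exists e.
have S0 : 0 <= \sum_j (f j)^-1.
  by apply: sumr_ge0 => j _; rewrite invr_ge0 ltW// (fP j).1.
(* The sum of the inverses dominates each of them; the added 1 keeps it positive when the index set
   is empty. *)
exists (1 + \sum_j (f j)^-1)^-1 => [|i]; first by rewrite invr_gt0 ltr_pwDl.
have [fi0 fiP] := fP i; apply: Pd fiP.
rewrite invr_gt0 ltr_pwDl//= -[leRHS]invrK lef_pV2 ?posrE ?invr_gt0 ?ltr_pwDl//.
rewrite (bigD1 i)//= addrCA lerDl addr_ge0// sumr_ge0// => j _.
by rewrite invr_ge0 ltW// (fP j).1.
Qed.

(* [fine] turns the infinite values of a divergent integral into 0. *)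
Lemma RI_junk t (f : R -> R) : measurable_fun (`[0, t]%classic : set R) f ->
  ~ intg t f -> RI t f = 0.
Proof.
move=> mf nf; rewrite /Defs.Rint /Rintegral.
have : ~~ ((\int[@lebesgue_measure R]_(x in `[0%R, t]) (f x)%:E)%E \is a fin_num).
  apply/negP; rewrite -integral_fin_num_abs// => h; apply: nf.
  by apply/integrableP; split => //; exact/measurable_EFinP.
by rewrite fin_numE negb_and !negbK => /orP[] /eqP ->.
Qed.

(** * Adjoint solutions, known only through their integral identity *)

Section Adjoint.
Variables (n : nat) (T : R) (A : 'M[R]_n).

Lemma isAdj_mexp (y0 : 'cV[R]_n) : isAdj T A (fun t => mexp (- A^T) t *m y0).
Proof.
move=> t /andP[t0 tT]; rewrite mexp0 mul1mx.
have i0 k : vintg t (fun=> (0 : 'cV[R]_k)).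
  by move=> i; apply: eq_intg (intg0 _) => s _; rewrite mxE.
rewrite {1}(@duhamel_sol _ (- A^T) t y0 (fun=> 0) (fun s => mexp (- A^T) s *m y0))//; last 2 first.
- move=> s /andP[s0 st]; congr (_ *m _); rewrite -[LHS]addr0; congr (_ + _).
  by rewrite vint_eq0// => r _; rewrite mulmx0.
- by rewrite t0 lexx.
congr (_ + _); rewrite -vintN.
  by apply: eq_vint => s _; rewrite addr0 mulNmx.
apply: vintg_mul => i; apply: continuous_intg.
exact: C1_continuous (mexp_mul_C1 _ _ _).
Qed.

(** Integrability is what variation of constants, used here with zero forcing, asks of [y]. *)
Lemma isAdj_integrable (y : R -> 'cV[R]_n) t : 0 <= t <= T -> isAdj T A y ->
  vintg t y -> y t = mexp (- A^T) t *m y 0.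
Proof.
move=> /andP[t0 tT] ya yi.
rewrite (@variation_of_constants _ (- A^T) t (y 0) (fun=> 0) y)//; last 2 first.
- by move=> i; apply: eq_intg (intg0 _) => s _; rewrite mxE.
- move=> s /andP[s0 st]; rewrite ya ?s0 ?(le_trans st)//; congr (_ + _).
  rewrite -vintN; first by apply: eq_vint => r _; rewrite addr0 mulNmx.
  by apply: vintg_mul; apply: vintgS yi.
congr (_ *m _); rewrite -[RHS]addr0; congr (_ + _).
by rewrite vint_eq0// => r _; rewrite mulmx0.
Qed.

(** The identity makes [y] a constant minus a function of the upper bound of an integral, measurable
    by [measurable_Rint] whatever the integrand. *)
Lemma isAdj_measurable (y : R -> 'cV[R]_n) (t : R) i : t <= T -> isAdj T A y ->
  measurable_fun (`[0, t]%classic : set R) (fun s => y s i 0).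
Proof.
move=> tT ya.
apply: (eq_measurable_fun (fun s => y 0 i 0 - RI s (fun r => (A^T *m y r) i 0))).
  move=> s; rewrite inE/= in_itv/= => /andP[s0 st].
  by rewrite [in RHS]ya ?s0 ?(le_trans st)// !mxE.
apply: measurable_funB; first exact: measurable_cst.
by apply: (measurable_funS (E := setT)) => //; exact: measurable_Rint.
Qed.

Lemma mexp_mul_bounded (N : 'M[R]_n) t (y0 : 'cV[R]_n) :
  exists2 K, 0 <= K & forall s i, 0 <= s <= t -> `|(mexp N s *m y0) i 0| <= K.
Proof.
have /choice[K KP] : forall i, exists K, 0 <= K /\
    forall s, 0 <= s <= t -> `|(mexp N s *m y0) i 0| <= K.
  move=> i.
  have [K K0 KP] := continuous_bounded t (C1_continuous (mexp_mul_C1 N y0 i)).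
  by exists K.
exists (\sum_i K i) => [|s i st]; first by apply: sumr_ge0 => i _; case: (KP i).
apply: le_trans ((KP i).2 _ st) _.
by rewrite (bigD1 i)//= lerDl sumr_ge0// => j _; case: (KP j).
Qed.

(* Continuation: past the supremum of the times up to which [y] is integrable, each
   component either stays integrable for a while or its integral term vanishes by [RI_junk]. *)
Lemma isAdjP (y : R -> 'cV[R]_n) : 0 <= T -> isAdj T A y ->
  forall t, 0 <= t <= T -> y t = mexp (- A^T) t *m y 0.
Proof.
move=> T0 ya.
have [K K0 KP] := mexp_mul_bounded (- A^T) T (y 0).
pose G := [set t : R | 0 <= t <= T /\ vintg t y].
have G0 : G 0.
  split; first by rewrite lexx.
  move=> i; apply: (@bounded_intg _ _ _ `|y 0 i 0|).
    exact: isAdj_measurable.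
  by move=> s /andP[s0 s0']; have -> : s = 0 by apply/le_anti/andP.
have Gub : ubound G T by move=> t [/andP[_ ?] _].
have hG : has_sup G by split; [exists 0|exists T].
set s := sup G.
have s0 : 0 <= s by apply: ub_le_sup => //; exists T.
have sT : s <= T by apply: ge_sup => //; exists 0.
have Gs t : 0 <= t < s -> y t = mexp (- A^T) t *m y 0.
  move=> /andP[t0 ts]; have := @sup_adherent _ G (s - t); rewrite subr_gt0.
  move=> /(_ ts hG)[t' [/andP[t'0 t'T] it']]; rewrite subKr => tt'.
  apply: isAdj_integrable => //; first by rewrite t0 (le_trans (ltW ts)).
  by apply: vintgS it'; apply: ltW.
pose K' := K + \sum_i `|y s i 0|.
have K'P t i : 0 <= t <= s -> `|y t i 0| <= K'.
  move=> /andP[t0]; rewrite le_eqVlt => /predU1P[->|ts].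
    by rewrite /K' (bigD1 i)//= addrCA lerDl addr_ge0// sumr_ge0.
  rewrite Gs ?t0// (le_trans (KP _ _ _))//.
    by rewrite t0 (le_trans (ltW ts)).
  by rewrite lerDl sumr_ge0.
have Gss : vintg s y.
  move=> i; apply: (@bounded_intg _ _ _ K'); first exact: isAdj_measurable.
  by move=> t st; apply: K'P.
have [sT'|] := eqVneq s T.
  move=> t /andP[t0 tT]; apply: isAdj_integrable => //; first by rewrite t0.
  by apply: vintgS Gss; rewrite sT'.
move=> sT'; exfalso.
have {sT' sT} sT : s < T by rewrite lt_neqAle sT'.
pose g i r := (A^T *m y r) i 0.
have mg i t : t <= T -> measurable_fun (`[0, t]%classic : set R) (g i).
  move=> tT; apply: (eq_measurable_fun (fun r => \sum_j (A^T) i j * y r j 0)).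
    by move=> r _; rewrite /g mxE.
  apply: measurable_sum => j; apply: measurable_funM; first exact: measurable_cst.
  exact: isAdj_measurable.
have yE t i : 0 <= t <= T -> y t i 0 = y 0 i 0 - RI t (g i).
  by move=> tT; rewrite ya// !mxE.
(* A step [e] past the supremum on which component [i] stays bounded. A common step for all
   components would put [s + e] in [G], against the choice of [s]. *)
pose P i e := s + e <= T /\ exists L, forall t, 0 <= t <= s + e -> `|y t i 0| <= L.
have [|i|e e0 eP] := @common_pos _ P.
- move=> i e e' /andP[e'0 e'e] [seT [L LP]]; split.
    by rewrite (le_trans _ seT)// lerD2l.
  exists L => t /andP[t0 ts]; apply: LP; rewrite t0 (le_trans ts)//.
  by rewrite lerD2l.
- have [[e [e0 [seT ig]]]|nex] := pselect (exists e, 0 < e /\ s + e <= T /\ intg (s + e) (g i)).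
    exists e => //; split => //.
    exists (`|y 0 i 0| + RI (s + e) (fun r => `|g i r|)) => t /andP[t0 ts].
    rewrite yE ?t0 ?(le_trans ts)// (le_trans (ler_normB _ _))// lerD2l.
    by apply: RI_bounded; rewrite ?t0.
  exists (T - s); first by rewrite subr_gt0.
  rewrite /P subrKC lexx; split => //; exists (K' + `|y 0 i 0|) => t /andP[t0 tT].
  have [ts|st] := leP t s.
    by rewrite (le_trans (K'P t i _)) ?t0// lerDl.
  rewrite yE ?t0// RI_junk ?subr0 ?lerDr ?addr_ge0 ?sumr_ge0//; first exact: mg.
  move=> ig; apply: nex; exists (t - s).
  by rewrite subr_gt0 subrKC.
- have [seT|nseT] := leP (s + e) T; last first.
    (* In dimension 0 integrability is vacuous, so [T] itself lies in [G]. *)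
    have [n0|n0] := posnP n; last by have [] := eP (Ordinal n0); rewrite leNgt nseT.
    have : G T.
      by split => [|i]; [rewrite lexx T0|have := leq_trans (ltn_ord i) (eq_leq n0)].
    by move=> /(ub_le_sup (proj2 hG)); rewrite -/s leNgt sT.
  have : G (s + e).
    split; first by rewrite addr_ge0 ?(ltW e0).
    move=> i; have [_ [L LP]] := eP i.
    by apply: (@bounded_intg _ _ _ L) => //; exact: isAdj_measurable.
  move=> /(ub_le_sup (proj2 hG)); rewrite -/s leNgt => /negP; apply.
  by rewrite ltrDl.
Qed.

End Adjoint.
End LinearODE.

(** * Square integrable functions *)

Section EuclideanNorm.
Variable R : realType.

(** Stated for a bare nonnegative quadratic so that it serves vectors, L^2 functions and the
    stationarity of [J b] alike; [c = 0] is allowed because the L^2 form is only semidefinite on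
    functions. *)
Lemma quadratic_CauchySchwarz (a b c : R) : 0 <= a -> 0 <= c ->
  (forall s, 0 <= a + 2 * b * s + c * s ^+ 2) ->
  `|b| <= Num.sqrt a * Num.sqrt c.
Proof.
move=> a0 c0 h.
suff bac : b ^+ 2 <= a * c by rewrite -sqrtr_sqr -sqrtrM// ler_sqrt// mulr_ge0.
have [c0'|cn0] := eqVneq c 0.
  have [->|bn0] := eqVneq b 0; first by rewrite expr0n mulr_ge0.
  (* With [c = 0] and [b] nonzero the expression is affine in [s], and here it takes the value
     -1. *)
  have := h (- (a + 1) / (2 * b)); rewrite c0' mul0r addr0 mulrCA mulfV ?mulr1; last first.
    by rewrite mulf_neq0// pnatr_eq0.
  by rewrite opprD addrA subrr sub0r oppr_ge0 leNgt ltr01.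
have cgt0 : 0 < c by rewrite lt_neqAle eq_sym cn0.
(* The minimum of the quadratic. *)
have := h (- b / c).
have -> : a + 2 * b * (- b / c) + c * (- b / c) ^+ 2 = (a * c - b ^+ 2) / c by field.
by rewrite pmulr_lge0 ?invr_gt0// subr_ge0.
Qed.

Lemma quadratic_triangle (a b c : R) : 0 <= a -> 0 <= c ->
  (forall s, 0 <= a + 2 * b * s + c * s ^+ 2) ->
  Num.sqrt (a + 2 * b + c) <= Num.sqrt a + Num.sqrt c.
Proof.
move=> a0 c0 h.
have /(le_trans (ler_norm _)) bac := quadratic_CauchySchwarz a0 c0 h.
rewrite -[leRHS]ger0_norm ?addr_ge0 ?sqrtr_ge0// -sqrtr_sqr ler_sqrt ?sqr_ge0//.
rewrite sqrrD !sqr_sqrtr//; lra.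
Qed.

Lemma dotv_ge0 k (x : 'cV[R]_k) : 0 <= dotv x x.
Proof. by apply: sumr_ge0 => i _; rewrite -expr2 sqr_ge0. Qed.

Lemma enormE k (x : 'cV[R]_k) : enorm x = Num.sqrt (dotv x x).
Proof. by []. Qed.

Lemma enorm_ge0 k (x : 'cV[R]_k) : 0 <= enorm x.
Proof. exact: sqrtr_ge0. Qed.

Lemma enorm_sqr k (x : 'cV[R]_k) : enorm x ^+ 2 = dotv x x.
Proof. by rewrite enormE sqr_sqrtr// dotv_ge0. Qed.

Lemma dotv_lincomb k (x y : 'cV[R]_k) s :
  dotv (x + s *: y) (x + s *: y) = dotv x x + 2 * dotv x y * s + dotv y y * s ^+ 2.
Proof. rewrite !(dotvDl, dotvDr, dotvZl, dotvZr) (dotvC y x); ring. Qed.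

Lemma dotv_quad_ge0 k (x y : 'cV[R]_k) s :
  0 <= dotv x x + 2 * dotv x y * s + dotv y y * s ^+ 2.
Proof. by rewrite -dotv_lincomb dotv_ge0. Qed.

Lemma enormD k (x y : 'cV[R]_k) : enorm (x + y) <= enorm x + enorm y.
Proof.
have := dotv_lincomb x y 1; rewrite scale1r mulr1 expr1n mulr1 enormE => ->.
by apply: quadratic_triangle; rewrite ?dotv_ge0// => s; apply: dotv_quad_ge0.
Qed.

Lemma enormZ k a (x : 'cV[R]_k) : enorm (a *: x) = `|a| * enorm x.
Proof.
by rewrite !enormE dotvZl dotvZr mulrA -expr2 sqrtrM ?sqr_ge0// sqrtr_sqr.
Qed.

Lemma enorm0 k : enorm (0 : 'cV[R]_k) = 0.
Proof. by rewrite -(scale0r (0 : 'cV[R]_k)) enormZ normr0 mul0r. Qed.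

Lemma enormN k (x : 'cV[R]_k) : enorm (- x) = enorm x.
Proof. by rewrite -scaleN1r enormZ normrN normr1 mul1r. Qed.

Lemma ler_entry_enorm k (x : 'cV[R]_k) i : `|x i 0| <= enorm x.
Proof.
rewrite -sqrtr_sqr ler_sqrt; last by apply: sumr_ge0 => j _; exact: sqr_ge0.
by rewrite (bigD1 i)//= lerDl; apply: sumr_ge0 => j _; exact: sqr_ge0.
Qed.

Lemma enorm_entries k (x : 'cV[R]_k) : enorm x <= \sum_i `|x i 0|.
Proof.
have S0 : 0 <= \sum_i `|x i 0| by apply: sumr_ge0.
rewrite -[leRHS]ger0_norm// -sqrtr_sqr ler_sqrt ?sqr_ge0//.
rewrite expr2 mulr_suml; apply: ler_sum => i _.
rewrite -[_ ^+ 2]ger0_norm ?sqr_ge0// normrX expr2 ler_wpM2l// (bigD1 i)//= lerDl; exact: sumr_ge0.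
Qed.

Lemma enorm_eq0 k (x : 'cV[R]_k) : enorm x = 0 -> x = 0.
Proof.
move=> x0; apply/matrixP => i j; rewrite ord1 mxE.
by have := ler_entry_enorm x i; rewrite x0 normr_le0 => /eqP.
Qed.

Lemma enorm_mulmx k l (M : 'M[R]_(k, l)) (x : 'cV[R]_l) :
  enorm (M *m x) <= entry_sum M * enorm x.
Proof.
apply: le_trans (enorm_entries _) _.
rewrite /entry_sum mulr_suml; apply: ler_sum => i _.
rewrite mxE (le_trans (ler_norm_sum _ _ _))// mulr_suml; apply: ler_sum => j _.
by rewrite normrM ler_wpM2l// ler_entry_enorm.
Qed.

End EuclideanNorm.

(** * The space L^2 over [0, T] and equality almost everywhere *)

Section L2.
Variables (R : realType) (T : R).
Local Notation leb := (@lebesgue_measure R).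
Local Notation RI := (@Defs.Rint R 0).
Hypothesis T0 : 0 <= T.

Lemma enorm_sqr_measurable k (f : R -> 'cV[R]_k) (D : set R) :
  (forall i, measurable_fun D (fun t => f t i 0)) ->
  measurable_fun D (fun t => enorm (f t) ^+ 2).
Proof.
move=> mf; under eq_fun do rewrite enorm_sqr.
by apply: measurable_sum => i; apply: measurable_funM.
Qed.

Lemma isL2P k (f : R -> 'cV[R]_k) : isL2 T f <->
  (forall i, measurable_fun (`[0, T]%classic : set R) (fun t => f t i 0)) /\
  intg T (fun t => enorm (f t) ^+ 2).
Proof.
have absE : (\int[leb]_(t in `[0%R, T]) `|(EFin \o (fun t => (enorm (f t) ^+ 2)%R)) t|)%E =
    (\int[leb]_(t in I0T T) (enorm (f t) ^+ 2)%:E)%E.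
  by apply: eq_integral => t _; rewrite /= ger0_norm// sqr_ge0.
split=> -[mf h]; split => //; last first.
  by have [_] := integrableP _ _ _ h; rewrite absE.
apply/integrableP; split; last by rewrite absE.
by apply/measurable_EFinP; exact: enorm_sqr_measurable.
Qed.

Lemma isL2_measurable k (f : R -> 'cV[R]_k) i : isL2 T f ->
  measurable_fun (`[0, T]%classic : set R) (fun t => f t i 0).
Proof. by case. Qed.

Lemma isL2_sqr k (f : R -> 'cV[R]_k) : isL2 T f -> intg T (fun t => dotv (f t) (f t)).
Proof. by move=> /isL2P[_]; apply: eq_intg => s _; rewrite enorm_sqr. Qed.

Lemma L2normE k (f : R -> 'cV[R]_k) : L2norm T f = Num.sqrt (RI T (fun t => dotv (f t) (f t))).
Proof. by congr Num.sqrt; apply: eq_RI => s _; rewrite enorm_sqr. Qed.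

Lemma L2norm_ge0 k (f : R -> 'cV[R]_k) : 0 <= L2norm T f.
Proof. exact: sqrtr_ge0. Qed.

Lemma L2norm_sqr k (f : R -> 'cV[R]_k) : L2norm T f ^+ 2 = RI T (fun t => enorm (f t) ^+ 2).
Proof. by rewrite sqr_sqrtr//; apply: RI_ge0 => s _; rewrite sqr_ge0. Qed.

Lemma eq_L2norm k (f g : R -> 'cV[R]_k) : (forall t, 0 <= t <= T -> f t = g t) ->
  L2norm T f = L2norm T g.
Proof. by move=> fg; congr Num.sqrt; apply: eq_RI => s /fg ->. Qed.

Lemma eq_isL2 k (f g : R -> 'cV[R]_k) : (forall t, 0 <= t <= T -> f t = g t) ->
  isL2 T f -> isL2 T g.
Proof.
move=> fg /isL2P[mf fi]; apply/isL2P; split.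
  move=> i; apply: eq_measurable_fun (mf i) => s.
  by rewrite inE/= in_itv/= => /fg ->.
by apply: eq_intg fi => s /fg ->.
Qed.

Lemma isL2_dotv k (f g : R -> 'cV[R]_k) : isL2 T f -> isL2 T g ->
  intg T (fun t => dotv (f t) (g t)).
Proof.
move=> fL gL; apply: (@le_intg _ _ _ (fun t => dotv (f t) (f t) + dotv (g t) (g t))).
- by apply: measurable_sum => i; apply: measurable_funM; apply: isL2_measurable.
- move=> s _; have := dotv_quad_ge0 (f s) (g s) 1.
  have := dotv_quad_ge0 (f s) (g s) (-1).
  have := dotv_ge0 (f s); have := dotv_ge0 (g s).
  rewrite sqrrN expr1n ler_norml; lra.
- by apply: intgD; apply: isL2_sqr.
Qed.

Lemma isL2D k (f g : R -> 'cV[R]_k) : isL2 T f -> isL2 T g -> isL2 T (fun t => f t + g t).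
Proof.
move=> fL gL; apply/isL2P; split.
  move=> i; apply: (eq_measurable_fun (fun t => f t i 0 + g t i 0)) => [t _|].
    by rewrite mxE.
  by apply: measurable_funD; apply: isL2_measurable.
apply: (@eq_intg _ _ (fun t => dotv (f t) (f t) + (2 * dotv (f t) (g t) + dotv (g t) (g t)))).
  move=> s _; rewrite enorm_sqr.
  by have := dotv_lincomb (f s) (g s) 1; rewrite scale1r mulr1 expr1n mulr1 addrA => ->.
by do ![apply: intgD]; [exact: isL2_sqr|apply/intgZ/isL2_dotv|exact: isL2_sqr].
Qed.

Lemma isL2Z k a (f : R -> 'cV[R]_k) : isL2 T f -> isL2 T (fun t => a *: f t).
Proof.
move=> fL; apply/isL2P; split.
  move=> i; apply: (eq_measurable_fun (fun t => a * f t i 0)) => [t _|].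
    by rewrite mxE.
  by apply: measurable_funM; [exact: measurable_cst|apply: isL2_measurable].
apply: (@eq_intg _ _ (fun t => a ^+ 2 * dotv (f t) (f t))).
  by move=> s _; rewrite enorm_sqr dotvZl dotvZr mulrA.
exact/intgZ/isL2_sqr.
Qed.

Lemma isL2N k (f : R -> 'cV[R]_k) : isL2 T f -> isL2 T (fun t => - f t).
Proof. by move=> /(isL2Z (-1)); apply: eq_isL2 => t _; rewrite scaleN1r. Qed.

Lemma isL2B k (f g : R -> 'cV[R]_k) : isL2 T f -> isL2 T g -> isL2 T (fun t => f t - g t).
Proof. by move=> fL gL; apply: isL2D => //; apply: isL2N. Qed.

Lemma isL2_bounded k (f : R -> 'cV[R]_k) M :
  (forall i, measurable_fun (`[0, T]%classic : set R) (fun t => f t i 0)) ->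
  (forall t, 0 <= t <= T -> enorm (f t) <= M) -> isL2 T f.
Proof.
move=> mf fM; apply/isL2P; split => //.
apply: (bounded_intg (M := M ^+ 2)); first exact: enorm_sqr_measurable.
by move=> s st; rewrite ger0_norm ?sqr_ge0// ler_sqr ?nnegrE ?fM// ?enorm_ge0// (le_trans (enorm_ge0 (f s))) ?fM.
Qed.

Lemma isL20 k : isL2 T (fun=> 0 : 'cV[R]_k).
Proof.
apply: (@isL2_bounded _ _ 0); last by move=> t _; rewrite enorm0.
by move=> i; exact: measurable_cst.
Qed.

Lemma isL2_sum k (I : eqType) (r : seq I) (F : I -> R -> 'cV[R]_k) :
  (forall i, i \in r -> isL2 T (F i)) -> isL2 T (fun t => \sum_(i <- r) F i t).
Proof.
elim: r => [|i r IH] FL.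
  by apply: eq_isL2 (isL20 k) => t _; rewrite big_nil.
have /isL2D : isL2 T (F i) by apply: FL; rewrite mem_head.
move=> /(_ _ (IH _)); move=> h; apply: eq_isL2 (h _) => [t _|j jr].
  by rewrite big_cons.
by apply: FL; rewrite inE jr orbT.
Qed.

Lemma L2norm_bounded k (f : R -> 'cV[R]_k) M :
  (forall i, measurable_fun (`[0, T]%classic : set R) (fun t => f t i 0)) ->
  0 <= M -> (forall t, 0 <= t <= T -> enorm (f t) <= M) -> L2norm T f <= M * Num.sqrt T.
Proof.
move=> mf M0 fM; have /isL2P[_ fi] := isL2_bounded mf fM.
rewrite -[M in leRHS]ger0_norm// -sqrtr_sqr -sqrtrM ?sqr_ge0// ler_sqrt ?mulr_ge0 ?sqr_ge0//.
rewrite -RI_cst//; apply: le_RI => //; first exact: intg_cst.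
by move=> s st; rewrite ler_sqr ?nnegrE ?enorm_ge0 ?fM.
Qed.

Lemma RI_quad k (f g : R -> 'cV[R]_k) s : isL2 T f -> isL2 T g ->
  RI T (fun t => dotv (f t + s *: g t) (f t + s *: g t)) =
  RI T (fun t => dotv (f t) (f t)) + 2 * RI T (fun t => dotv (f t) (g t)) * s
  + RI T (fun t => dotv (g t) (g t)) * s ^+ 2.
Proof.
move=> fL gL.
have i1 := isL2_sqr fL; have i2 := isL2_sqr gL; have i3 := isL2_dotv fL gL.
rewrite (eq_RI (g := fun t => (dotv (f t) (f t) + (2 * s) * dotv (f t) (g t)) + s ^+ 2 * dotv (g t) (g t))).
  by rewrite !(RID, RIZ)//; [ring|exact: intgZ|apply: intgD => //; exact: intgZ|exact: intgZ].
by move=> t _; rewrite dotv_lincomb; ring.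
Qed.

Lemma RI_dotv_ge0 k (f : R -> 'cV[R]_k) : 0 <= RI T (fun t => dotv (f t) (f t)).
Proof. by apply: RI_ge0 => s _; exact: dotv_ge0. Qed.

Lemma RI_quad_ge0 k (f g : R -> 'cV[R]_k) s : isL2 T f -> isL2 T g ->
  0 <= RI T (fun t => dotv (f t) (f t)) + 2 * RI T (fun t => dotv (f t) (g t)) * s
  + RI T (fun t => dotv (g t) (g t)) * s ^+ 2.
Proof. by move=> fL gL; rewrite -RI_quad// RI_dotv_ge0. Qed.

Lemma L2normD k (f g : R -> 'cV[R]_k) : isL2 T f -> isL2 T g ->
  L2norm T (fun t => f t + g t) <= L2norm T f + L2norm T g.
Proof.
move=> fL gL; rewrite !L2normE.
have := RI_quad 1 fL gL; under eq_RI do rewrite scale1r.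
rewrite mulr1 expr1n mulr1 => ->.
apply: quadratic_triangle; rewrite ?RI_dotv_ge0// => s; exact: RI_quad_ge0.
Qed.

Lemma L2normZ k a (f : R -> 'cV[R]_k) : isL2 T f ->
  L2norm T (fun t => a *: f t) = `|a| * L2norm T f.
Proof.
move=> fL; rewrite !L2normE.
rewrite (eq_RI (g := fun t => a ^+ 2 * dotv (f t) (f t))); last first.
  by move=> t _; rewrite dotvZl dotvZr mulrA -expr2.
rewrite RIZ; last exact: isL2_sqr.
by rewrite sqrtrM ?sqr_ge0// sqrtr_sqr.
Qed.

Lemma L2normN k (f : R -> 'cV[R]_k) : L2norm T (fun t => - f t) = L2norm T f.
Proof. by congr Num.sqrt; apply: eq_RI => s _; rewrite enormN. Qed.

Lemma L2normB k (f g : R -> 'cV[R]_k) : isL2 T f -> isL2 T g ->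
  L2norm T (fun t => f t - g t) <= L2norm T f + L2norm T g.
Proof. by move=> fL gL; rewrite -(L2normN g); apply: L2normD => //; apply: isL2N. Qed.

Lemma L2norm0 k : L2norm T (fun=> 0 : 'cV[R]_k) = 0.
Proof.
by rewrite /L2norm (eq_RI (g := fun=> 0)) ?RI0 ?sqrtr0// => s _; rewrite enorm0 expr0n.
Qed.

Lemma L2norm_sum k (I : eqType) (r : seq I) (F : I -> R -> 'cV[R]_k) :
  (forall i, i \in r -> isL2 T (F i)) ->
  L2norm T (fun t => \sum_(i <- r) F i t) <= \sum_(i <- r) L2norm T (F i).
Proof.
elim: r => [|i r IH] FL.
  by rewrite big_nil (eq_L2norm (g := fun=> 0)) ?L2norm0// => t _; rewrite big_nil.
have FLr j : j \in r -> isL2 T (F j) by move=> jr; apply: FL; rewrite inE jr orbT.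
rewrite big_cons (eq_L2norm (g := fun t => F i t + \sum_(j <- r) F j t)); last first.
  by move=> t _; rewrite big_cons.
rewrite (le_trans (L2normD _ _))//; first by apply: FL; rewrite mem_head.
  exact: isL2_sum.
by rewrite lerD2l IH.
Qed.

Lemma isL2_mulmx k l (M : 'M[R]_(k, l)) (f : R -> 'cV[R]_l) : isL2 T f ->
  isL2 T (fun t => M *m f t).
Proof.
move=> /isL2P[mf fi]; have mMf i : measurable_fun (`[0, T]%classic : set R) (fun t => (M *m f t) i 0).
  apply: (eq_measurable_fun (fun t => \sum_j M i j * f t j 0)) => [t _|].
    by rewrite mxE.
  apply: measurable_sum => j.
  by apply: measurable_funM; [exact: measurable_cst|exact: mf].
apply/isL2P; split => //.
apply: (@le_intg _ _ _ (fun t => entry_sum M ^+ 2 * enorm (f t) ^+ 2)).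
- exact: enorm_sqr_measurable.
- move=> s _; rewrite ger0_norm ?sqr_ge0// -exprMn ler_sqr ?nnegrE ?enorm_ge0 ?mulr_ge0 ?entry_sum_ge0 ?enorm_ge0//.
  exact: enorm_mulmx.
- exact: intgZ.
Qed.

Lemma L2norm_mulmx k l (M : 'M[R]_(k, l)) (f : R -> 'cV[R]_l) : isL2 T f ->
  L2norm T (fun t => M *m f t) <= entry_sum M * L2norm T f.
Proof.
move=> fL; rewrite -[entry_sum M]ger0_norm ?entry_sum_ge0// -sqrtr_sqr -sqrtrM ?sqr_ge0//.
have /isL2P[_ fi] := fL; have /isL2P[_ Mfi] := isL2_mulmx M fL.
rewrite -RIZ// ler_sqrt; last first.
  by apply: RI_ge0 => s _; rewrite mulr_ge0 ?sqr_ge0.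
apply: le_RI => //; first exact: intgZ.
move=> s _; rewrite -exprMn ler_sqr ?nnegrE ?enorm_ge0 ?mulr_ge0 ?entry_sum_ge0 ?enorm_ge0//.
exact: enorm_mulmx.
Qed.

Lemma isL2_intg_enorm k (f : R -> 'cV[R]_k) : isL2 T f -> intg T (fun t => enorm (f t)).
Proof.
move=> /isL2P[mf fi]; apply: (@le_intg _ _ _ (fun t => 1 + enorm (f t) ^+ 2)).
- apply: (eq_measurable_fun (fun t => Num.sqrt (enorm (f t) ^+ 2))).
    by move=> t _; rewrite sqrtr_sqr ger0_norm// enorm_ge0.
  apply: measurableT_comp; last exact: enorm_sqr_measurable.
  by apply: continuous_measurable_fun; exact: sqrt_continuous.
- move=> s _; rewrite ger0_norm ?enorm_ge0//.
  have := sqr_ge0 (enorm (f s) - 1); have := enorm_ge0 (f s); nra.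
- by apply: intgD => //; exact: intg_cst.
Qed.

Lemma isL2_vintg k (f : R -> 'cV[R]_k) : isL2 T f -> vintg T f.
Proof.
move=> fL i; apply: le_intg (isL2_intg_enorm fL); first exact: isL2_measurable.
by move=> s _; exact: ler_entry_enorm.
Qed.

(** Cauchy-Schwarz against the constant 1, from the nonnegative integral of
    [(1 + s * enorm (f t)) ^+ 2]. *)
Lemma L1_le_L2 k (f : R -> 'cV[R]_k) : isL2 T f ->
  RI T (fun t => enorm (f t)) <= Num.sqrt T * L2norm T f.
Proof.
move=> fL; have ei := isL2_intg_enorm fL; have /isL2P[mf e2i] := fL.
apply: le_trans (ler_norm _) _.
have := @quadratic_CauchySchwarz _ T (RI T (fun t => enorm (f t)))
  (RI T (fun t => enorm (f t) ^+ 2)) T0.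
apply; first by apply: RI_ge0 => s _; rewrite sqr_ge0.
move=> s; have -> : T + 2 * RI T (fun t => enorm (f t)) * s +
    RI T (fun t => enorm (f t) ^+ 2) * s ^+ 2 =
    RI T (fun t => (1 + (2 * s) * enorm (f t)) + s ^+ 2 * enorm (f t) ^+ 2).
  rewrite !(RID, RIZ, RI_cst)//; first by ring.
  - exact: intg_cst.
  - exact: intgZ.
  - by apply: intgD; [exact: intg_cst|exact: intgZ].
  - exact: intgZ.
by apply: RI_ge0 => t _; have := sqr_ge0 (1 + s * enorm (f t)); nra.
Qed.

Lemma eqL_RI (f g : R -> R) (N : set R) : measurable N -> leb N = 0 ->
  measurable_fun (`[0, T]%classic : set R) f -> measurable_fun (`[0, T]%classic : set R) g ->
  (forall t, 0 <= t <= T -> ~ N t -> f t = g t) -> RI T f = RI T g.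
Proof.
move=> mN N0 mf mg fg; congr fine; apply: ae_eq_integral => //.
- exact/measurable_EFinP.
- exact/measurable_EFinP.
exists N; split => // t /= nfg; apply: contrapT => nN; apply: nfg.
by rewrite in_itv/= => tT; rewrite fg.
Qed.

Lemma eqL_ex k (f g : R -> 'cV[R]_k) : eqL T f g ->
  exists2 N : set R, measurable N /\ leb N = 0 &
    forall t, 0 <= t <= T -> ~ N t -> f t = g t.
Proof.
move=> [N [mN N0 sN]]; exists N => // t tT nN; apply: contrapT => nfg.
by apply/nN/sN.
Qed.

Lemma ex_eqL k (f g : R -> 'cV[R]_k) (N : set R) : measurable N -> leb N = 0 ->
  (forall t, 0 <= t <= T -> ~ N t -> f t = g t) -> eqL T f g.
Proof.
move=> mN N0 fg; exists N; split => // t [tT nfg].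
by apply: contrapT => nN; apply: nfg; apply: fg.
Qed.

Lemma eqL_refl k (f g : R -> 'cV[R]_k) :
  (forall t, 0 <= t <= T -> f t = g t) -> eqL T f g.
Proof. by move=> fg; apply: (@ex_eqL _ _ _ set0) => // t tT _; apply: fg. Qed.

Lemma eqL_sym k (f g : R -> 'cV[R]_k) : eqL T f g -> eqL T g f.
Proof.
by move=> /eqL_ex[N [mN N0] fg]; apply: (@ex_eqL _ _ _ N) => // t tT nN; rewrite fg.
Qed.

Lemma eqL_trans k (f g h : R -> 'cV[R]_k) : eqL T f g -> eqL T g h -> eqL T f h.
Proof.
move=> /eqL_ex[N [mN N0] fg] /eqL_ex[N' [mN' N'0] gh].
apply: (@ex_eqL _ _ _ (N `|` N')).
- exact: measurableU.
- by apply/eqP; rewrite -measure_le0 -[leRHS]adde0 -{1}N0 -N'0 measureU2.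
- by move=> t tT /not_orP[nN nN']; rewrite fg// gh.
Qed.

Lemma eqL_lin k a (f f' g g' : R -> 'cV[R]_k) : eqL T f f' -> eqL T g g' ->
  eqL T (fun t => a *: f t + g t) (fun t => a *: f' t + g' t).
Proof.
move=> /eqL_ex[N [mN N0] ff'] /eqL_ex[N' [mN' N'0] gg'].
apply: (@ex_eqL _ _ _ (N `|` N')).
- exact: measurableU.
- by apply/eqP; rewrite -measure_le0 -[leRHS]adde0 -{1}N0 -N'0 measureU2.
- by move=> t tT /not_orP[nN nN']; rewrite ff'// gg'.
Qed.

Lemma eqLD k (f f' g g' : R -> 'cV[R]_k) : eqL T f f' -> eqL T g g' ->
  eqL T (fun t => f t + g t) (fun t => f' t + g' t).
Proof.
move=> ff' gg'; have := eqL_lin 1 ff' gg'.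
by under eq_fun do rewrite scale1r; under [X in eqL _ _ X -> _]eq_fun do rewrite scale1r.
Qed.

Lemma eqLZ k a (f f' : R -> 'cV[R]_k) : eqL T f f' ->
  eqL T (fun t => a *: f t) (fun t => a *: f' t).
Proof.
move=> ff'; have := eqL_lin a ff' (eqL_refl (f := fun=> 0) (fun t _ => erefl)).
by under eq_fun do rewrite addr0; under [X in eqL _ _ X -> _]eq_fun do rewrite addr0.
Qed.

Lemma eqL_sum k (I : eqType) (r : seq I) (f g : I -> R -> 'cV[R]_k) :
  (forall i, i \in r -> eqL T (f i) (g i)) ->
  eqL T (fun t => \sum_(i <- r) f i t) (fun t => \sum_(i <- r) g i t).
Proof.
elim: r => [|i r IH] fg; first by apply: eqL_refl => t _; rewrite !big_nil.
apply: (@eqL_trans _ _ (fun t => f i t + \sum_(j <- r) f j t)).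
  by apply: eqL_refl => t _; rewrite big_cons.
apply: (@eqL_trans _ _ (fun t => g i t + \sum_(j <- r) g j t)); last first.
  by apply: eqL_refl => t _; rewrite big_cons.
apply: eqLD; first by apply: fg; rewrite mem_head.
by apply: IH => j jr; apply: fg; rewrite inE jr orbT.
Qed.

Lemma eqL_L2norm k (f g : R -> 'cV[R]_k) : isL2 T f -> isL2 T g -> eqL T f g ->
  L2norm T f = L2norm T g.
Proof.
move=> fL gL /eqL_ex[N [mN N0] fg]; congr Num.sqrt; apply: (eqL_RI mN N0).
- by apply: enorm_sqr_measurable => i; exact: isL2_measurable.
- by apply: enorm_sqr_measurable => i; exact: isL2_measurable.
- by move=> t tT nN; rewrite fg.
Qed.

(** Fatou's lemma for squared norms. Applied to partial sums it puts the limit in L^2; applied to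
    differences it gives the rate of convergence. *)
Lemma L2_fatou k (h : nat -> R -> 'cV[R]_k) (g : R -> 'cV[R]_k) (d : R) : 0 <= d ->
  (forall N, isL2 T (h N)) -> (\forall N \near \oo, L2norm T (h N) <= d) ->
  (forall t i, 0 <= t <= T -> h N t i 0 @[N --> \oo] --> g t i 0) ->
  isL2 T g /\ L2norm T g <= d.
Proof.
move=> d0 hL hd hg.
have mg i : measurable_fun (`[0, T]%classic : set R) (fun t => g t i 0).
  apply: (measurable_fun_cvg (h := fun N t => h N t i 0)) => [N|t].
    exact: isL2_measurable.
  by rewrite /= in_itv/= => tT; apply: hg.
have hgE t : 0 <= t <= T -> (enorm (h N t) ^+ 2)%:E @[N --> \oo] --> (enorm (g t) ^+ 2)%:E.
  move=> tT; apply: cvg_EFin; first by apply: nearW.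
  have -> : fine \o (fun N => (enorm (h N t) ^+ 2)%:E) = (fun N => \sum_i (h N t i 0 * h N t i 0)).
    by apply/funext => N /=; rewrite enorm_sqr.
  rewrite enorm_sqr; apply: cvg_big => //=; first exact: add_continuous.
  by move=> i _; apply: cvgM; apply: hg.
have hint N : (\int[leb]_(t in `[0%R, T]) (enorm (h N t) ^+ 2)%:E)%E = (L2norm T (h N) ^+ 2)%:E.
  rewrite L2norm_sqr /Defs.Rint /Rintegral fineK//.
  by have /isL2P[_ hi] := hL N; apply: integrable_fin_num.
have key : (\int[leb]_(t in `[0%R, T]) (enorm (g t) ^+ 2)%:E <= (d ^+ 2)%:E)%E.
  apply: (@le_trans _ _ (\int[leb]_(t in `[0%R, T])
       limn_einf (fun N => (enorm (h N t) ^+ 2)%:E))%E).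
    rewrite le_eqVlt; apply/orP; left; apply/eqP; apply: eq_integral => t.
    rewrite inE/= in_itv/= => /hgE hgt; apply/esym.
    rewrite is_cvg_limn_einfE; last by apply/cvg_ex; eexists; exact: hgt.
    exact/cvg_lim.
  apply: le_trans (@fatou _ _ _ leb _ _ (fun N t => (enorm (h N t) ^+ 2)%:E) _ _) _ => //.
  - move=> N; apply/measurable_EFinP; apply: enorm_sqr_measurable => i.
    exact: isL2_measurable.
  - by move=> N t _; rewrite lee_fin sqr_ge0.
  rewrite limn_einf_lim; apply: lime_le; first exact: is_cvg_einfs.
  near=> N; apply: (@le_trans _ _ (L2norm T (h N) ^+ 2)%:E).
    by apply: ereal_inf_lbound; exists N => //=; exact: hint.
  rewrite lee_fin ler_sqr ?nnegrE ?L2norm_ge0//; near: N; exact: hd.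
have gL : isL2 T g.
  by split => //; apply: le_lt_trans key _; rewrite ltry.
split => //; rewrite -ler_sqr ?nnegrE ?L2norm_ge0// L2norm_sqr -lee_fin.
rewrite /Defs.Rint /Rintegral fineK//.
by have /isL2P[_ gi] := gL; apply: integrable_fin_num.
Unshelve. all: by end_near. Qed.

(** * Families with bounded norm sums converge unconditionally in L^2 *)

Section Completeness.
Variables (k : nat) (I : countType) (S : pred I) (f : I -> R -> 'cV[R]_k) (M : R).
Hypothesis fL : forall i, S i -> isL2 T (f i).
Hypothesis fM : forall s : seq I, uniq s -> all S s -> \sum_(i <- s) L2norm T (f i) <= M.

(** [sel j] holds the element of code [j], if there is one and it satisfies [S]; so the lists
    [pre N] exhaust [S] and reduce sums over [I] to sequences. *)
Let sel (j : nat) : seq I := [seq i <- seq_of_opt (pickle_inv j) | S i].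
Let pre (N : nat) : seq I := flatten [seq sel j | j <- iota 0 N].

Let mem_sel i j : (i \in sel j) = S i && (pickle i == j).
Proof.
rewrite /sel mem_filter; congr (_ && _).
case E : (pickle_inv j) => [i'|] /=.
  have <- : pickle i' = j by have := @pickle_invK I j; rewrite E.
  by rewrite inE; apply/eqP/eqP => [->//|]; exact: (pcan_inj pickleK_inv).
rewrite in_nil; apply/esym/eqP => ij.
by move: E; rewrite -ij pickleK_inv.
Qed.

Let preS N : pre N.+1 = pre N ++ sel N.
Proof. by rewrite /pre -addn1 iotaD map_cat flatten_cat /= cats0. Qed.

Let mem_pre i N : (i \in pre N) = S i && (pickle i < N)%N.
Proof.
elim: N => [|N IH]; first by rewrite andbF.
by rewrite preS mem_cat IH mem_sel -andb_orr [in RHS]ltnS [in RHS]leq_eqVlt orbC.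
Qed.

Let uniq_pre N : uniq (pre N).
Proof.
elim: N => [//|N IH]; rewrite preS cat_uniq IH /= /sel; apply/andP; split.
  by apply/hasPn => i; rewrite mem_sel => /andP[Si /eqP ij]; rewrite mem_pre Si ij ltnn.
by apply: filter_uniq; case: (pickle_inv N).
Qed.

Let all_pre N : all S (pre N).
Proof. by apply/allP => i; rewrite mem_pre => /andP[]. Qed.

Let pre_series (V : nmodType) (x : I -> V) N :
  \sum_(i <- pre N) x i = \sum_(0 <= j < N) \sum_(i <- sel j) x i.
Proof.
elim: N => [|N IH]; first by rewrite big_nil big_nil.
by rewrite preS big_cat IH big_nat_recr.
Qed.

Let H N (t : R) := \sum_(i <- pre N) enorm (f i t).

Let H_ge0 N t : 0 <= H N t.
Proof. by apply: sumr_ge0 => i _; exact: enorm_ge0. Qed.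

Let H_nd t : nondecreasing_seq (H^~ t).
Proof.
apply/nondecreasing_seqP => N; rewrite /H preS big_cat /= lerDl.
by apply: sumr_ge0 => i _; exact: enorm_ge0.
Qed.

Let pre_L2 N i : i \in pre N -> isL2 T (f i).
Proof. by move/(allP (all_pre N)); exact: fL. Qed.

Let intg_H N : intg T (H N).
Proof.
rewrite /H; have : {subset pre N <= pre N} by [].
elim: {1 3}(pre N) => [|i r IH] sub.
  by apply: eq_intg (intg0 _) => t _; rewrite big_nil.
apply: (@eq_intg _ _ (fun t => enorm (f i t) + \sum_(j <- r) enorm (f j t))).
  by move=> t _; rewrite big_cons.
apply: intgD; first by apply: isL2_intg_enorm; apply: (pre_L2 (N := N)); apply: sub; rewrite mem_head.
by apply: IH => j jr; apply: sub; rewrite inE jr orbT.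
Qed.

Let RI_H N : RI T (H N) <= Num.sqrt T * M.
Proof.
apply: (@le_trans _ _ (Num.sqrt T * \sum_(i <- pre N) L2norm T (f i))); last first.
  by rewrite ler_wpM2l ?sqrtr_ge0// fM.
rewrite /H; have : {subset pre N <= pre N} by [].
elim: {1 3 4}(pre N) => [|i r IH] sub.
  by rewrite big_nil mulr0 (eq_RI (g := fun=> 0)) ?RI0// => t _; rewrite big_nil.
have sub' : {subset r <= pre N} by move=> j jr; apply: sub; rewrite inE jr orbT.
have iL : isL2 T (f i) by apply: (pre_L2 (N := N)); apply: sub; rewrite mem_head.
rewrite (eq_RI (g := fun t => enorm (f i t) + \sum_(j <- r) enorm (f j t))); last first.
  by move=> t _; rewrite big_cons.
rewrite RID; last 2 first.
- exact: isL2_intg_enorm.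
- move: sub'; elim: r {IH sub} => [|j r IH] sub'.
    by apply: eq_intg (intg0 _) => t _; rewrite big_nil.
  apply: (@eq_intg _ _ (fun t => enorm (f j t) + \sum_(l <- r) enorm (f l t))).
    by move=> t _; rewrite big_cons.
  apply: intgD; first by apply: isL2_intg_enorm; apply: (pre_L2 (N := N)); apply: sub'; rewrite mem_head.
  by apply: IH => l lr; apply: sub'; rewrite inE lr orbT.
by rewrite big_cons mulrDr lerD ?IH//; exact: L1_le_L2.
Qed.

(* The pointwise series converges absolutely off a null set, since [sup_N H N] is integrable. *)
Let ae_bounded : exists2 Z : set R, measurable Z /\ leb Z = 0 &
  forall t, 0 <= t <= T -> ~ Z t -> exists K, forall N, H N t <= K.
Proof.
have mH N : measurable_fun (`[0, T]%classic : set R) (fun t => (H N t)%:E).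
  by apply/measurable_EFinP; apply: intg_measurable (intg_H N).
have Hcvg t : cvgn (fun N => (H N t)%:E).
  by apply: ereal_nondecreasing_is_cvgn => a b ab; rewrite lee_fin; apply: H_nd.
pose Hlim t := limn (fun N => (H N t)%:E).
have mHlim : measurable_fun (`[0, T]%classic : set R) Hlim.
  by apply: (emeasurable_fun_cvg (fun N t => (H N t)%:E)) => // t _; exact: Hcvg.
have Hlim0 t : (0 <= Hlim t)%E.
  by apply: lime_ge => //; apply: nearW => N; rewrite lee_fin.
have intH : leb.-integrable `[0, T] Hlim.
  apply/integrableP; split => //.
  under eq_integral do rewrite gee0_abs//.
  rewrite (@monotone_convergence _ _ _ leb _ _ (fun N t => (H N t)%:E))//; last 2 first.
  - by move=> N t _; rewrite lee_fin.
  - by move=> t _ a b ab; rewrite lee_fin; apply: H_nd.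
  apply: (@le_lt_trans _ _ (Num.sqrt T * M)%:E); last by rewrite ltry.
  apply: lime_le.
    apply: ereal_nondecreasing_is_cvgn => a b ab; apply: ge0_le_integral => //.
    + by move=> t _; rewrite lee_fin.
    + exact: mH.
    + exact: mH.
    + by move=> t _; rewrite lee_fin; apply: H_nd.
  apply: nearW => N; apply: le_trans (_ : (RI T (H N))%:E <= _)%E.
    rewrite /Defs.Rint /Rintegral fineK//.
    by apply: integrable_fin_num => //; exact: intg_H.
  by rewrite lee_fin RI_H.
have [Z [mZ Z0 sZ]] := @integrable_ae _ _ _ leb _ (measurable_itv _) _ intH.
exists Z => // t tT nZ; exists (fine (Hlim t)) => N.
have fint : Hlim t \is a fin_num.
  apply: contrapT => nf; apply/nZ/sZ => /= h; apply: nf; apply: h.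
  by rewrite in_itv.
rewrite -lee_fin fineK//.
apply: lime_ge; first exact: Hcvg.
by exists N => // N' /= NN'; rewrite lee_fin; apply: H_nd.
Qed.

(** What a finite set leaves out of the sum has norm at most what it leaves out of the sum of norms.
    A set [F0] whose norm sum is within [e / 2] of the supremum therefore controls every larger
    [Fs], whatever the enumeration. *)
Lemma L2_summable_cvg : exists2 g, isL2 T g & forall e, 0 < e ->
  exists F0 : seq I, all S F0 /\ forall Fs, uniq Fs -> all S Fs -> {subset F0 <= Fs} ->
    L2norm T (fun t => \sum_(i <- Fs) f i t - g t) < e.
Proof.
have [Z [mZ Z0] ZP] := ae_bounded.
(* Setting the partial sums to zero on the null set makes them converge at every time of [[0, T]],
   as [L2_fatou] requires. *)
pose p N t := if t \in Z then 0 else \sum_(i <- pre N) f i t.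
have mnZ : measurable_fun (`[0, T]%classic : set R) (fun t => \1_(~` Z) t : R).
  by apply: measurable_indic; exact: measurableC.
have pE N t i : p N t i 0 = \1_(~` Z) t * (\sum_(j <- pre N) f j t) i 0.
  rewrite /p indicE in_setC; case: (t \in Z) => /=; rewrite ?mul0r ?mul1r//.
  by rewrite mxE.
have sL s : all S s -> isL2 T (fun t => \sum_(i <- s) f i t).
  by move=> sS; apply: isL2_sum => // i /(allP sS); exact: fL.
have mp N i : measurable_fun (`[0, T]%classic : set R) (fun t => p N t i 0).
  apply: (eq_measurable_fun (fun t => \1_(~` Z) t * (\sum_(j <- pre N) f j t) i 0)) => [t _|].
    by rewrite pE.
  apply: measurable_funM => //.
  by apply: isL2_measurable; apply: sL.
have pL N : isL2 T (p N).
  apply/isL2P; split => //.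
  have /isL2P[_ qi] := sL _ (all_pre N).
  apply: (le_intg _ _ qi); first exact: enorm_sqr_measurable.
  move=> s _; rewrite ger0_norm ?sqr_ge0// /p; case: ifP => // _.
  by rewrite enorm0 expr0n sqr_ge0.
have pcvg t i : 0 <= t <= T -> cvgn (fun N => p N t i 0).
  move=> tT; have [tZ|tZ] := boolP (t \in Z).
    rewrite /p tZ; exact: is_cvg_cst.
  have [|K KP] := ZP t tT; first by move=> Zt; move: tZ; rewrite mem_set.
  have -> : (fun N => p N t i 0) = series (fun j => \sum_(l <- sel j) f l t i 0).
    by apply/funext => N; rewrite /p (negbTE tZ) summxE pre_series.
  apply: normed_cvg; apply: nondecreasing_is_cvgn.
    by apply: nondecreasing_series => j _ _; exact: normr_ge0.
  exists K => _ [N _ <-]; apply: le_trans (KP N).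
  rewrite /H pre_series; apply: ler_sum => j _; apply: le_trans (ler_norm_sum _ _ _) _.
  by apply: ler_sum => l _; exact: ler_entry_enorm.
pose g t : 'cV[R]_k := \col_i limn (fun N => p N t i 0).
have pg t i : 0 <= t <= T -> p N t i 0 @[N --> \oo] --> g t i 0.
  by move=> tT; rewrite mxE; exact: pcvg.
have pre_eq s N : all S s -> eqL T (fun t => \sum_(i <- s) f i t - p N t)
    (fun t => \sum_(i <- s) f i t - \sum_(i <- pre N) f i t).
  move=> _; apply: (@ex_eqL _ _ _ Z) => // t tT nZ; rewrite /p.
  by case: ifPn => //; rewrite inE.
have M0 : 0 <= M by have := fM (s := [::]); rewrite big_nil; apply.
have tail (s : seq I) N : uniq s -> all S s -> {subset s <= pre N} ->
    L2norm T (fun t => \sum_(i <- s) f i t - p N t) <=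
    \sum_(i <- pre N) L2norm T (f i) - \sum_(i <- s) L2norm T (f i).
  move=> us sS sub.
  pose r := [seq i <- pre N | i \notin s].
  have permN : perm_eq (pre N) (s ++ r).
    apply: uniq_perm; rewrite ?uniq_pre// ?cat_uniq ?us ?filter_uniq ?uniq_pre// ?andbT.
      by apply/hasPn => i; rewrite mem_filter => /andP[].
    move=> i; rewrite mem_cat mem_filter; case: (boolP (i \in s)) => //= /sub.
    by move=> ->.
  rewrite (@eqL_L2norm _ _ (fun t => - \sum_(i <- r) f i t)).
  - rewrite L2normN (perm_big _ permN) /= big_cat /= addrAC subrr add0r.
    by apply: L2norm_sum => // i; rewrite mem_filter => /andP[_] /pre_L2.
  - by apply: isL2B => //; exact: sL.
  - by apply: isL2N => //; apply: sL; apply/allP => i; rewrite mem_filter => /andP[_] /(allP (all_pre N)).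
  - apply: eqL_trans (pre_eq _ _ sS) _; apply: eqL_refl => t _.
    by rewrite (perm_big _ permN) /= big_cat /= opprD addrA subrr sub0r.
have gfat (s : seq I) d : 0 <= d -> all S s ->
   (\forall N \near \oo, L2norm T (fun t => \sum_(i <- s) f i t - p N t) <= d) ->
   isL2 T (fun t => \sum_(i <- s) f i t - g t) /\
   L2norm T (fun t => \sum_(i <- s) f i t - g t) <= d.
  move=> d0 sS hd; apply: (L2_fatou (h := fun N t => \sum_(i <- s) f i t - p N t)) => // [N|t i tT].
    by apply: isL2B => //; exact: sL.
  have -> : (fun N => (\sum_(i0 <- s) f i0 t - p N t) i 0) =
     (fun N => (\sum_(i0 <- s) f i0 t) i 0 - p N t i 0).
    by apply/funext => N; rewrite !mxE.
  rewrite [X in _ --> X]mxE [X in _ --> _ + X]mxE; apply: cvgB; [exact: cvg_cst|exact: pg].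
exists g.
  have [|hL _] := gfat [::] M M0 isT.
    apply: nearW => N; apply: le_trans (tail [::] N _ _ _) _ => //.
    by rewrite big_nil subr0 fM.
  by have := isL2N hL; apply: eq_isL2 => t _; rewrite big_nil sub0r opprK.
move=> e e0.
pose E := [set \sum_(i <- s) L2norm T (f i) | s in [set s : seq I | uniq s /\ all S s]].
have hE : has_sup E.
  split; first by exists 0, [::] => //; rewrite big_nil.
  by exists M => _ [s [us sS] <-]; exact: fM.
have e20 : 0 < e / 2 by rewrite divr_gt0.
have [_ [F0 [uF0 F0S] <-] F0E] := sup_adherent e20 hE.
exists F0; split => // Fs uFs FsS sub.
suff [_] : isL2 T (fun t => \sum_(i <- Fs) f i t - g t) /\
   L2norm T (fun t => \sum_(i <- Fs) f i t - g t) <= e / 2.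
  by move=> /le_lt_trans; apply; rewrite ltr_pdivrMr// ltr_pMr// ltr1n.
apply: gfat => //; first exact: ltW.
(* From this rank on, [pre N] contains [Fs]. *)
exists (\max_(i <- Fs) (pickle i).+1)%N => // N /= FsN.
have FsubN : {subset Fs <= pre N}.
  move=> i iFs; rewrite mem_pre (allP FsS)//=; apply: leq_trans FsN.
  by rewrite (big_rem i)//= leq_maxl.
apply: le_trans (tail _ _ uFs FsS FsubN) _.
have h1 : \sum_(i <- pre N) L2norm T (f i) <= sup E.
  by apply: ub_le_sup; [case: hE|exists (pre N)].
have h2 : \sum_(i <- F0) L2norm T (f i) <= \sum_(i <- Fs) L2norm T (f i).
  have perm2 : perm_eq Fs (F0 ++ [seq i <- Fs | i \notin F0]).
    apply: uniq_perm; rewrite ?cat_uniq ?uF0 ?filter_uniq// ?andbT.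
      by apply/hasPn => i; rewrite mem_filter => /andP[].
    move=> i; rewrite mem_cat mem_filter; case: (boolP (i \in F0)) => //= /sub.
    by move=> ->.
  rewrite (perm_big _ perm2) /= big_cat /= lerDl; apply: sumr_ge0 => i _.
  exact: L2norm_ge0.
lra.
Qed.

End Completeness.

End L2.

(** * The solution operator *)

Section SolutionOperator.
Variables (R : realType) (T : R).
Local Notation RI := (@Defs.Rint R 0).
Local Notation leb := (@lebesgue_measure R).
Hypothesis T0 : 0 <= T.

(** The infimum defining an operator norm is itself admissible: divide by [b w] when it is positive;
    when it is zero, a single admissible constant already gives [a w <= 0]. Used for [normPhi0] and
    [opF]. *)
Lemma inf_bound (X : Type) (P : X -> Prop) (a b : X -> R) :
  (exists M, 0 <= M /\ forall w, P w -> a w <= M * b w) ->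
  (forall w, P w -> 0 <= b w) ->
  let k := inf [set M : R | 0 <= M /\ forall w, P w -> a w <= M * b w] in
  0 <= k /\ forall w, P w -> a w <= k * b w.
Proof.
move=> [M [M0 MP]] b0 k.
have k0 : 0 <= k by apply: lb_le_inf; [exists M|move=> N []].
split => // w Pw; have := b0 w Pw; rewrite le_eqVlt => /predU1P[bw|bw].
  by have := MP w Pw; rewrite -bw !mulr0.
rewrite -ler_pdivrMr//; apply: lb_le_inf; first by exists M.
by move=> N [N0 NP]; rewrite ler_pdivrMr// NP.
Qed.

Section Space.
Variable k : nat.
Implicit Types x g : R -> 'cV[R]_k.

Lemma isPrim_bounded x g t : isPrim T x g -> 0 <= t <= T ->
  enorm (x t) <= enorm (x 0) + \sum_i RI T (fun s => `|g s i 0|).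
Proof.
move=> [gL xE] tT; rewrite xE//; apply: le_trans (enormD _ _) _.
rewrite lerD2l; apply: le_trans (enorm_entries _) _; apply: ler_sum => i _.
by rewrite mxE; apply: RI_bounded => //; exact: isL2_vintg.
Qed.

Lemma isPrim_measurable x g i : isPrim T x g ->
  measurable_fun (`[0, T]%classic : set R) (fun t => x t i 0).
Proof.
move=> [gL xE]; apply: (eq_measurable_fun (fun t => x 0 i 0 + RI t (fun s => g s i 0))).
  by move=> t; rewrite inE/= in_itv/= => tT; rewrite [in RHS]xE// !mxE.
apply: measurable_funD; first exact: measurable_cst.
by apply: (measurable_funS (E := setT)) => //; exact: measurable_Rint.
Qed.

Lemma isS_bounded x : isS T x -> exists M, forall t, 0 <= t <= T -> enorm (x t) <= M.
Proof. by move=> [g xg]; eexists => t; exact: isPrim_bounded xg. Qed.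

Lemma isS_isL2 x : isS T x -> isL2 T x.
Proof.
move=> xS; have [M xM] := isS_bounded xS; have [g xg] := xS.
by apply: isL2_bounded xM => i; exact: isPrim_measurable xg.
Qed.

Lemma eqS_isPrim x x' g : eqS T x x' -> isPrim T x g -> isPrim T x' g.
Proof.
move=> xx' [gL xE]; have h0 : x 0 = x' 0 by apply: xx'; rewrite lexx.
by split => // t tT; rewrite -h0 -(xx' _ tT) xE.
Qed.

Lemma eqS_sym x x' : eqS T x x' -> eqS T x' x.
Proof. by move=> h t tT; rewrite h. Qed.

Lemma eqS_isS x x' : eqS T x x' -> isS T x -> isS T x'.
Proof. by move=> xx' [g xg]; exists g; exact: eqS_isPrim xg. Qed.

Lemma eqS_Snorm x x' : eqS T x x' -> Snorm T x = Snorm T x'.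
Proof.
move=> xx'; congr (sup _ + inf _).
  by apply/seteqP; split => _ [t /= tT <-]; exists t => //; move: tT; rewrite in_itv/= => /xx' ->.
by apply/seteqP; split => _ [g xg <-]; exists g => //; apply: eqS_isPrim xg => //; exact: eqS_sym.
Qed.

Let has_sup_enorm x : isS T x -> has_sup [set enorm (x t) | t in `[0, T]].
Proof.
move=> /isS_bounded[M xM]; split; first by exists (enorm (x 0)), 0 => //=; rewrite in_itv/= lexx.
by exists M => _ [t + <-]; rewrite /= in_itv/=; exact: xM.
Qed.

Let inf_L2_ge0 x : isS T x -> 0 <= inf [set L2norm T g | g in isPrim T x].
Proof.
move=> [g xg]; apply: lb_le_inf; first by exists (L2norm T g), g.
by move=> _ [h _ <-]; exact: L2norm_ge0.
Qed.

Lemma enorm_le_Snorm x t : isS T x -> 0 <= t <= T -> enorm (x t) <= Snorm T x.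
Proof.
move=> xS tT; rewrite -[leLHS]addr0 lerD ?inf_L2_ge0//.
by apply: ub_le_sup; [case: (has_sup_enorm xS)|exists t => //=; rewrite in_itv].
Qed.

Lemma Snorm_ge0 x : isS T x -> 0 <= Snorm T x.
Proof.
by move=> xS; apply: le_trans (enorm_le_Snorm (t := 0) xS _); rewrite ?enorm_ge0 ?lexx.
Qed.

Lemma Snorm_le x g M : isPrim T x g -> (forall t, 0 <= t <= T -> enorm (x t) <= M) ->
  Snorm T x <= M + L2norm T g.
Proof.
move=> xg xM; apply: lerD.
  apply: ge_sup; first by exists (enorm (x 0)), 0 => //=; rewrite in_itv/= lexx.
  by move=> _ [t + <-]; rewrite /= in_itv/=; exact: xM.
by apply: ge_inf; [exists 0 => _ [h _ <-]; exact: L2norm_ge0|exists g].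
Qed.

Lemma isPrim_lin a x x' g g' : isPrim T x g -> isPrim T x' g' ->
  isPrim T (fun t => a *: x t + x' t) (fun t => a *: g t + g' t).
Proof.
move=> [gL xE] [gL' xE']; split; first by apply: isL2D => //; exact: isL2Z.
move=> t tT; have /andP[t0 tT'] := tT.
have gi : vintg t g by apply: vintgS (isL2_vintg gL).
have gi' : vintg t g' by apply: vintgS (isL2_vintg gL').
rewrite vintD//; last first.
  exact: vintgZ.
by rewrite vintZ// {1}xE// {1}xE'// scalerDr addrACA.
Qed.

Lemma isS_lin a x x' : isS T x -> isS T x' -> isS T (fun t => a *: x t + x' t).
Proof. by move=> [g xg] [g' xg']; eexists; exact: isPrim_lin xg xg'. Qed.

Lemma isS0 : isS T (fun=> 0 : 'cV[R]_k).
Proof.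
exists (fun=> 0); split; first exact: isL20.
by move=> t tT; rewrite vint_eq0 ?addr0.
Qed.

Lemma isSD x x' : isS T x -> isS T x' -> isS T (fun t => x t + x' t).
Proof. by move=> xS xS'; apply: eqS_isS (isS_lin 1 xS xS') => t _; rewrite scale1r. Qed.

Lemma isSZ a x : isS T x -> isS T (fun t => a *: x t).
Proof. by move=> xS; apply: eqS_isS (isS_lin a xS isS0) => t _; rewrite addr0. Qed.

Lemma isS_sum (I : eqType) (r : seq I) (X : I -> R -> 'cV[R]_k) :
  (forall i, i \in r -> isS T (X i)) -> isS T (fun t => \sum_(i <- r) X i t).
Proof.
elim: r => [|i r IH] XS; first by apply: eqS_isS isS0 => t _; rewrite big_nil.
apply: (@eqS_isS (fun t => X i t + \sum_(j <- r) X j t)).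
  by move=> t _; rewrite big_cons.
apply: isSD; first by apply: XS; rewrite mem_head.
by apply: IH => j jr; apply: XS; rewrite inE jr orbT.
Qed.

End Space.

Section Operator.
Variables (n : nat) (A : 'M[R]_n).
Implicit Types w : Iset R n.

(** [Phi0] selects a solution by choice; uniqueness identifies it on [[0, T]] with this explicit
    formula, from which its properties are read. *)
Definition duhamel w (t : R) : 'cV[R]_n :=
  mexp A t *m (w.1 + vint (fun s => mexp A (- s) *m w.2 s) 0 t).

Lemma entry_sum_bounded (E : R -> 'M[R]_n) : (forall i j, continuous (fun s => E s i j)) ->
  exists2 K, 0 <= K & forall s, 0 <= s <= T -> entry_sum (E s) <= K.
Proof.
move=> cE; have cS : continuous (fun s => entry_sum (E s)).
  do 2 (apply: continuous_sum => ?).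
  by move=> s; apply: cvg_norm; exact: cE.
have [K K0 KP] := continuous_bounded T cS; exists K => // s sT.
exact: le_trans (ler_norm _) (KP s sT).
Qed.

Lemma enorm_vint_mul (E : R -> 'M[R]_n) K f t : (forall i j, continuous (fun s => E s i j)) ->
  (forall s, 0 <= s <= T -> entry_sum (E s) <= K) -> isL2 T f -> 0 <= t <= T ->
  enorm (vint (fun s => E s *m f s) 0 t) <= n%:R * (K * Num.sqrt T) * L2norm T f.
Proof.
move=> cE KP fL tT; have K0 : 0 <= K by apply: le_trans (entry_sum_ge0 (E 0)) (KP 0 _); rewrite lexx.
apply: le_trans (enorm_entries _) _.
have wi : vintg T (fun s => E s *m f s) by apply: vintg_contM => //; exact: isL2_vintg.
have -> : n%:R * (K * Num.sqrt T) * L2norm T f = \sum_(i < n) (K * Num.sqrt T * L2norm T f).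
  by rewrite sumr_const card_ord -mulrA mulr_natl.
apply: ler_sum => i _; rewrite mxE; apply: le_trans (RI_bounded (wi i) tT) _.
rewrite -mulrA; apply: (@le_trans _ _ (K * RI T (fun s => enorm (f s)))); last first.
  by rewrite ler_wpM2l//; exact: L1_le_L2.
have ei := isL2_intg_enorm fL.
rewrite -RIZ//; apply: le_RI; [exact: intg_norm|exact: intgZ|move=> s sT].
apply: le_trans (ler_entry_enorm _ _) _; apply: le_trans (enorm_mulmx _ _) _.
by rewrite ler_wpM2r ?enorm_ge0 ?KP.
Qed.

Lemma Inorm_ge0 w : 0 <= Inorm T w.
Proof. by rewrite addr_ge0 ?enorm_ge0 ?L2norm_ge0. Qed.

Let continuousN i j : continuous (fun s => mexp A (- s) i j).
Proof. exact: C1_continuous (mexpN_C1 A i j). Qed.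

Lemma vintg_mexpN w t : t <= T -> isL2 T w.2 -> vintg t (fun s => mexp A (- s) *m w.2 s).
Proof. by move=> tT wL; apply: vintgS tT _; apply: vintg_contM => //; exact: isL2_vintg. Qed.

Lemma duhamel_measurable w i : isL2 T w.2 ->
  measurable_fun (`[0, T]%classic : set R) (fun t => duhamel w t i 0).
Proof.
move=> wL; apply: (eq_measurable_fun (fun t => \sum_j mexp A t i j *
    (w.1 j 0 + RI t (fun s => (mexp A (- s) *m w.2 s) j 0)))).
  by move=> t _; rewrite mxE; apply: eq_bigr => j _; rewrite !mxE.
apply: measurable_sum => j; apply: measurable_funM.
  by apply: continuous_measurable_itv => //; exact: mexp_continuous.
apply: measurable_funD; first exact: measurable_cst.
by apply: (measurable_funS (E := setT)) => //; exact: measurable_Rint.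
Qed.

Lemma duhamel_bounded : exists2 c, 0 <= c & forall w t, isL2 T w.2 -> 0 <= t <= T ->
  enorm (duhamel w t) <= c * Inorm T w.
Proof.
have [K K0 KP] := entry_sum_bounded (@mexp_continuous _ _ A).
have [K' K'0 K'P] := entry_sum_bounded continuousN.
pose c := n%:R * (K' * Num.sqrt T).
have c0 : 0 <= c by rewrite !mulr_ge0 ?sqrtr_ge0.
exists (K * (1 + c)) => [|w t wL tT]; first by rewrite mulr_ge0 ?addr_ge0.
have /andP[t0 tT'] := tT.
apply: le_trans (enorm_mulmx _ _) _; rewrite -mulrA.
apply: ler_pM; rewrite ?entry_sum_ge0 ?enorm_ge0 ?KP//.
apply: le_trans (enormD _ _) _.
apply: (@le_trans _ _ (enorm w.1 + c * L2norm T w.2)); last first.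
  rewrite /Inorm; have := enorm_ge0 w.1; have := L2norm_ge0 T w.2; nra.
rewrite lerD2l; exact: enorm_vint_mul.
Qed.

Lemma duhamel_isL2 w : isL2 T w.2 -> isL2 T (duhamel w).
Proof.
have [c _ cP] := duhamel_bounded => wL.
apply: (isL2_bounded (M := c * Inorm T w)) => [i|t tT]; last exact: cP.
exact: duhamel_measurable.
Qed.

Lemma duhamel0 w : duhamel w 0 = w.1.
Proof. by rewrite /duhamel mexp0 mul1mx vint0 addr0. Qed.

Lemma duhamel_isPrim w : isL2 T w.2 ->
  isPrim T (duhamel w) (fun s => A *m duhamel w s + w.2 s).
Proof.
move=> wL; split; first by apply: isL2D => //; apply: isL2_mulmx; exact: duhamel_isL2.
move=> t tT; rewrite duhamel0.
by apply: duhamel_sol tT => //; exact: isL2_vintg.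
Qed.

Lemma isSolLin_duhamel w : isL2 T w.2 -> isSolLin T A w.1 w.2 (duhamel w).
Proof.
move=> wL; split; first by eexists; exact: duhamel_isPrim.
by move=> t tT; have [_ ->] := duhamel_isPrim wL => //; rewrite duhamel0.
Qed.

Lemma isSolLin_uniq w x : isL2 T w.2 -> isSolLin T A w.1 w.2 x -> eqS T x (duhamel w).
Proof.
move=> wL [xS xE] t /andP[t0 tT]; apply: variation_of_constants => //.
- by apply: vintgS (isL2_vintg wL).
- by apply: vintgS (isL2_vintg (isS_isL2 xS)).
- by move=> s /andP[s0 st]; rewrite xE// s0 (le_trans st).
Qed.

Lemma Phi0P w : isL2 T w.2 -> isSolLin T A w.1 w.2 (Phi0 T A w).
Proof.
move=> wL.
have ex : exists x, [set x | isSolLin T A w.1 w.2 x] x by exists (duhamel w); exact: isSolLin_duhamel.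
exact: (getPex ex).
Qed.

Lemma Phi0E w : isL2 T w.2 -> eqS T (Phi0 T A w) (duhamel w).
Proof. by move=> wL; apply: isSolLin_uniq => //; exact: Phi0P. Qed.

Lemma Phi0_isS w : isL2 T w.2 -> isS T (Phi0 T A w).
Proof. by move=> /Phi0P[]. Qed.

Lemma normPhi0P : 0 <= normPhi0 T A /\
  forall w, isL2 T w.2 -> Snorm T (Phi0 T A w) <= normPhi0 T A * Inorm T w.
Proof.
apply: (@inf_bound _ (fun w : Iset R n => isL2 T w.2) (fun w => Snorm T (Phi0 T A w)) (Inorm T)).
  have [c c0 cP] := duhamel_bounded.
  (* The first [c] bounds the sup norm; the rest bounds the L^2 norm of the derivative
     [A *m x + f]. *)
  exists (c + (entry_sum A * (c * Num.sqrt T) + 1)); split.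
    by rewrite !addr_ge0// !mulr_ge0 ?sqrtr_ge0 ?entry_sum_ge0.
  move=> w wL; rewrite (eqS_Snorm (Phi0E wL)).
  have dL := duhamel_isL2 wL; have I0 := Inorm_ge0 w.
  apply: le_trans (Snorm_le (duhamel_isPrim wL) (fun t tT => cP w t wL tT)) _.
  rewrite mulrDl lerD2l; apply: le_trans (L2normD (isL2_mulmx A dL) wL) _.
  rewrite mulrDl mul1r; apply: lerD; last by rewrite lerDr enorm_ge0.
  apply: le_trans (L2norm_mulmx _ dL) _; rewrite -mulrA ler_wpM2l ?entry_sum_ge0// mulrAC.
  apply: L2norm_bounded => //; [|exact: mulr_ge0|by move=> t; exact: cP].
  by move=> i; exact: isL2_measurable.
by move=> w _; exact: Inorm_ge0.
Qed.

(** A nonzero initial value with zero forcing gives a nonzero solution. Positivity is what gives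
    sense to the inverse of this norm in [C']. *)
Lemma normPhi0_gt0 : (0 < n)%N -> 0 < normPhi0 T A.
Proof.
move=> n0; have [K0 KP] := normPhi0P; rewrite lt_neqAle K0 andbT; apply/eqP => K00.
pose w : Iset R n := (const_mx 1, fun=> 0).
have wL : isL2 T w.2 by exact: isL20.
have := KP w wL; rewrite -K00 mul0r; apply/negP; rewrite -ltNge.
apply: lt_le_trans (enorm_le_Snorm (t := 0) (Phi0_isS wL) _); last by rewrite lexx.
rewrite Phi0E ?lexx// duhamel0 lt_neqAle enorm_ge0 andbT eq_sym; apply/eqP => /enorm_eq0.
move=> /matrixP/(_ (Ordinal n0) 0); rewrite !mxE; apply/eqP; exact: oner_neq0.
Qed.

Lemma Phi0_lin a w w' : isL2 T w.2 -> isL2 T w'.2 ->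
  eqS T (Phi0 T A (a *: w.1 + w'.1, fun t => a *: w.2 t + w'.2 t))
        (fun t => a *: Phi0 T A w t + Phi0 T A w' t).
Proof.
move=> wL wL' t tT; have tT' : t <= T by case/andP: tT.
rewrite !Phi0E//=; last by apply: isL2D => //; exact: isL2Z.
have wi := vintg_mexpN tT' wL; have wi' := vintg_mexpN tT' wL'.
rewrite /duhamel /= (eq_vint (g := fun s => a *: (mexp A (- s) *m w.2 s) + mexp A (- s) *m w'.2 s)); last first.
  by move=> s _; rewrite mulmxDr -scalemxAr.
rewrite vintD//; last first.
  exact: vintgZ.
by rewrite vintZ// addrACA mulmxDr -scalerDr -scalemxAr.
Qed.

(** The forcing enters only under an integral, so identities for [F_p] that hold almost everywhere
    become identities between solutions at every time. *)
Lemma Phi0_eqL x0 f f' : isL2 T f -> isL2 T f' -> eqL T f f' ->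
  eqS T (Phi0 T A (x0, f)) (Phi0 T A (x0, f')).
Proof.
move=> fL fL' /eqL_ex[N [mN N0] ff'] t /andP[t0 tT].
rewrite !Phi0E ?t0// /duhamel /=; congr (_ *m (_ + _)); apply/matrixP => i j; rewrite !mxE.
have me (h : R -> 'cV[R]_n) : isL2 T h ->
    measurable_fun (`[0, t]%classic : set R) (fun s => (mexp A (- s) *m h s) i 0).
  by move=> hL; have := @vintg_mexpN (0, h) t tT hL i; exact: intg_measurable.
apply: (eqL_RI mN N0); [exact: me|exact: me|].
by move=> s /andP[s0 st] nN; rewrite ff'// s0 (le_trans st).
Qed.

Lemma Phi0_0 : eqS T (Phi0 T A (0, fun=> 0)) (fun=> 0).
Proof.
move=> t tT; rewrite Phi0E//; last exact: isL20.
by rewrite /duhamel vint_eq0 ?addr0 ?mulmx0// => s _; rewrite mulmx0.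
Qed.

End Operator.
End SolutionOperator.

(** * Kalman condition and minimizers *)

Section Observability.
Variables (R : realType) (T : R).
Local Notation RI := (@Defs.Rint R 0).
Hypothesis T_gt0 : 0 < T.
Let T0 : 0 <= T := ltW T_gt0.

Lemma C1_zero (phi psi : R -> R) (a b : R) : C1 phi psi ->
  (forall t, t \in `]a, b[ -> phi t = 0) -> forall t, t \in `]a, b[ -> psi t = 0.
Proof.
move=> [d _] phi0 t tab.
have dt := d t; have <- : 'D_1 phi t = psi t by apply: derive_val.
rewrite (@near_eq_derive _ _ _ _ (cst 0)) ?derive_cst//.
have := near_in_itvoo tab; apply: filterS => s sab.
by rewrite phi0.
Qed.

(** The primitive of [h] is squeezed between 0 and its value 0 at [T], so its derivative [h]
    vanishes. *)
Lemma RI_eq0_continuous (h : R -> R) : continuous h -> (forall t, 0 <= h t) ->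
  RI T h = 0 -> forall t, t \in `]0, T[ -> h t = 0.
Proof.
move=> ch h0 hT t tT; have := tT; rewrite in_itv/= => /andP[t0 tT'].
have ih := continuous_intg T ch.
have [_ <-] := @continuous_FTC1_closed _ h 0 t T tT' ih t0 (ch t).
rewrite derive1E (@near_eq_derive _ _ _ _ (cst 0)) ?derive_cst//.
have := near_in_itvoo tT; apply: filterS => s; rewrite in_itv/= => /andP[s0 sT].
apply/le_anti/andP; split; last by apply: RI_ge0 => r _.
have sT' : 0 <= s <= T by rewrite (ltW s0) (ltW sT).
by apply: (@le_trans _ _ (RI T h)); [exact: RI_homo|rewrite hT].
Qed.

Section System.
Variables (n m : nat) (A : 'M[R]_n) (B : 'M[R]_(n, m)).
Local Notation Ad := (mexp (- A^T)).

(** Differentiating the vanishing function brings out a factor [- A^T]. *)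
Lemma adj_mul_zero k (N : 'M[R]_(k, n)) (y : 'cV[R]_n) :
  (forall t, t \in `]0, T[ -> N *m (Ad t *m y) = 0) ->
  forall t, t \in `]0, T[ -> N *m A^T *m (Ad t *m y) = 0.
Proof.
move=> N0 t tT; apply/eqP; rewrite -oppr_eq0 -mulNmx -mulmxN; apply/eqP.
apply/matrixP => i j; rewrite ord1 [RHS]mxE {j} -mulmxA.
apply: (@C1_zero (fun t => (N *m (Ad t *m y)) i 0)
  (fun t => (N *m (- A^T *m (Ad t *m y))) i 0) 0 T) tT; last first.
  by move=> s sT; rewrite N0// mxE.
split => [s|].
  have -> : (fun s => (N *m (Ad s *m y)) i 0) = \sum_j (N i j \*: (fun s => (Ad s *m y) j 0)).
    by apply/funext => r; rewrite mxE fct_sumE; apply: eq_bigr.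
  have -> : (N *m (- A^T *m (Ad s *m y))) i 0 = \sum_j (N i j *: ((- A^T *m (Ad s *m y)) j 0)).
    by rewrite mxE; apply: eq_bigr.
  have dl l : is_derive s (1 : R) (N i l \*: (fun s => (Ad s *m y) l 0)) (N i l *: ((- A^T *m (Ad s *m y)) l 0)).
    by apply: is_deriveZ; case: (mexp_mul_C1 (- A^T) y l).
  exact: is_derive_sum.
under eq_fun do rewrite mxE; apply: continuous_sum => j s.
apply: cvgM; first exact: cvg_cst.
by case: (mexp_mul_C1 (- A^T) y j) => _; apply.
Qed.

Lemma trmx_expr (k : nat) : ((A ^+ k)^T = A^T ^+ k)%R.
Proof. by elim: k => [|k IH]; rewrite ?expr0 ?trmx1// exprS trmx_mul IH exprSr. Qed.

(** Repeated differentiation shows that [Ad t *m y] is orthogonal to the columns of every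
    [A ^+ k *m B]; the full row rank makes it zero, and [Ad t] is invertible. *)
Lemma kalman_observable (y : 'cV[R]_n) : kalman A B ->
  (forall t, t \in `]0, T[ -> B^T *m (Ad t *m y) = 0) -> y = 0.
Proof.
move=> kal By0.
have BAy k t : t \in `]0, T[ -> B^T *m A^T ^+ k *m (Ad t *m y) = 0.
  elim: k t => [|k IH] t tT; first by rewrite expr0 mulmx1 By0.
  have -> : A^T ^+ k.+1 = A^T ^+ k *m A^T by exact: exprSr.
  by rewrite (mulmxA B^T (A^T ^+ k)); exact: adj_mul_zero.
(* Any interior time works; the derivatives are known to vanish on the open interval only. *)
pose t := T / 2; have tT : t \in `]0, T[.
  by rewrite in_itv/= divr_gt0//= ltr_pdivrMr// ltr_pMr// ltr1n.
have [z zE] : {z | z = Ad t *m y} by eexists.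
have zK : z^T *m \mxrow_(k < n) (A ^+ k *m B) = 0.
  have h k : z^T *m (A ^+ k *m B) = 0.
    by apply: trmx_inj; rewrite trmx0 !trmx_mul trmxK trmx_expr zE; exact: BAy.
  by rewrite mul_mxrow; apply/matrixP => i j; rewrite mxE h !mxE.
have rf : row_free (\mxrow_(k < n) (A ^+ k *m B)) by rewrite /row_free kal.
have z0 : z = 0.
  apply: trmx_inj; rewrite trmx0; apply: (row_free_inj rf).
  by rewrite zK mul0mx.
by rewrite -[y]mul1mx -(mexpNK (- A^T) t) -mulmxA -zE z0 mulmx0.
Qed.

Definition Wmx (t : R) : 'M[R]_(m, n) := B^T *m Ad t.

Lemma Wmx_continuous i j : continuous (fun t => Wmx t i j).
Proof.
under eq_fun do rewrite mxE; apply: continuous_sum => k s.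
by apply: cvgM; [exact: cvg_cst|exact: mexp_continuous].
Qed.

(** The controllability Gramian, the integral over [0, T] of exp(-tA) B B^T exp(-tA^T); it is the
    Hessian of every [J b] in the initial value. *)
Definition gram : 'M[R]_n := \matrix_(i, j) RI T (fun t => ((Wmx t)^T *m Wmx t) i j).

Lemma WtW_intg i j : intg T (fun t => ((Wmx t)^T *m Wmx t) i j).
Proof.
have -> : (fun t => ((Wmx t)^T *m Wmx t) i j) = (fun t => \sum_k Wmx t k i * Wmx t k j).
  by apply/funext => t; rewrite mxE; apply: eq_bigr => k _; rewrite mxE.
apply: continuous_intg; apply: continuous_sum => k s.
by apply: cvgM; exact: Wmx_continuous.
Qed.

Lemma gram_dotv (z y : 'cV[R]_n) :
  dotv z (gram *m y) = RI T (fun t => dotv (Wmx t *m z) (Wmx t *m y)).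
Proof.
rewrite (eq_RI (g := fun t => \sum_i \sum_j z i 0 * y j 0 * ((Wmx t)^T *m Wmx t) i j)); last first.
  move=> t _; rewrite dotvE trmx_mul -mulmxA mxE; apply: eq_bigr => i _.
  rewrite mulmxA !mxE mulr_sumr; apply: eq_bigr => j _.
  by ring.
rewrite RI_sum => [|i]; last by apply: intg_sum => j; apply: intgZ; exact: WtW_intg.
apply: eq_bigr => i _; rewrite RI_sum => [|j]; last by apply: intgZ; exact: WtW_intg.
rewrite mxE mulr_sumr; apply: eq_bigr => j _.
by rewrite RIZ ?mxE; [rewrite mulrAC mulrA|exact: WtW_intg].
Qed.

Lemma gram_sym (z y : 'cV[R]_n) : dotv z (gram *m y) = dotv y (gram *m z).
Proof. by rewrite !gram_dotv; apply: eq_RI => t _; exact: dotvC. Qed.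

Lemma gram_ge0 (z : 'cV[R]_n) : 0 <= dotv z (gram *m z).
Proof. by rewrite gram_dotv; apply: RI_ge0 => t _; exact: dotv_ge0. Qed.

(** On a vector of the kernel the integral of the squared observation is zero, so by continuity the
    observation vanishes on the open interval and [kalman_observable] applies. *)
Lemma gram_unit : kalman A B -> gram \in unitmx.
Proof.
move=> kal; rewrite -row_free_unit; apply: inj_row_free => v vG.
apply: trmx_inj; rewrite trmx0; apply: kalman_observable => // t tT.
have h0 : RI T (fun t => dotv (Wmx t *m v^T) (Wmx t *m v^T)) = 0.
  by rewrite -gram_dotv dotvE trmxK mulmxA vG mul0mx mxE.
have := RI_eq0_continuous _ _ h0 tT; rewrite -enorm_sqr mulmxA => h.
apply: enorm_eq0; apply/eqP; rewrite -sqrf_eq0; apply/eqP; apply: h => [|s]; last exact: dotv_ge0.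
have cWv i : continuous (fun s => (Wmx s *m v^T) i 0).
  under eq_fun do rewrite mxE; apply: continuous_sum => k s.
  by apply: cvgM; [exact: Wmx_continuous|exact: cvg_cst].
by apply: continuous_sum => i s; apply: cvgM; exact: cWv.
Qed.

Lemma quadratic_stationary (b c : R) : 0 <= c ->
  (forall s, 0 <= b * s + c * s ^+ 2) -> b = 0.
Proof.
move=> c0 h; have := @quadratic_CauchySchwarz _ 0 (b / 2) c (lexx _) c0.
rewrite sqrtr0 mul0r normr_le0 mulf_eq0 invr_eq0 pnatr_eq0 orbF => H.
apply/eqP; apply: H => s; rewrite add0r.
by have -> : 2 * (b / 2) * s = b * s by field.
Qed.

(** Only the first-order condition is needed, the minimizer being given: along each line the cost
    minus its minimum is a nonnegative quadratic without constant term. *)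
Lemma gram_minimizer (l y : 'cV[R]_n) : kalman A B ->
  (forall z, 2^-1 * dotv y (gram *m y) + dotv l y <= 2^-1 * dotv z (gram *m z) + dotv l z) ->
  y = - (invmx gram *m l).
Proof.
move=> kal ymin.
suff Gy : gram *m y = - l by rewrite -mulmxN -Gy mulKmx// gram_unit.
have st d : dotv d (gram *m y + l) = 0.
  apply: (@quadratic_stationary _ (2^-1 * dotv d (gram *m d))) => [|s].
    by rewrite mulr_ge0 ?invr_ge0 ?gram_ge0.
  have := ymin (y + s *: d); rewrite -subr_ge0 mulmxDr -scalemxAr.
  rewrite !(dotvDl, dotvDr, dotvZl, dotvZr) (gram_sym y d) (dotvC d l).
  by move=> h; lra.
(* Stationarity is tested in the direction of the gradient itself. *)
apply/eqP; rewrite -addr_eq0; apply/eqP; apply: enorm_eq0.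
by rewrite enormE st sqrtr0.
Qed.

(** The vector that represents the linear part of [J b] as a function of the initial value; see
    [obs_functionalP]. *)
Definition obs_functional (x0 : 'cV[R]_n) (f : R -> 'cV[R]_n) : 'cV[R]_n :=
  x0 + vint (fun t => (Ad t)^T *m f t) 0 T.

Let AdT_continuous i j : continuous (fun t => (Ad t)^T i j).
Proof. by under eq_fun do rewrite mxE; exact: mexp_continuous. Qed.

Lemma obs_functionalP x0 f z : isL2 T f ->
  dotv (obs_functional x0 f) z = dotv x0 z + RI T (fun t => dotv (Ad t *m z) (f t)).
Proof.
move=> fL; rewrite dotvDl; congr (_ + _).
have fi : vintg T (fun t => (Ad t)^T *m f t) by apply: vintg_contM => //; exact: isL2_vintg.
rewrite (eq_RI (g := fun t => \sum_i z i 0 * ((Ad t)^T *m f t) i 0)); last first.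
  by move=> t _; rewrite -[Ad t]trmxK dotv_trmx trmxK.
rewrite RI_sum => [|i]; last exact: intgZ.
by apply: eq_bigr => i _; rewrite mxE RIZ// mulrC.
Qed.

Lemma obs_functional_bounded : exists2 c, 0 <= c & forall x0 f, isL2 T f ->
  enorm (obs_functional x0 f) <= c * Inorm T (x0, f).
Proof.
have [K K0 KP] := entry_sum_bounded T AdT_continuous.
pose c := n%:R * (K * Num.sqrt T); have c0 : 0 <= c by rewrite !mulr_ge0 ?sqrtr_ge0.
exists (1 + c) => [|x0 f fL]; first by rewrite addr_ge0.
apply: le_trans (enormD _ _) _.
apply: (@le_trans _ _ (enorm x0 + c * L2norm T f)).
  by rewrite lerD2l; apply: enorm_vint_mul => //; rewrite T0 lexx.
rewrite /Inorm /=; have := enorm_ge0 x0; have := L2norm_ge0 T f; nra.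
Qed.

Lemma Wmx_bounded : exists2 K, 0 <= K &
  forall t y, 0 <= t <= T -> enorm (Wmx t *m y) <= K * enorm y.
Proof.
have [K K0 KP] := entry_sum_bounded T (@mexp_continuous _ _ (- A^T)).
exists (entry_sum B^T * K) => [|t y tT]; first by rewrite mulr_ge0 ?entry_sum_ge0.
rewrite -mulmxA -mulrA; apply: le_trans (enorm_mulmx _ _) _.
rewrite ler_wpM2l ?entry_sum_ge0//; apply: le_trans (enorm_mulmx _ _) _.
by rewrite ler_wpM2r ?enorm_ge0 ?KP.
Qed.

(* The unique minimizer is [- gram^-1 l], so the control is bounded by the data, and by duality
   the Euler-Lagrange equation says exactly that the controlled solution vanishes at time [T]. *)
Lemma minimizer_control : kalman A B -> exists2 c, 0 <= c &
  forall x0 f v y, isL2 T f -> isAdj T A y -> eqS T v (fun t => B^T *m y t) ->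
  (forall y', isAdj T A y' ->
    2^-1 * RI T (fun t => enorm (B^T *m y t) ^+ 2) +
      (dotv x0 (y 0) + RI T (fun t => dotv (y t) (f t))) <=
    2^-1 * RI T (fun t => enorm (B^T *m y' t) ^+ 2) +
      (dotv x0 (y' 0) + RI T (fun t => dotv (y' t) (f t)))) ->
  [/\ isL2 T v, L2norm T v <= c * Inorm T (x0, f) &
      Phi0 T A (x0, fun t => B *m v t + f t) T = 0].
Proof.
move=> kal; have [c c0 cP] := obs_functional_bounded; have [K K0 KP] := Wmx_bounded.
exists (K * (entry_sum (invmx gram) * c) * Num.sqrt T).
  by rewrite !mulr_ge0 ?sqrtr_ge0 ?entry_sum_ge0.
move=> x0 f v y fL ya vE ymin.
have yE := isAdjP T0 ya.
have I0 : 0 <= Inorm T (x0, f) by exact: Inorm_ge0.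
have cost z : 2^-1 * RI T (fun t => enorm (B^T *m (Ad t *m z)) ^+ 2) +
      (dotv x0 z + RI T (fun t => dotv (Ad t *m z) (f t))) =
      2^-1 * dotv z (gram *m z) + dotv (obs_functional x0 f) z.
  rewrite obs_functionalP// gram_dotv; congr (_ * _ + _); apply: eq_RI => t _.
  by rewrite enorm_sqr /Wmx mulmxA.
have y0E : y 0 = - (invmx gram *m obs_functional x0 f).
  apply: gram_minimizer => // z; rewrite -!cost.
  have := ymin _ (@isAdj_mexp _ _ T A z); rewrite mexp0 mul1mx; apply: le_trans.
  rewrite (eq_RI (f := fun t => enorm (B^T *m y t) ^+ 2)
    (g := fun t => enorm (B^T *m (Ad t *m y 0)) ^+ 2)); last by move=> t tT; rewrite (yE t).
  rewrite (eq_RI (f := fun t => dotv (y t) (f t)) (g := fun t => dotv (Ad t *m y 0) (f t))) => [|t tT].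
    exact: lexx.
  by rewrite (yE t).
have vW t : 0 <= t <= T -> v t = Wmx t *m y 0.
  by move=> tT; rewrite vE// (yE t)// mulmxA.
have vM i : measurable_fun (`[0, T]%classic : set R) (fun t => v t i 0).
  apply: (eq_measurable_fun (fun t => \sum_j Wmx t i j * y 0 j 0)).
    by move=> t; rewrite inE/= in_itv/= => tT; rewrite vW// mxE.
  apply: measurable_sum => j; apply: measurable_funM; last exact: measurable_cst.
  by apply: continuous_measurable_itv => //; exact: Wmx_continuous.
have vB t : 0 <= t <= T -> enorm (v t) <= K * (entry_sum (invmx gram) * c) * Inorm T (x0, f).
  move=> tT; rewrite vW//; apply: le_trans (KP _ _ tT) _; rewrite -!mulrA ler_wpM2l//.
  rewrite y0E enormN; apply: le_trans (enorm_mulmx _ _) _.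
  by rewrite ler_wpM2l ?entry_sum_ge0// cP.
have vL : isL2 T v by exact: isL2_bounded vB.
split => //.
  rewrite mulrAC; apply: L2norm_bounded => //.
  by rewrite !mulr_ge0 ?entry_sum_ge0.
pose w : Iset R n := (x0, fun t => B *m v t + f t).
have wL : isL2 T w.2 by apply: isL2D => //; exact: isL2_mulmx.
have [xS xE] := Phi0P T0 A wL.
(* [Ad T] is invertible, so the vectors [Ad T *m z] are all vectors. *)
suff orth z : dotv (Phi0 T A w T) (Ad T *m z) = 0.
  apply: enorm_eq0; rewrite enormE.
  rewrite -[X in dotv _ X]mul1mx -(mexpKN (- A^T) T) -[X in dotv _ X]mulmxA orth.
  by rewrite sqrtr0.
rewrite (@duality _ _ A T x0 z w.2)//; last 2 first.
- exact: isL2_vintg.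
- by apply: isL2_vintg; exact: isS_isL2.
have Adz i : C1 (fun t => (Ad t *m z) i 0) (fun t => (- A^T *m (Ad t *m z)) i 0) by exact: mexp_mul_C1.
have di (h : R -> 'cV[R]_n) : isL2 T h -> intg T (fun t => dotv (Ad t *m z) (h t)).
  move=> hL; apply: intg_sum => i; apply: intg_contM; first exact: C1_continuous (Adz i).
  exact: isL2_vintg.
rewrite (eq_RI (g := fun t => dotv (Ad t *m z) (B *m v t) + dotv (Ad t *m z) (f t))); last first.
  by move=> t _; rewrite dotvDr.
have BvL : isL2 T (fun t => B *m v t) by exact: isL2_mulmx.
rewrite RID; [|exact: di|exact: di].
rewrite addrCA -obs_functionalP//.
have -> : RI T (fun t => dotv (Ad t *m z) (B *m v t)) = dotv z (gram *m y 0).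
  rewrite gram_dotv; apply: eq_RI => t tT.
  by rewrite -dotv_trmx mulmxA vW.
(* The Gramian applied to [y 0] is the opposite of the vector of the data. *)
by rewrite y0E mulmxN mulKVmx ?gram_unit// dotvC dotvNl addNr.
Qed.

End System.
End Observability.

(** * Sums over trees *)

Section Products.

(** The index set for expanding a product of sums, or a multilinear map evaluated at sums. *)
Fixpoint prods (I : Type) (Ls : seq (seq I)) : seq (seq I) :=
  if Ls is L :: Ls' then [seq i :: ks | i <- L, ks <- prods Ls'] else [:: [::]].

Lemma mem_prods (I : eqType) (L : seq I) Ls ks :
  (ks \in prods (L :: Ls)) = if ks is i :: ks' then (i \in L) && (ks' \in prods Ls) else false.
Proof.
apply/allpairsP/idP => [[[i ks'] /= [iL isL ->]]|]; first by rewrite iL isL.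
by case: ks => // i ks /andP[iL isL]; exists (i, ks).
Qed.

Lemma mem_prods_nseq (I : eqType) p (W : seq I) ks :
  (ks \in prods (nseq p W)) = (size ks == p) && all [in W] ks.
Proof.
elim: p ks => [|p IH] ks; first by rewrite inE -size_eq0; case: ks.
by rewrite mem_prods; case: ks => //= i ks; rewrite IH eqSS andbCA.
Qed.

Lemma uniq_prods_nseq (I : eqType) p (W : seq I) : uniq W -> uniq (prods (nseq p W)).
Proof.
move=> uW; elim: p => //= p IH; apply: allpairs_uniq => //.
by move=> [i ks] [j js] _ _ /= [-> ->].
Qed.

Lemma sum_prods (R : comRingType) (I : Type) (a : I -> R) (Ls : seq (seq I)) :
  \sum_(ks <- prods Ls) \prod_(i <- ks) a i = \prod_(L <- Ls) \sum_(i <- L) a i.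
Proof.
elim: Ls => [|L Ls IH] /=; first by rewrite big_seq1 !big_nil.
rewrite big_cons -IH big_allpairs_dep mulr_suml; apply: eq_bigr => i _.
by rewrite mulr_sumr; apply: eq_bigr => ks _; rewrite big_cons.
Qed.

Lemma ler_sum_subset (R : realType) (I : eqType) (g : I -> R) (s l : seq I) :
  (forall i, i \in l -> 0 <= g i) -> uniq s -> {subset s <= l} ->
  \sum_(i <- s) g i <= \sum_(i <- l) g i.
Proof.
elim: s l => [|i s IH] l g0 /=.
  by move=> _ _; rewrite big_nil big_seq_cond; apply: sumr_ge0 => i /andP[/g0].
move=> /andP[ks us] sl; have il : i \in l by apply: sl; rewrite mem_head.
rewrite (perm_big _ (perm_to_rem il)) /= !big_cons lerD2l IH//.
  by move=> j /mem_rem; exact: g0.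
move=> j js; have jl : j \in l by apply: sl; rewrite inE js orbT.
have := jl; rewrite (perm_mem (perm_to_rem il)) inE => /predU1P[ji|//].
by move: ks; rewrite -ji js.
Qed.

End Products.

Section Trees.

(** [tree] is nested in [seq], so the generated principle has no hypothesis on the children. *)
Lemma tree_children_ind (P : tree -> Prop) :
  (forall cs, (forall c, c \in cs -> P c) -> P (Node cs)) -> forall b, P b.
Proof.
move=> H; fix IH 1 => -[cs]; apply: H.
elim: cs => [c|c cs IHcs d]; first by clear IH; rewrite in_nil.
by rewrite inE => /predU1P[->|]; [exact: IH|exact: IHcs].
Qed.

(** A named copy of the anonymous fixpoint inside [cuts], so that statements can be made about it;
    [goPhi] plays the same part for [Phi]. *)
Definition gocuts := fix go (cs : seq tree) : seq (seq tree * seq tree) :=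
  match cs with
  | [::] => [:: ([::], [::])]
  | c :: cs' => [seq (p.1 :: q.1, p.2 ++ q.2) | p <- cuts c, q <- go cs']
  end.

Lemma cuts_node cs : cs != [::] ->
  cuts (Node cs) = (leaf, [:: Node cs]) :: [seq (Node q.1, q.2) | q <- gocuts cs].
Proof. by case: cs. Qed.

(** To cut a forest is to cut each of its trees independently. In this form the cuts match the index
    set of [Fseq_expand]. *)
Lemma gocutsE cs : gocuts cs =
  [seq ([seq p.1 | p <- ps], flatten [seq p.2 | p <- ps]) | ps <- prods [seq cuts c | c <- cs]].
Proof.
elim: cs => //= c cs ->; rewrite map_allpairs.
by elim: (cuts c) => //= p L ->; rewrite -map_comp.
Qed.

Lemma validb_node cs : validb (Node cs) = (size cs != 1)%N && all validb cs.
Proof. by []. Qed.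

Lemma ninner_node cs : cs != [::] -> ninner (Node cs) = (sumn (map ninner cs)).+1.
Proof. by case: cs. Qed.

Lemma nleaves_node cs : cs != [::] -> nleaves (Node cs) = sumn (map nleaves cs).
Proof. by case: cs. Qed.

Lemma ninner_child cs c : c \in cs -> (ninner c < ninner (Node cs))%N.
Proof.
move=> ccs; rewrite ninner_node; last by case: cs ccs.
rewrite ltnS; elim: cs ccs => //= d cs IH; rewrite inE => /predU1P[->|/IH h].
  exact: leq_addr.
by rewrite (leq_trans h)// leq_addl.
Qed.

Lemma cuts_spec b : validb b -> forall p, p \in cuts b ->
  size p.2 = nleaves p.1 /\ all validb p.2.
Proof.
elim/tree_children_ind: b => cs IH vb p.
have [->|cs0] := eqVneq cs [::]; first by rewrite inE => /eqP ->.
rewrite cuts_node// inE => /predU1P[->|]; first by rewrite /= -/(validb (Node cs)) vb.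
move=> /mapP[q]; rewrite gocutsE => /mapP[ps psP ->] -> /=.
have ps0 : ps != [::].
  by case: cs cs0 psP {IH vb} => // c cs _; rewrite /= mem_prods; case: ps.
have {ps0} : [seq p0.1 | p0 <- ps] != [::] by case: ps ps0 {psP}.
move=> /nleaves_node /= ->; rewrite size_flatten /shape -!map_comp.
have {cs0} vcs : all validb cs by case/andP: vb.
elim: cs ps IH vcs psP {vb q} => [|c cs IHcs] ps IH; first by rewrite inE => _ /eqP ->.
move=> /= /andP[vc vcs]; rewrite mem_prods; case: ps => // p0 ps /andP[p0c psP] /=.
have [] := IHcs ps _ vcs psP; first by move=> d dcs; apply: IH; rewrite inE dcs orbT.
have [-> h2 -> h4] := IH c (mem_head _ _) vc p0 p0c.
by rewrite all_cat h2 h4.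
Qed.

End Trees.

(** * Majorants for recursive inequalities on trees *)

Section TreeMajorant.
Variables (R : realType) (alpha : tree -> R) (o : nat -> R).
Hypothesis alpha0 : forall b, validb b -> 0 <= alpha b.
Hypothesis o0 : forall p, 0 <= o p.

(** With [alpha] the size of the solutions attached to trees and [o p] the norm of F_p, this is the
    multilinear bound on the forcing at [b]. *)
Definition tbeta (b : tree) : R := o (size (children b)) * \prod_(c <- children b) alpha c.

(** The trees with [p] children, [1 < p < N], all taken from [W]; the strict upper bound matches
    partial sums over [p < N]. *)
Definition grow (W : seq tree) (N : nat) : seq tree :=
  [seq Node cs | p <- [seq p <- iota 0 N | (1 < p)%N], cs <- prods (nseq p W)].

Lemma mem_grow W N cs :
  (Node cs \in grow W N) = (1 < size cs < N)%N && all [in W] cs.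
Proof.
apply/allpairsPdep/idP => [[p [cs' [pN cs'P [->]]]]|/andP[csN csW]].
  move: pN cs'P; rewrite mem_filter mem_iota add0n mem_prods_nseq => /andP[p1 /= pN].
  by move=> /andP[/eqP -> ->]; rewrite p1 pN.
exists (size cs), cs; rewrite mem_filter mem_iota add0n mem_prods_nseq eqxx csW.
by case/andP: csN => -> ->.
Qed.

Lemma uniq_grow W N : uniq W -> uniq (grow W N).
Proof.
move=> uW; apply: allpairs_uniq_dep.
- by rewrite filter_uniq ?iota_uniq.
- by move=> p _; exact: uniq_prods_nseq.
move=> _ _ /allpairsPdep[p [cs [_ csP ->]]] /allpairsPdep[q [ds [_ dsP ->]]] /= [csds].
move: csP dsP; rewrite csds !mem_prods_nseq => /andP[/eqP <- _] /andP[/eqP <- _].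
by [].
Qed.

Lemma valid_grow W N : all validb W -> all validb (grow W N).
Proof.
move=> vW; apply/allP => -[cs]; rewrite mem_grow validb_node => /andP[/andP[c1 _] /allP csW].
rewrite neq_ltn c1 orbT /=; apply/allP => c /csW; exact: (allP vW).
Qed.

Lemma big_grow (V : nmodType) W N (g : tree -> V) :
  \sum_(b <- grow W N) g b =
  \sum_(p < N | (1 < p)%N) \sum_(cs <- prods (nseq p W)) g (Node cs).
Proof.
have e : iota 0 N = index_iota 0 N by rewrite /index_iota subn0.
rewrite big_allpairs_dep big_filter e big_mkord.
by [].
Qed.

Lemma tbeta_ge0 b : validb b -> 0 <= tbeta b.
Proof.
case: b => cs /andP[_ /allP vcs]; rewrite mulr_ge0// big_seq_cond prodr_ge0// => c.
by rewrite andbT => /vcs/alpha0.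
Qed.

(** Over all choices of [p] children in [W] the sum of the products is the [p]-th power of the sum
    over [W]; the terms with [p < 2] on the right are nonnegative. *)
Lemma sum_tbeta_grow W N : all validb W ->
  \sum_(b <- grow W N) tbeta b <= \sum_(p < N) o p * (\sum_(c <- W) alpha c) ^+ p.
Proof.
move=> vW; have S0 : 0 <= \sum_(c <- W) alpha c.
  by rewrite big_seq_cond; apply: sumr_ge0 => c /andP[/(allP vW)/alpha0].
rewrite big_grow [leLHS]big_mkcond; apply: ler_sum => p _; case: ifP => _; last first.
  by rewrite mulr_ge0 ?exprn_ge0.
rewrite (eq_big_seq (fun cs => o p * \prod_(c <- cs) alpha c)) => [|cs]; last first.
  by rewrite mem_prods_nseq => /andP[/eqP <- _].
rewrite -mulr_sumr sum_prods ler_wpM2l//.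
by elim: (p : nat) => [|q IH]; rewrite /= ?big_nil ?expr0 ?big_cons ?exprS// ler_wpM2l.
Qed.

Variables (M Phi : R).
Hypothesis Phi_ub : forall N, \sum_(p < N) o p * M ^+ p <= Phi.

(** [Fs] is contained in [grow W N], for [W] the set of all children and [N] above all root degrees.
    The terms added are nonnegative, and the larger sum factors. *)
Lemma sum_tbeta Fs : uniq Fs -> all validb Fs -> leaf \notin Fs ->
  \sum_(c <- undup (flatten (map children Fs))) alpha c <= M ->
  \sum_(b <- Fs) tbeta b <= Phi.
Proof.
move=> uFs vFs lFs; set W := undup _ => WM.
have vW : all validb W.
  apply/allP => c; rewrite mem_undup => /flattenP[_ /mapP[[cs] csF ->] /= ccs].
  by have /andP[_ /allP] := allP vFs _ csF; apply.
have S0 : 0 <= \sum_(c <- W) alpha c.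
  by rewrite big_seq_cond; apply: sumr_ge0 => c /andP[/(allP vW)/alpha0].
pose N := (\max_(b <- Fs) (size (children b)).+1)%N.
apply: (@le_trans _ _ (\sum_(b <- grow W N) tbeta b)).
  apply: ler_sum_subset => //.
    by move=> b /(allP (valid_grow N vW)); exact: tbeta_ge0.
  move=> [cs] csF; rewrite mem_grow; apply/andP; split; last first.
    apply/allP => c ccs; rewrite mem_undup; apply/flattenP.
    by exists cs => //; apply/mapP; exists (Node cs).
  have /andP[c1 _] := allP vFs _ csF.
  have c0 : size cs != 0%N.
    by apply: contra lFs => /nilP cs0; rewrite -[leaf]/(Node [::]) -cs0.
  rewrite ltn_neqAle eq_sym c1 lt0n c0 /=.
  by rewrite /N (big_rem _ csF) /= leq_max leqnn.
apply: le_trans (sum_tbeta_grow N vW) _.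
apply: le_trans (Phi_ub N); apply: ler_sum => p _.
by rewrite ler_wpM2l// lerXn2r ?nnegrE// (le_trans S0).
Qed.

(** A single step of the recursion, for a quantity [g] that may differ from [alpha]: the same step
    later bounds controls and forcings once the solutions are bounded. *)
Lemma sum_le_tbeta (g theta : tree -> R) (kappa Th : R) Fs : 0 <= kappa ->
  (forall b, validb b -> g b <= theta b + (if b == leaf then 0 else kappa * tbeta b)) ->
  uniq Fs -> all validb Fs -> \sum_(b <- Fs) theta b <= Th ->
  \sum_(c <- undup (flatten (map children [seq b <- Fs | b != leaf]))) alpha c <= M ->
  \sum_(b <- Fs) g b <= Th + kappa * Phi.
Proof.
move=> kappa0 g_le uFs vFs thF aM.
apply: (@le_trans _ _ (\sum_(b <- Fs) (theta b + (if b == leaf then 0 else kappa * tbeta b)))).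
  by rewrite big_seq [leRHS]big_seq; apply: ler_sum => b /(allP vFs); exact: g_le.
rewrite big_split /= lerD//.
have -> : \sum_(b <- Fs) (if b == leaf then 0 else kappa * tbeta b) =
    kappa * \sum_(b <- [seq b <- Fs | b != leaf]) tbeta b.
  rewrite big_filter mulr_sumr [RHS]big_mkcond; apply: eq_bigr => b _.
  by case: (b == leaf).
rewrite ler_wpM2l//; apply: sum_tbeta => //.
- by rewrite filter_uniq.
- by apply/allP => b; rewrite mem_filter => /andP[_]; exact: (allP vFs).
- by rewrite mem_filter eqxx.
Qed.

Variables (theta : tree -> R) (kappa Th : R).
Hypothesis kappa0 : 0 <= kappa.
Hypothesis alpha_le : forall b, validb b ->
  alpha b <= theta b + (if b == leaf then 0 else kappa * tbeta b).
Hypothesis theta_ub : forall Fs, uniq Fs -> all validb Fs -> \sum_(b <- Fs) theta b <= Th.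
Hypothesis ThM : Th + kappa * Phi <= M.

(* Induction on the number of internal vertices: the children of the trees of a finite family
   have fewer of them, and bound the family through [sum_le_tbeta]. *)
Lemma tree_majorant Fs : uniq Fs -> all validb Fs -> \sum_(b <- Fs) alpha b <= M.
Proof.
have Th0 : 0 <= Th by have := @theta_ub [::] isT isT; rewrite big_nil.
have Phi0 : 0 <= Phi by have := Phi_ub 0; rewrite big_ord0.
suff H h : forall Fs, uniq Fs -> all validb Fs -> all (fun b => ninner b < h)%N Fs ->
    \sum_(b <- Fs) alpha b <= M.
  move=> uFs vFs; apply: (H (\max_(b <- Fs) (ninner b).+1)%N) => //.
  by apply/allP => b bF; rewrite (big_rem _ bF) /= leq_max leqnn.
elim: h => [|h IH] {}Fs uFs vFs hFs.
  case: Fs uFs vFs hFs => // *; rewrite big_nil.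
  by apply: le_trans ThM; rewrite addr_ge0// mulr_ge0.
apply: le_trans ThM; apply: (@sum_le_tbeta _ theta) => //; first exact: theta_ub.
have GF b : b \in [seq b <- Fs | b != leaf] -> b \in Fs by rewrite mem_filter => /andP[].
apply: IH.
- exact: undup_uniq.
- apply/allP => c; rewrite mem_undup => /flattenP[_ /mapP[[cs] csF ->] /= ccs].
  by have /andP[_ /allP] := allP vFs _ (GF _ csF); apply.
apply/allP => c; rewrite mem_undup => /flattenP[_ /mapP[[cs] csF ->] /= ccs].
have := allP hFs _ (GF _ csF); rewrite ltnS; apply: leq_trans.
exact: ninner_child.
Qed.

End TreeMajorant.

(** * Multilinear expansions *)

Section Multilinear.
Variables (R : realType) (T : R) (n : nat) (F : Fam R n).
Hypothesis T0 : 0 <= T.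
Hypothesis HF : H1 T F.
Local Notation fun0 := (fun=> 0 : 'cV[R]_n).

(** Quantified over all indices: the default is the zero function, which lies in S, so no bound on
    the index has to be carried. *)
Definition allS (ws : seq (fn R n)) := forall k, isS T (nth fun0 ws k).

Lemma allS_cons w ws : isS T w -> allS ws -> allS (w :: ws).
Proof. by move=> wS wsS [|k] //=; exact: wsS. Qed.

Lemma allS_cat ws ws' : allS ws -> allS ws' -> allS (ws ++ ws').
Proof. by move=> wS wS' k; rewrite nth_cat; case: ifP. Qed.

Lemma allS_nil : allS [::].
Proof. by move=> k; rewrite nth_nil; exact: isS0. Qed.

Lemma allS_map (I : eqType) (phi : I -> fn R n) (s : seq I) :
  (forall i, i \in s -> isS T (phi i)) -> allS [seq phi i | i <- s].
Proof.
elim: s => [|i s IH] h; first exact: allS_nil.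
apply: allS_cons; first by apply: h; rewrite mem_head.
by apply: IH => j js; apply: h; rewrite inE js orbT.
Qed.

Lemma allS_nseq k x : isS T x -> allS (nseq k x).
Proof. by move=> xS; elim: k => [|k IH]; [exact: allS_nil|exact: allS_cons]. Qed.

(** The arity [size ws] occurs in the type of the arguments; this replaces it by a fixed [p], so
    that lists of equal length can be compared. *)
Lemma Fseq_size p ws : size ws = p -> Fseq F ws = F (fun i : 'I_p => nth fun0 ws i).
Proof. by move=> <-. Qed.

Lemma Fseq_isL2 ws : allS ws -> isL2 T (Fseq F ws).
Proof. by case: HF => _ [_ [h _]] wsS; apply: h => i; exact: wsS. Qed.

Lemma opFP p : 0 <= opF T F p /\ forall w : 'I_p -> fn R n, (forall i, isS T (w i)) ->
  L2norm T (F w) <= opF T F p * \prod_i Snorm T (w i).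
Proof.
case: HF => _ [_ [_ [_ [h _]]]].
apply: (@inf_bound _ _ (fun w : 'I_p -> fn R n => forall i, isS T (w i))
  (fun w => L2norm T (F w)) (fun w => \prod_i Snorm T (w i))); first exact: h.
by move=> w wS; apply: prodr_ge0 => i _; exact: Snorm_ge0.
Qed.

Lemma Fseq_bound ws : allS ws ->
  L2norm T (Fseq F ws) <= opF T F (size ws) * \prod_(w <- ws) Snorm T w.
Proof.
move=> wsS; rewrite (big_nth fun0) big_mkord.
by apply: (proj2 (opFP (size ws))) => i; exact: wsS.
Qed.

(** Linearity in one slot, moved from updates of a function on ['I_p] to lists split at that slot;
    the three lists share the length [p]. *)
Lemma Fseq_lin pre post a x y : allS pre -> allS post -> isS T x -> isS T y ->
  eqL T (Fseq F (pre ++ (fun t => a *: x t + y t) :: post))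
        (fun t => a *: Fseq F (pre ++ x :: post) t + Fseq F (pre ++ y :: post) t).
Proof.
move=> preS postS xS yS; pose p := (size pre + (size post).+1)%N.
have szE z : size (pre ++ z :: post) = p by rewrite size_cat.
have lt_p : (size pre < p)%N by rewrite /p -addSnnS leq_addr.
pose w (i : 'I_p) := nth fun0 (pre ++ x :: post) i.
have updE z : upd w (Ordinal lt_p) z = (fun i : 'I_p => nth fun0 (pre ++ z :: post) i).
  apply/funext => i; rewrite /upd -val_eqE /= /w !nth_cat.
  case: (ltngtP i (size pre)) => [//|lt_pi|->]; last by rewrite subnn.
  by rewrite -(subnSK lt_pi).
rewrite !(Fseq_size (szE _)) -!updE.
case: HF => _ [_ [_ [h _]]]; apply: h => // i.
by apply: allS_cat => //; exact: allS_cons.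
Qed.

Lemma Fseq_zero pre post : allS pre -> allS post ->
  eqL T (Fseq F (pre ++ fun0 :: post)) fun0.
Proof.
(* Since -1 * 0 + 0 = 0, linearity gives F(0) = - F(0) + F(0). *)
move=> preS postS; have := Fseq_lin (-1) preS postS (@isS0 _ T _) (@isS0 _ T _).
under eq_fun do rewrite scaler0 addr0; move=> h; apply: eqL_trans h _.
by apply: eqL_refl => t _; rewrite scaleN1r addNr.
Qed.

Lemma FseqZ pre post a x : allS pre -> allS post -> isS T x ->
  eqL T (Fseq F (pre ++ (fun t => a *: x t) :: post))
        (fun t => a *: Fseq F (pre ++ x :: post) t).
Proof.
move=> preS postS xS; have := Fseq_lin a preS postS xS (@isS0 _ T _).
under eq_fun do rewrite addr0; move=> h; apply: eqL_trans h _.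
apply: eqL_trans (eqL_lin a (eqL_refl (fun _ _ => erefl)) (Fseq_zero preS postS)) _.
by apply: eqL_refl => t _; rewrite addr0.
Qed.

Lemma Fseq_sum pre post (I : eqType) (phi : I -> fn R n) (L : seq I) :
  allS pre -> allS post -> (forall i, i \in L -> isS T (phi i)) ->
  eqL T (Fseq F (pre ++ (fun t => \sum_(i <- L) phi i t) :: post))
        (fun t => \sum_(i <- L) Fseq F (pre ++ phi i :: post) t).
Proof.
move=> preS postS; elim: L => [|i L IH] LS.
  under [X in eqL _ _ X]eq_fun do rewrite big_nil.
  have -> : (fun t => \sum_(i <- [::]) phi i t) = fun0 by apply/funext => t; rewrite big_nil.
  exact: Fseq_zero.
have LS' j : j \in L -> isS T (phi j) by move=> jL; apply: LS; rewrite inE jL orbT.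
have -> : (fun t => \sum_(j <- i :: L) phi j t) = (fun t => 1 *: phi i t + \sum_(j <- L) phi j t).
  by apply/funext => t; rewrite big_cons scale1r.
apply: eqL_trans (Fseq_lin 1 preS postS (LS _ (mem_head _ _)) (isS_sum T0 LS')) _.
apply: eqL_trans (eqL_lin 1 (eqL_refl (fun _ _ => erefl)) (IH LS')) _.
by apply: eqL_refl => t _; rewrite big_cons scale1r.
Qed.

(** [pre] collects the arguments already expanded, which lets the induction run from left to
    right. *)
Lemma Fseq_expand_pre (I : eqType) (phi : I -> fn R n) (Ls : seq (seq I)) pre :
  (forall L i, L \in Ls -> i \in L -> isS T (phi i)) -> allS pre ->
  eqL T (Fseq F (pre ++ [seq (fun t => \sum_(i <- L) phi i t) | L <- Ls]))
        (fun t => \sum_(ks <- prods Ls) Fseq F (pre ++ [seq phi i | i <- ks]) t).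
Proof.
elim: Ls pre => [|L Ls IH] pre LsS preS /=.
  by apply: eqL_refl => t _; rewrite big_seq1.
have LS i : i \in L -> isS T (phi i) by apply: LsS; rewrite mem_head.
have LsS' L' i : L' \in Ls -> i \in L' -> isS T (phi i).
  by move=> L'Ls; apply: LsS; rewrite inE L'Ls orbT.
apply: eqL_trans (Fseq_sum preS _ LS) _.
  by apply: allS_map => L' L'Ls; apply: (isS_sum T0) => i; exact: LsS'.
apply: (@eqL_trans _ _ _ _ (fun t => \sum_(i <- L) \sum_(ks <- prods Ls)
    Fseq F ((pre ++ [:: phi i]) ++ [seq phi j | j <- ks]) t)).
  apply: eqL_sum => i iL; rewrite -cat_rcons -cats1; apply: IH => //.
  by apply: allS_cat => //; apply: allS_cons; [exact: LS|exact: allS_nil].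
apply: eqL_refl => t _; rewrite big_allpairs_dep; apply: eq_bigr => i _.
by apply: eq_bigr => ks _; rewrite -catA.
Qed.

Lemma Fseq_expand (I : eqType) (phi : I -> fn R n) (Ls : seq (seq I)) :
  (forall L i, L \in Ls -> i \in L -> isS T (phi i)) ->
  eqL T (Fseq F [seq (fun t => \sum_(i <- L) phi i t) | L <- Ls])
        (fun t => \sum_(ks <- prods Ls) Fseq F [seq phi i | i <- ks] t).
Proof. by move=> LsS; apply: (Fseq_expand_pre (pre := [::])) => //; exact: allS_nil. Qed.

Lemma Fseq_scale_pre (I : eqType) (phi : I -> fn R n) (a : I -> R) (ks : seq I) pre :
  (forall i, i \in ks -> isS T (phi i)) -> allS pre ->
  eqL T (Fseq F (pre ++ [seq (fun t => a i *: phi i t) | i <- ks]))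
        (fun t => (\prod_(i <- ks) a i) *: Fseq F (pre ++ [seq phi i | i <- ks]) t).
Proof.
elim: ks pre => [|i ks IH] pre kS preS /=.
  by apply: eqL_refl => t _; rewrite big_nil scale1r.
have kS' j : j \in ks -> isS T (phi j) by move=> jk; apply: kS; rewrite inE jk orbT.
have iS : isS T (phi i) by apply: kS; rewrite mem_head.
apply: eqL_trans (FseqZ (a i) preS _ iS) _.
  by apply: allS_map => j jk; apply: (isSZ T0); exact: kS'.
rewrite -!cat_rcons -cats1.
apply: eqL_trans (eqLZ (a i) (IH _ kS' _)) _.
  by apply: allS_cat => //; apply: allS_cons; [|exact: allS_nil].
by apply: eqL_refl => t _; rewrite big_cons scalerA.
Qed.

Lemma Fseq_scale (I : eqType) (phi : I -> fn R n) (a : I -> R) (ks : seq I) :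
  (forall i, i \in ks -> isS T (phi i)) ->
  eqL T (Fseq F [seq (fun t => a i *: phi i t) | i <- ks])
        (fun t => (\prod_(i <- ks) a i) *: Fseq F [seq phi i | i <- ks] t).
Proof. by move=> kS; apply: (Fseq_scale_pre a (pre := [::]) kS); exact: allS_nil. Qed.

(** Telescoping: the arguments [x] are replaced by [y] one at a time. [pre] holds those already
    replaced, with product of norms at most [rho ^+ q]. *)
Lemma Fseq_lipschitz p rho : 0 <= rho -> exists2 c, 0 <= c & forall x y, isS T x -> isS T y ->
  Snorm T x <= rho -> Snorm T y <= rho ->
  L2norm T (fun t => Fseq F (nseq p x) t - Fseq F (nseq p y) t) <=
  c * Snorm T (fun t => x t - y t).
Proof.
move=> rho0.
suff H k q : exists2 c, 0 <= c & forall pre x y, size pre = q -> allS pre ->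
   \prod_(w <- pre) Snorm T w <= rho ^+ q ->
   isS T x -> isS T y -> Snorm T x <= rho -> Snorm T y <= rho ->
   L2norm T (fun t => Fseq F (pre ++ nseq k x) t - Fseq F (pre ++ nseq k y) t) <=
   c * Snorm T (fun t => x t - y t).
  have [c c0 cP] := H p 0%N; exists c => // x y xS yS xr yr.
  apply: (cP [::]) => //; [exact: allS_nil|by rewrite big_nil expr0].
elim: k q => [|k IH] q.
  exists 0 => // pre x y _ _ _ xS yS _ _; rewrite mul0r cats0.
  by rewrite (eq_L2norm (g := fun0)) ?L2norm0// => t _; rewrite subrr.
have [c c0 cP] := IH q.+1.
(* Bounds the replacement of the first [x]; the constant [c] of the induction covers the [k]
   others. *)
pose d := opF T F (q + k.+1) * (rho ^+ q * rho ^+ k).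
have d0 : 0 <= d by rewrite !mulr_ge0 ?exprn_ge0//; case: (opFP (q + k.+1)).
exists (d + c) => [|pre x y szp preS prer xS yS xr yr]; first exact: addr_ge0.
have kxS : allS (nseq k x) by exact: allS_nseq.
have kyS : allS (nseq k y) by exact: allS_nseq.
have xyS : isS T (fun t => x t - y t).
  by apply: eqS_isS (isS_lin (-1) yS xS) => // t _; rewrite scaleN1r addrC.
have mS z ws : isS T z -> allS ws -> allS (pre ++ z :: ws).
  by move=> zS wsS; apply: allS_cat => //; exact: allS_cons.
set G1 := Fseq F (pre ++ nseq k.+1 x); set G3 := Fseq F (pre ++ nseq k.+1 y).
pose G2 := Fseq F (pre ++ y :: nseq k x).
have G1L : isL2 T G1 by apply: Fseq_isL2; exact: mS.
have G2L : isL2 T G2 by apply: Fseq_isL2; exact: mS.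
have G3L : isL2 T G3 by apply: Fseq_isL2; exact: mS.
rewrite (eq_L2norm (g := fun t => (G1 t - G2 t) + (G2 t - G3 t))); last first.
  by move=> t _; rewrite addrA subrK.
apply: le_trans (L2normD (isL2B G1L G2L) (isL2B G2L G3L)) _.
rewrite mulrDl lerD//; last first.
  rewrite /G2 /G3 -[nseq k.+1 y]/(y :: nseq k y) -!cat_rcons.
  apply: cP => //; first by rewrite size_rcons szp.
    by rewrite -cats1; apply: allS_cat => //; apply: allS_cons => //; exact: allS_nil.
  rewrite -cats1 big_cat big_seq1 exprSr ler_pM ?Snorm_ge0//.
  rewrite (big_nth fun0) big_mkord prodr_ge0// => i _; apply: Snorm_ge0 => //; exact: preS.
have GE : eqL T (fun t => G1 t - G2 t) (Fseq F (pre ++ (fun t => x t - y t) :: nseq k x)).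
  apply: eqL_sym; have := Fseq_lin (-1) preS kxS yS xS.
  have -> : (fun t => -1 *: y t + x t) = (fun t => x t - y t).
    by apply/funext => t; rewrite scaleN1r addrC.
  move=> h; apply: eqL_trans h _.
  by apply: eqL_refl => t _; rewrite scaleN1r addrC.
rewrite (eqL_L2norm _ _ GE); [|exact: isL2B|by apply: Fseq_isL2; exact: mS].
apply: le_trans (Fseq_bound _) _; first exact: mS.
rewrite size_cat /= size_nseq szp big_cat big_cons /= /d.
rewrite -mulrA ler_wpM2l//; first by case: (opFP (q + k.+1)).
rewrite [X in _ * X <= _]mulrC mulrA ler_wpM2r ?Snorm_ge0//.
have pge0 ws : allS ws -> 0 <= \prod_(w <- ws) Snorm T w.
  by move=> wsS; rewrite (big_nth fun0) big_mkord prodr_ge0// => i _; apply: Snorm_ge0 => //; exact: wsS.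
apply: ler_pM => //; try exact: pge0.
elim: k {IH c c0 cP d d0 kxS kyS mS G1 G3 G2 G1L G2L G3L GE} => [|k IH] /=.
  by rewrite big_nil expr0.
by rewrite big_cons exprS ler_pM ?Snorm_ge0// pge0//; exact: allS_nseq.
Qed.

Lemma absF_ub z : 0 <= z -> forall N, \sum_(p < N) opF T F p * z ^+ p <= absF T F z.
Proof.
move=> z0 N; case: HF => _ [_ [_ [_ [_ h]]]].
apply: (@nondecreasing_cvgn_le _ (fun N => \sum_(p < N) opF T F p * z ^+ p)); last exact: h.
apply/nondecreasing_seqP => k; rewrite big_ord_recr /= lerDl mulr_ge0 ?exprn_ge0//.
by case: (opFP k).
Qed.

End Multilinear.

(** * The grafting sums solve linear systems *)

Section TreeSolutions.
Variables (R : realType) (T : R) (n : nat) (A : 'M[R]_n) (F : Fam R n) (u : tree -> Iset R n).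
Hypothesis T0 : 0 <= T.
Hypothesis HF : H1 T F.
Hypothesis uL : forall b, validb b -> isL2 T (u b).2.
Local Notation Phi := (Phi T A).
Local Notation PhiStar := (PhiStar T A F u).
Local Notation fun0 := (fun=> 0 : 'cV[R]_n).

Definition goPhi := fix go (cs : seq tree) (w : seq (Iset R n)) : seq (fn R n) :=
  match cs with
  | [::] => [::]
  | c1 :: cs' => Phi F c1 (take (nleaves c1) w) :: go cs' (drop (nleaves c1) w)
  end.

Lemma Phi_node cs w : cs != [::] -> Phi F (Node cs) w = Phi0 T A (0, Fseq F (goPhi cs w)).
Proof. by case: cs. Qed.

Definition allL2 (w : seq (Iset R n)) := forall k, isL2 T (nth (0, fun0) w k).2.

Lemma Phi_isS c w : allL2 w -> isS T (Phi F c w).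
Proof.
elim/tree_children_ind: c w => cs IH w wL.
have [->|cs0] := eqVneq cs [::].
  apply: Phi0_isS => //=; have := wL 0%N; rewrite nth0; exact.
rewrite Phi_node//; apply: Phi0_isS => //=; apply: Fseq_isL2 => //.
elim: cs w IH wL {cs0} => [|c cs IHcs] w IH wL; first exact: allS_nil.
apply: allS_cons.
  apply: IH; first by rewrite mem_head.
  move=> k; have [kc|kc] := ltnP k (nleaves c); first by rewrite nth_take.
  by rewrite nth_default ?size_take_min ?geq_min ?kc//; exact: isL20.
apply: IHcs => [d dcs w' w'L|k]; first by apply: IH => //; rewrite inE dcs orbT.
by rewrite nth_drop.
Qed.

Definition cutphi (p : tree * seq tree) : fn R n := Phi F p.1 (map u p.2).

Lemma PhiStarE c : PhiStar c = (fun t => \sum_(p <- cuts c) cutphi p t).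
Proof. by []. Qed.

Lemma allL2_map (E : seq tree) : all validb E -> allL2 (map u E).
Proof.
move=> vE k; have [kE|kE] := ltnP k (size E); last first.
  by rewrite nth_default ?size_map//; exact: isL20.
by rewrite (nth_map leaf)//; apply: uL; apply: (allP vE); exact: mem_nth.
Qed.

Lemma cutphi_isS c p : validb c -> p \in cuts c -> isS T (cutphi p).
Proof. by move=> vc /(cuts_spec vc)[_ vp]; apply: Phi_isS; exact: allL2_map. Qed.

Lemma PhiStar_isS c : validb c -> isS T (PhiStar c).
Proof. by move=> vc; apply: (isS_sum T0) => p; exact: cutphi_isS. Qed.

(** As each cut grafts exactly one tree per leaf, the concatenated data split back into one block
    per child. *)
Lemma goPhi_pairs (ps : seq (tree * seq tree)) :
  (forall p, p \in ps -> size p.2 = nleaves p.1) ->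
  goPhi [seq p.1 | p <- ps] (map u (flatten [seq p.2 | p <- ps])) = [seq cutphi p | p <- ps].
Proof.
elim: ps => [//|p ps IH] szp /=.
have szp0 : size (map u p.2) = nleaves p.1 by rewrite size_map szp// mem_head.
rewrite map_cat -szp0 take_size_cat// drop_size_cat// IH// => q qps.
by apply: szp; rewrite inE qps orbT.
Qed.

Lemma mem_prods_cuts cs ps : ps \in prods [seq cuts c | c <- cs] ->
  size ps = size cs /\ forall p, p \in ps -> exists2 c, c \in cs & p \in cuts c.
Proof.
elim: cs ps => [|c cs IH] ps; first by rewrite inE => /eqP ->.
rewrite /= mem_prods; case: ps => // p ps /andP[pc /IH[szp h]]; split; first by rewrite /= szp.
move=> q; rewrite inE => /predU1P[->|/h[d dcs qd]]; first by exists c => //; rewrite mem_head.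
by exists d => //; rewrite inE dcs orbT.
Qed.

Lemma Phi0_sum (I : eqType) (r : seq I) (a : I -> R) (w : I -> Iset R n) :
  (forall i, i \in r -> isL2 T (w i).2) ->
  eqS T (Phi0 T A (\sum_(i <- r) a i *: (w i).1, fun t => \sum_(i <- r) a i *: (w i).2 t))
        (fun t => \sum_(i <- r) a i *: Phi0 T A (w i) t).
Proof.
elim: r => [|i r IH] wL t tT.
  rewrite !big_nil; have -> : (fun t => \sum_(i <- [::]) a i *: (w i).2 t) = fun0.
    by apply/funext => s; rewrite big_nil.
  exact: Phi0_0.
have wL' j : j \in r -> isL2 T (w j).2 by move=> jr; apply: wL; rewrite inE jr orbT.
have h := @Phi0_lin _ _ T0 _ A (a i) (w i)
  (\sum_(j <- r) a j *: (w j).1, fun t => \sum_(j <- r) a j *: (w j).2 t)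
  (wL _ (mem_head _ _)).
rewrite big_cons big_cons -IH// -h//=; last first.
  by apply: isL2_sum => j jr; apply: isL2Z; exact: wL'.
by congr (Phi0 T A (_, _) t); apply/funext => s; rewrite big_cons.
Qed.

Lemma Gterm_isL2 cs : validb (Node cs) -> isL2 T (Gterm T A F u (Node cs)).
Proof.
move=> /andP[_ /allP vcs]; apply: (Fseq_isL2 HF); apply: allS_map => c ccs.
exact/PhiStar_isS/vcs.
Qed.

(** The cut at the root contributes the response to [u] of the whole tree. The others choose one cut
    for each child, so they are the terms of the expansion of F_r at the sums [PhiStar] of the
    children, that is of [Gterm]. *)
Lemma PhiStar_node cs : cs != [::] -> validb (Node cs) ->
  eqS T (PhiStar (Node cs))
    (Phi0 T A ((u (Node cs)).1, fun t => (u (Node cs)).2 t + Gterm T A F u (Node cs) t)).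
Proof.
move=> cs0 vb t tT; have ub := uL vb; have GL := Gterm_isL2 vb.
have /andP[_ /allP vcs] := vb.
have h := @Phi0_lin _ _ T0 _ A 1 (u (Node cs)) (0, Gterm T A F u (Node cs)) ub GL t tT.
transitivity (Phi0 T A (u (Node cs)) t + Phi0 T A (0, Gterm T A F u (Node cs)) t); last first.
  rewrite -[X in X + _]scale1r -h /= scale1r addr0; congr (Phi0 T A (_, _) t).
  by apply/funext => s; rewrite scale1r.
rewrite PhiStarE cuts_node// big_cons; congr (_ + _).
pose Ls := [seq cuts c | c <- cs].
have psS ps p : ps \in prods Ls -> p \in ps -> isS T (cutphi p).
  move=> /mem_prods_cuts[_ h'] /h'[c ccs pc]; apply: cutphi_isS pc; exact: vcs.
have FL ps : ps \in prods Ls -> isL2 T (Fseq F [seq cutphi p | p <- ps]).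
  by move=> psP; apply: (Fseq_isL2 HF); apply: allS_map => p; exact: psS.
rewrite big_map gocutsE big_map.
rewrite (eq_big_seq (fun ps => 1 *: Phi0 T A (0, Fseq F [seq cutphi p | p <- ps]) t)); last first.
  move=> ps psP; have [szp pP] := mem_prods_cuts psP; rewrite scale1r /cutphi Phi_node/=.
    rewrite goPhi_pairs// => p /pP[c ccs pc].
    by have [] := cuts_spec (vcs _ ccs) pc.
  by rewrite -size_eq0 size_map szp size_eq0.
rewrite -(@Phi0_sum _ _ (fun=> 1) (fun ps => (0, Fseq F [seq cutphi p | p <- ps])))//=.
rewrite big1 => [|ps _]; last by rewrite scaler0.
apply: Phi0_eqL tT => //.
  by apply: isL2_sum => ps psP; apply: isL2Z; exact: FL.
have := @Fseq_expand _ _ _ _ T0 HF _ cutphi Ls; rewrite -map_comp => hE.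
apply: eqL_sym; apply: eqL_trans (hE _) _.
  by move=> L p /mapP[c ccs ->] pc; apply: cutphi_isS pc; exact: vcs.
by apply: eqL_refl => s _; apply: eq_bigr => ps _; rewrite scale1r.
Qed.

Lemma PhiStar_leaf : eqS T (PhiStar leaf) (Phi0 T A (u leaf)).
Proof. by move=> t _; rewrite PhiStarE big_seq1. Qed.

End TreeSolutions.

(** * Synthesis of the control *)

Section TreeSums.
Variable R : realType.

Lemma tsum_le (a : tree -> R) M :
  (forall Fs, uniq Fs -> all validb Fs -> \sum_(b <- Fs) a b <= M) -> (tsum a <= M%:E)%E.
Proof.
move=> aM; apply: ge_ereal_sup => _ [X [finX subX] <-].
rewrite fsbig_finite// sumEFin lee_fin; apply: aM; first exact: finmap.fset_uniq.
by apply/allP => b; rewrite in_fset_set// inE => /subX.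
Qed.

Lemma le_tsum (a : tree -> R) Fs : uniq Fs -> all validb Fs ->
  ((\sum_(b <- Fs) a b)%:E <= tsum a)%E.
Proof.
move=> uFs vFs; apply: esum_ge; exists [set` Fs].
  by split; [exact: finite_seq|move=> b /= /(allP vFs)].
by rewrite -fsbig_seq// sumEFin.
Qed.

End TreeSums.

Section Synthesis.
Variables (R : realType) (n m : nat) (T : R) (A : 'M[R]_n) (B : 'M[R]_(n, m)).
Variables (x0 : 'cV[R]_n) (lam : R) (F : Fam R n) (v : tree -> fm R m) (c : R).
Hypothesis n0 : (0 < n)%N.
Hypothesis T_gt0 : 0 < T.
Hypothesis HF : H1 T F.
Hypothesis x0_neq0 : x0 != 0.
Hypothesis vC : constructed T A B x0 F v.
Hypothesis c0 : 0 <= c.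
(** The conclusion of [minimizer_control], through which the Kalman condition acts in this section;
    it quantifies over its own data, so [c] depends neither on the section's [x0] nor on [F]. *)
Hypothesis cP : forall x0 f v y, isL2 T f -> isAdj T A y -> eqS T v (fun t => B^T *m y t) ->
  (forall y', isAdj T A y' ->
    2^-1 * Defs.Rint 0 T (fun t => enorm (B^T *m y t) ^+ 2) +
      (dotv x0 (y 0) + Defs.Rint 0 T (fun t => dotv (y t) (f t))) <=
    2^-1 * Defs.Rint 0 T (fun t => enorm (B^T *m y' t) ^+ 2) +
      (dotv x0 (y' 0) + Defs.Rint 0 T (fun t => dotv (y' t) (f t)))) ->
  [/\ isL2 T v, L2norm T v <= c * Inorm T (x0, f) &
      Phi0 T A (x0, fun t => B *m v t + f t) T = 0].

Let T0 : 0 <= T := ltW T_gt0.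
Local Notation u := (uof B x0 v).
Local Notation X := (PhiStar T A F u).
Local Notation K := (normPhi0 T A).
Local Notation fun0 := (fun=> 0 : 'cV[R]_n).

Definition init_of (b : tree) : 'cV[R]_n := if b == leaf then x0 else 0.
(** At the leaf [Gterm] would be the constant term F_0, which is zero only almost everywhere; zero
    is put there outright. *)
Definition forcing (b : tree) : fn R n := if b == leaf then fun0 else Gterm T A F u b.

Lemma leafE b : (b == leaf) = (children b == [::]).
Proof. by case: b => -[|c' cs] //; apply/eqP. Qed.

Lemma uof1 b : (u b).1 = init_of b.
Proof. by rewrite /init_of leafE /uof /=; case: (children b). Qed.

(** Drawn from the adjoint formula alone, without minimality: [cP] presupposes a square integrable
    forcing, and the forcing is built from controls. *)
Lemma control_isL2 b : validb b -> isL2 T (v b).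
Proof.
move=> vb; have [y [ya [vE _]]] := vC vb.
have yE := isAdjP T0 ya; have [M M0 MP] := mexp_mul_bounded (- A^T) T (y 0).
have yL : isL2 T y.
  apply: (eq_isL2 (f := fun t => mexp (- A^T) t *m y 0)) => [t tT|]; first by rewrite (yE t).
  apply: (isL2_bounded (M := \sum_(i < n) M)) => [i|t tT].
    by apply: continuous_measurable_itv => //; exact: C1_continuous (mexp_mul_C1 _ _ i).
  by apply: le_trans (enorm_entries _) _; apply: ler_sum => i _; exact: MP.
apply: (eq_isL2 (f := fun t => B^T *m y t)) => [t tT|]; first by rewrite vE.
exact: isL2_mulmx.
Qed.

Lemma uof_isL2 b : validb b -> isL2 T (u b).2.
Proof. by move=> vb; apply: isL2_mulmx; exact: control_isL2. Qed.

Lemma forcing_isL2 b : validb b -> isL2 T (forcing b).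
Proof.
case: b => cs vb; rewrite /forcing; case: ifP => _; first exact: isL20.
by apply: Gterm_isL2 => //; exact: uof_isL2.
Qed.

Lemma X_eq b : validb b ->
  eqS T (X b) (Phi0 T A (init_of b, fun t => B *m v b t + forcing b t)).
Proof.
case: b => cs vb t tT; rewrite -uof1 /forcing leafE /=.
have [cs0|cs0] := eqVneq cs [::]; last first.
  by rewrite (@PhiStar_node R T n A F u T0 HF uof_isL2 cs cs0 vb t tT).
rewrite cs0; apply: etrans (@PhiStar_leaf R T n A F u t tT) _.
congr (Phi0 T A _ t); rewrite /uof /=; congr pair.
by apply/funext => s; rewrite addr0.
Qed.

Lemma X_isS b : validb b -> isS T (X b).
Proof. by move=> vb; apply: PhiStar_isS => //; exact: uof_isL2. Qed.

(** The leaf has zero forcing and the other trees zero initial value, so the single cost in [cP]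
    covers both forms of [J b]. *)
Lemma control_spec b : validb b ->
  L2norm T (v b) <= c * Inorm T (init_of b, forcing b) /\ X b T = 0.
Proof.
move=> vb; have [y [ya [vE ymin]]] := vC vb.
have JE z : Jval T A B x0 F v b z = 2^-1 * Defs.Rint 0 T (fun t => enorm (B^T *m z t) ^+ 2) +
   (dotv (init_of b) (z 0) + Defs.Rint 0 T (fun t => dotv (z t) (forcing b t))).
  rewrite /Jval /init_of /forcing leafE; case: (children b) => [|d ds] /=; congr (_ + _).
    rewrite (eq_RI (g := fun=> 0)) ?RI0 ?addr0// => t _.
    by rewrite /dotv big1// => i _; rewrite mxE mulr0.
  by rewrite [X in X + _](_ : _ = 0) ?add0r// /dotv big1// => i _; rewrite mxE mul0r.
have [|_ vc xT] := cP (forcing_isL2 vb) ya vE (x0 := init_of b).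
  by move=> y' y'a; rewrite -!JE; exact: ymin.
by split => //; rewrite X_eq// T0 lexx.
Qed.

Definition amp (b : tree) : R := `|lam| ^+ ninner b * Snorm T (X b).
Local Notation beta := (tbeta amp (opF T F)).

Lemma amp_ge0 b : validb b -> 0 <= amp b.
Proof. by move=> vb; rewrite mulr_ge0 ?exprn_ge0 ?Snorm_ge0//; exact: X_isS. Qed.

Lemma opF_ge0 p : 0 <= opF T F p. Proof. by case: (opFP T0 HF p). Qed.

Lemma prod_amp cs : \prod_(b <- cs) amp b =
  `|lam| ^+ sumn (map ninner cs) * \prod_(b <- cs) Snorm T (X b).
Proof.
elim: cs => [|d cs IH]; first by rewrite !big_nil expr0 mulr1.
by rewrite !big_cons IH /amp /= exprD mulrACA.
Qed.

(** The exponent is the total number of internal vertices of the children, so the powers of [lam]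
    distribute over the factors of the multilinear bound. *)
Lemma forcing_norm_pred b : validb b -> b != leaf ->
  `|lam| ^+ (ninner b).-1 * L2norm T (forcing b) <= beta b.
Proof.
case: b => cs vb bl; have cs0 : cs != [::] by rewrite leafE in bl.
rewrite ninner_node// /forcing (negbTE bl) /= /tbeta /=.
rewrite prod_amp mulrCA ler_wpM2l ?exprn_ge0//.
have XS : allS T [seq X d | d <- cs].
  by apply: allS_map => d dcs; apply: X_isS; have /andP[_ /allP] := vb; apply.
have := Fseq_bound T0 HF XS.
by rewrite size_map big_map.
Qed.

Lemma forcing_norm b : validb b -> b != leaf ->
  `|lam| ^+ ninner b * L2norm T (forcing b) <= `|lam| * beta b.
Proof.
move=> vb bl; apply: le_trans (ler_wpM2l (normr_ge0 lam) (forcing_norm_pred vb bl)).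
rewrite mulrA -exprS; case: b {vb} bl => cs; rewrite leafE => cs0.
by rewrite ninner_node.
Qed.

Lemma forcing_leaf : forcing leaf = fun0. Proof. by rewrite /forcing eqxx. Qed.

Lemma Inorm_leaf_gt0 : 0 < Inorm T (u leaf).
Proof.
apply: (@lt_le_trans _ _ (enorm x0)); last by rewrite /Inorm lerDl L2norm_ge0.
rewrite lt_neqAle enorm_ge0 andbT eq_sym; apply: contra x0_neq0 => /eqP/enorm_eq0 ->.
exact: eqxx.
Qed.

Lemma amp_le b : validb b ->
  amp b <= K * (`|lam| ^+ ninner b * (Inorm T (u b) + L2norm T (forcing b))).
Proof.
move=> vb; rewrite mulrCA ler_wpM2l ?exprn_ge0//.
have wL : isL2 T (fun t => B *m v b t + forcing b t).
  by apply: isL2D; [apply: isL2_mulmx; exact: control_isL2|exact: forcing_isL2].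
rewrite (eqS_Snorm T0 (X_eq vb)); apply: le_trans (proj2 (normPhi0P T0 A) _ _) _ => //.
rewrite ler_wpM2l//; first by case: (normPhi0P T0 A).
rewrite /Inorm /= -uof1 -addrA lerD2l.
by apply: L2normD; [apply: isL2_mulmx; exact: control_isL2|exact: forcing_isL2].
Qed.

Lemma control_norm_node b : validb b -> b != leaf ->
  `|lam| ^+ ninner b * L2norm T (v b) <= c * `|lam| * beta b.
Proof.
move=> vb bl; have [h _] := control_spec vb.
have i0 : init_of b = 0 by rewrite /init_of (negbTE bl).
apply: (@le_trans _ _ (c * (`|lam| ^+ ninner b * L2norm T (forcing b)))).
  rewrite mulrCA ler_wpM2l ?exprn_ge0//; apply: le_trans h _.
  by rewrite /Inorm i0 enorm0 add0r.
by rewrite -mulrA ler_wpM2l//; exact: forcing_norm.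
Qed.

Local Notation eB := (entry_sum B).

Lemma Inorm_node b : validb b -> b != leaf ->
  `|lam| ^+ ninner b * Inorm T (u b) <= eB * c * `|lam| * beta b.
Proof.
move=> vb bl; rewrite /Inorm uof1 /init_of (negbTE bl) enorm0 add0r.
apply: (@le_trans _ _ (eB * (`|lam| ^+ ninner b * L2norm T (v b)))).
  rewrite mulrCA ler_wpM2l ?exprn_ge0//; apply: L2norm_mulmx; exact: control_isL2.
by rewrite -!mulrA ler_wpM2l ?entry_sum_ge0// mulrA; exact: control_norm_node.
Qed.

Lemma sum_leaf (a : R) Fs : 0 <= a -> uniq Fs ->
  \sum_(b <- Fs) (if b == leaf then a else 0) <= a.
Proof.
move=> a0 uFs; have [lF|lF] := boolP (leaf \in Fs).
  by rewrite -big_mkcond -big_filter (filter_pred1_uniq uFs lF) big_seq1.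
rewrite big_seq big1// => b bF; case: eqVneq => // bl.
by rewrite -bl bF in lF.
Qed.

(** Once the solutions have the majorant [M], any quantity dominated by [beta] away from the leaf is
    summable. Applied to controls, to data and to forcings. *)
Lemma sum_node_bound (g : tree -> R) (g0 k M : R) : 0 <= M -> 0 <= k -> 0 <= g0 ->
  (forall Fs, uniq Fs -> all validb Fs -> \sum_(b <- Fs) amp b <= M) ->
  g leaf <= g0 -> (forall b, validb b -> b != leaf -> g b <= k * beta b) ->
  forall Fs, uniq Fs -> all validb Fs -> \sum_(b <- Fs) g b <= g0 + k * absF T F M.
Proof.
move=> M0 k0 g00 ampM gl gk Fs uFs vFs.
apply: (@sum_le_tbeta _ amp (opF T F) amp_ge0 opF_ge0 M (absF T F M) (absF_ub T0 HF M0) g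
  (fun b => if b == leaf then g0 else 0)) => //.
- move=> b vb; case: (eqVneq b leaf) => [->|bl]; first by rewrite addr0.
  by rewrite add0r gk.
- exact: sum_leaf.
apply: ampM; first exact: undup_uniq.
apply/allP => d; rewrite mem_undup => /flattenP[_ /mapP[[cs] csF ->] /= dcs].
move: csF; rewrite mem_filter => /andP[_ csF].
by have /andP[_ /allP] := allP vFs _ csF; apply.
Qed.

Lemma K_gt0 : 0 < K. Proof. exact: normPhi0_gt0. Qed.

Lemma absF_ge0 M : 0 <= M -> 0 <= absF T F M.
Proof. by move=> M0; have := absF_ub T0 HF M0 0; rewrite big_ord0. Qed.

(* The trees other than the leaf contribute at most [K (1 + |B| c) |lam| |F|(M)], which the
   hypothesis of smallness makes at most [U]; so [M = (K + 1) U] is a majorant. *)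
Lemma amp_majorant1 : let U := Inorm T (u leaf) in let M := (K + 1) * U in
  K * (1 + eB * c) * `|lam| * absF T F M <= U ->
  forall Fs, uniq Fs -> all validb Fs -> \sum_(b <- Fs) amp b <= M.
Proof.
move=> U M small; have K0 := K_gt0; have U0 := Inorm_leaf_gt0.
have eBc : 0 <= eB * c by rewrite mulr_ge0 ?entry_sum_ge0.
have M0 : 0 <= M by apply: mulr_ge0; [rewrite addr_ge0 ?(ltW K0)|exact: ltW U0].
apply: (@tree_majorant _ amp (opF T F) amp_ge0 opF_ge0 M (absF T F M) (absF_ub T0 HF M0)
  (fun b => if b == leaf then K * U else 0) (K * (1 + eB * c) * `|lam|) (K * U)).
- by rewrite !mulr_ge0 ?addr_ge0// ltW.
- move=> b vb; case: (eqVneq b leaf) => [->|bl].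
    apply: le_trans (amp_le _) _ => //.
    by rewrite forcing_leaf L2norm0 /= expr0 mul1r !addr0.
  apply: le_trans (amp_le vb) _; rewrite add0r -!mulrA ler_wpM2l ?(ltW K0)//.
  rewrite mulrDr mulrDl mul1r addrC; apply: lerD; first exact: forcing_norm.
  by rewrite !mulrA; have := Inorm_node vb bl; rewrite !mulrA.
- by move=> Fs uFs _; apply: sum_leaf => //; rewrite mulr_ge0// ltW.
- by rewrite [leRHS]mulrDl mul1r lerD2l.
Qed.

(** Here the data are already summable with sum at most [S], so they form the inhomogeneous term; it
    and the recursive term are each at most [K * S], and [M] dominates their sum. *)
Lemma amp_majorant2 (S : R) : 0 <= S -> let M := 16 * K * S in
  (forall Fs, uniq Fs -> all validb Fs -> \sum_(b <- Fs) `|lam| ^+ ninner b * Inorm T (u b) <= S) ->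
  `|lam| * absF T F M <= S ->
  forall Fs, uniq Fs -> all validb Fs -> \sum_(b <- Fs) amp b <= M.
Proof.
move=> S0 M uS small; have K0 := K_gt0.
have M0 : 0 <= M by rewrite !mulr_ge0// ltW.
apply: (@tree_majorant _ amp (opF T F) amp_ge0 opF_ge0 M (absF T F M) (absF_ub T0 HF M0)
  (fun b => K * (`|lam| ^+ ninner b * Inorm T (u b))) (K * `|lam|) (K * S)).
- by rewrite mulr_ge0// ltW.
- move=> b vb; apply: le_trans (amp_le vb) _; rewrite mulrDr mulrDr lerD2l.
  case: (eqVneq b leaf) => [->|bl]; first by rewrite forcing_leaf L2norm0 !mulr0.
  by rewrite -mulrA ler_wpM2l ?(ltW K0)//; exact: forcing_norm.
- by move=> Fs uFs vFs; rewrite -mulr_sumr ler_wpM2l ?(ltW K0)//; exact: uS.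
- have h : K * `|lam| * absF T F M <= K * S by rewrite -mulrA ler_wpM2l// ltW.
  have KS : 0 <= K * S by rewrite mulr_ge0// ltW.
  rewrite /M -mulrA; lra.
Qed.

(** [q < 1] yields the smallness asked by [amp_majorant1], and two uses of [sum_node_bound] then
    bound the controls and the data. *)
Lemma control_series_bounds (q : R) : let U := Inorm T (u leaf) in let C' := (1 + eB * c) * (1 + K^-1) in
  q = C' * `|lam| * K * U^-1 * absF T F ((K + 1) * U) -> q < 1 ->
  (tsum (fun b => (`|lam| ^+ ninner b * L2norm T (v b))%R) < +oo)%E /\
  (tsum (fun b => (`|lam| ^+ ninner b * Inorm T (u b))%R) <= (16 * U / (1 - q))%:E)%E.
Proof.
move=> U C' qdef q1; have K0 := K_gt0; have U0 : 0 < U := Inorm_leaf_gt0.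
set M := (K + 1) * U in qdef *.
have M0 : 0 <= M by apply: mulr_ge0; [rewrite addr_ge0 ?(ltW K0)|exact: ltW U0].
set Fi := absF T F M in qdef *; have Fi0 : 0 <= Fi := absF_ge0 M0.
have eBc : 0 <= eB * c by rewrite mulr_ge0 ?entry_sum_ge0.
(* The factor [1 + K^-1] of [C'] times [K] is [K + 1], large enough to cover both
   [K * (1 + eB * c)], for the majorant, and [eB * c], for the data. *)
have qE : q * U = (1 + eB * c) * (K + 1) * (`|lam| * Fi).
  by rewrite qdef /C'; field; rewrite !gt_eqF.
have lF : 0 <= `|lam| * Fi by rewrite mulr_ge0.
have q0 : 0 <= q.
  by rewrite -(pmulr_lge0 _ U0) qE !mulr_ge0 ?addr_ge0 ?(ltW K0).
have qU : q * U < U by rewrite gtr_pMl.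
have ampM : forall Fs, uniq Fs -> all validb Fs -> \sum_(b <- Fs) amp b <= M.
  apply: amp_majorant1 => //; rewrite -/U -/M -/Fi.
  have : 0 <= (1 + eB * c) * (`|lam| * Fi) by rewrite mulr_ge0 ?addr_ge0.
  by move: qU; rewrite qE; nra.
split.
  apply: (@le_lt_trans _ _ (L2norm T (v leaf) + c * `|lam| * Fi)%:E); last by rewrite ltry.
  apply: tsum_le; apply: sum_node_bound => //.
  - by rewrite mulr_ge0.
  - exact: L2norm_ge0.
  - by rewrite /= expr0 mul1r.
  - by move=> b vb bl; exact: control_norm_node.
apply: (@le_trans _ _ (U + eB * c * `|lam| * Fi)%:E).
  apply: tsum_le; apply: sum_node_bound => //.
  - by rewrite mulr_ge0.
  - exact: ltW.
  - by rewrite /= expr0 mul1r.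
  - by move=> b vb bl; exact: Inorm_node.
(* The data sum to at most [2 * U], and [0 <= q < 1]. *)
rewrite lee_fin ler_pdivlMr ?subr_gt0//.
have h1 : eB * c * `|lam| * Fi <= U.
  apply: le_trans (ltW qU); rewrite qE -!mulrA mulrA.
  have : 0 <= (eB * c) * K * (`|lam| * Fi) by rewrite !mulr_ge0 ?(ltW K0) ?entry_sum_ge0.
  have : 0 <= K * (`|lam| * Fi) by rewrite !mulr_ge0 ?(ltW K0).
  nra.
have h2 : 0 <= eB * c * `|lam| * Fi by rewrite !mulr_ge0 ?entry_sum_ge0.
nra.
Qed.

Definition xsum (W : seq tree) (t : R) : 'cV[R]_n := \sum_(b <- W) lam ^+ ninner b *: X b t.
Definition data (b : tree) : Iset R n := (init_of b, fun t => B *m v b t + forcing b t).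
Definition datasum (W : seq tree) : Iset R n :=
  (\sum_(b <- W) lam ^+ ninner b *: (data b).1, fun t => \sum_(b <- W) lam ^+ ninner b *: (data b).2 t).
(** One power of [lam] less than in [xsum]: these terms add up to F(x), and the equation carries
    [lam] in front of it. *)
Definition fterm (b : tree) (t : R) : 'cV[R]_n := lam ^+ (ninner b).-1 *: forcing b t.

Lemma data_isL2 b : validb b -> isL2 T (data b).2.
Proof.
by move=> vb; apply: isL2D; [apply: isL2_mulmx; exact: control_isL2|exact: forcing_isL2].
Qed.

Lemma datasum_isL2 W : all validb W -> isL2 T (datasum W).2.
Proof. by move=> vW; apply: isL2_sum => b /(allP vW) vb; apply: isL2Z; exact: data_isL2. Qed.

Lemma xsum_eq W : all validb W -> eqS T (xsum W) (Phi0 T A (datasum W)).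
Proof.
move=> vW t tT; rewrite (@Phi0_sum R T n A T0 _ W _ data)//.
  by apply: eq_big_seq => b /(allP vW) vb; rewrite X_eq.
by move=> b /(allP vW); exact: data_isL2.
Qed.

Lemma xsum_isS W : all validb W -> isS T (xsum W).
Proof.
move=> vW; apply: (isS_sum T0) => b /(allP vW) vb; apply: (isSZ T0); exact: X_isS.
Qed.

Lemma fterm_isL2 b : validb b -> isL2 T (fterm b).
Proof. by move=> vb; apply: isL2Z; exact: forcing_isL2. Qed.

Lemma xsum_T W : all validb W -> xsum W T = 0.
Proof.
move=> vW; rewrite /xsum big_seq big1// => b /(allP vW)/control_spec[_ ->].
by rewrite scaler0.
Qed.

Lemma Fseq_nseq p x : Fseq F (nseq p x) = F (fun _ : 'I_p => x).
Proof.
rewrite (Fseq_size _ (size_nseq p x)); congr (F _); apply/funext => i.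
by rewrite nth_nseq ltn_ord.
Qed.

Lemma prod_lam ks : \prod_(b <- ks) lam ^+ ninner b = lam ^+ sumn (map ninner ks).
Proof.
elim: ks => [|b ks IH]; first by rewrite big_nil.
by rewrite big_cons IH /= exprD.
Qed.

(** Expanding F_p at a finite sum yields one term for each list of [p] trees of [W], that is for
    each tree with these children. *)
Lemma Fseq_xsum p W : (1 < p)%N -> all validb W ->
  eqL T (Fseq F (nseq p (xsum W))) (fun t => \sum_(ks <- prods (nseq p W)) fterm (Node ks) t).
Proof.
move=> p1 vW; pose phi b t := lam ^+ ninner b *: X b t.
have XW b : b \in W -> isS T (X b) by move=> /(allP vW); exact: X_isS.
have -> : nseq p (xsum W) = [seq (fun t => \sum_(b <- L) phi b t) | L <- nseq p W].
  by rewrite map_nseq.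
have phiS L b : L \in nseq p W -> b \in L -> isS T (phi b).
  by rewrite mem_nseq => /andP[_ /eqP ->] bW; apply: (isSZ T0); exact: XW.
apply: eqL_trans (Fseq_expand T0 HF phiS) _; apply: eqL_sum => ks.
rewrite mem_prods_nseq => /andP[/eqP szk /allP kW].
have XS b : b \in ks -> isS T (X b) by move=> /kW; exact: XW.
apply: eqL_trans (Fseq_scale T0 HF (fun b => lam ^+ ninner b) XS) _.
apply: eqL_refl => t _; have ks0 : ks != [::] by case: ks szk p1 {kW XS} => // <-.
have bl : (Node ks == leaf) = false by rewrite leafE; exact: negbTE.
by rewrite /fterm /forcing bl ninner_node//= prod_lam.
Qed.

Lemma sum_Fseq_xsum N W : all validb W ->
  eqL T (fun t => \sum_(p < N) Fseq F (nseq p (xsum W)) t) (fun t => \sum_(b <- grow W N) fterm b t).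
Proof.
move=> vW; apply: (@eqL_trans _ _ _ _ (fun t => \sum_(p < N)
   (if (1 < p)%N then \sum_(ks <- prods (nseq p W)) fterm (Node ks) t else 0))); last first.
  by apply: eqL_refl => t _; rewrite big_grow [RHS]big_mkcond.
apply: eqL_sum => p _; case: (ltnP 1 p) => p1; first exact: Fseq_xsum.
(* The terms of degree 0 and 1 vanish almost everywhere, as [grow] has no tree of those root
   degrees. *)
by rewrite Fseq_nseq; case: HF => h _; apply: h.
Qed.

(** * Passage to the limit along finite sets of trees *)

Section Limits.
Variables (vs : fm R m) (g : fn R n).
Hypothesis vsL : isL2 T vs.
Hypothesis gL : isL2 T g.
Hypothesis vsP : sumconv T lam v vs.
Hypothesis gP : forall e, 0 < e -> exists F0 : seq tree,
  all (fun b => validb b && (b != leaf)) F0 /\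
  forall Fs, uniq Fs -> all (fun b => validb b && (b != leaf)) Fs -> {subset F0 <= Fs} ->
    L2norm T (fun t => \sum_(b <- Fs) fterm b t - g t) < e.

Definition limdata : Iset R n := (x0, fun t => B *m vs t + lam *: g t).
Definition xlim : fn R n := Phi0 T A limdata.
(** Written as a combination with coefficient -1 so that [Phi0_lin] applies directly. *)
Definition datadiff (W : seq tree) : Iset R n :=
  (- 1 *: (datasum W).1 + limdata.1, fun t => - 1 *: (datasum W).2 t + limdata.2 t).

Lemma limdata_isL2 : isL2 T limdata.2.
Proof. by apply: isL2D; [exact: isL2_mulmx|exact: isL2Z]. Qed.

Lemma datadiff_isL2 W : all validb W -> isL2 T (datadiff W).2.
Proof.
by move=> vW; apply: isL2D; [apply: isL2Z; exact: datasum_isL2|exact: limdata_isL2].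
Qed.

Lemma xlim_isS : isS T xlim. Proof. by apply: Phi0_isS => //; exact: limdata_isL2. Qed.

Lemma xdiff W : all validb W ->
  eqS T (fun t => xlim t - xsum W t) (Phi0 T A (datadiff W)).
Proof.
move=> vW t tT; rewrite xsum_eq// (Phi0_lin T0 A (-1) (datasum_isL2 vW) limdata_isL2 tT).
by rewrite scaleN1r addrC.
Qed.

Lemma Snorm_xdiff W : all validb W ->
  Snorm T (fun t => xlim t - xsum W t) <= K * Inorm T (datadiff W).
Proof.
move=> vW; rewrite (eqS_Snorm T0 (xdiff vW)).
by apply: (proj2 (normPhi0P T0 A)); exact: datadiff_isL2.
Qed.

(** With the leaf in [W] the initial values cancel. The leaf has no forcing, and elsewhere the
    factor [lam] restores the exponent lowered in [fterm]. *)
Lemma datadiff_norm W : uniq W -> all validb W -> leaf \in W ->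
  Inorm T (datadiff W) <= eB * L2norm T (fun t => \sum_(b <- W) lam ^+ ninner b *: v b t - vs t) +
   `|lam| * L2norm T (fun t => \sum_(b <- [seq b <- W | b != leaf]) fterm b t - g t).
Proof.
move=> uW vW lW.
have e1 : (datadiff W).1 = 0.
  rewrite /datadiff /datasum /limdata /= (bigD1_seq leaf)//= big1 => [|b bl].
    by rewrite /init_of eqxx expr0 scale1r addr0 scaleN1r addNr.
  by rewrite /init_of (negbTE bl) scaler0.
set dv := (X in eB * L2norm T X); set dg := (X in `|lam| * L2norm T X).
have dvL : isL2 T dv.
  by apply: isL2B => //; apply: isL2_sum => b /(allP vW) vb; apply: isL2Z; exact: control_isL2.
have dgL : isL2 T dg.
  apply: isL2B => //; apply: isL2_sum => b; rewrite mem_filter => /andP[_ /(allP vW)].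
  exact: fterm_isL2.
rewrite /Inorm e1 enorm0 add0r.
rewrite (eq_L2norm (g := fun t => - (B *m dv t + lam *: dg t))); last first.
  move=> t _; rewrite /datadiff /= scaleN1r.
  have -> : \sum_(b <- W) lam ^+ ninner b *: (B *m v b t + forcing b t) =
     B *m (\sum_(b <- W) lam ^+ ninner b *: v b t) +
     lam *: \sum_(b <- [seq b <- W | b != leaf]) fterm b t.
    under eq_bigr do rewrite scalerDr; rewrite big_split /=; congr (_ + _).
      by rewrite mulmx_sumr; apply: eq_bigr => b _; rewrite scalemxAr.
    rewrite big_filter scaler_sumr [RHS]big_mkcond /=; apply: eq_bigr => b _.
    case: (eqVneq b leaf) => [->|bl]; first by rewrite forcing_leaf scaler0.
    rewrite /fterm scalerA -exprS; case: b bl => cs; rewrite leafE => cs0.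
    by rewrite ninner_node.
  rewrite /dv /dg mulmxBr scalerBr !opprD !opprK !addrA; congr (_ + _).
  by rewrite addrAC.
rewrite L2normN; apply: le_trans (L2normD (isL2_mulmx B dvL) (isL2Z lam dgL)) _.
by rewrite L2normZ// lerD2r L2norm_mulmx.
Qed.

Lemma datadiff_cvg e : 0 < e -> exists W0 : seq tree, all validb W0 /\
  forall W, uniq W -> all validb W -> {subset W0 <= W} -> Inorm T (datadiff W) < e.
Proof.
(* Then [(eB + |lam|) * d < e]; the 1 makes the inequality strict and the denominator positive. *)
move=> e0; pose d := e / (1 + eB + `|lam|).
have D0 : 0 < 1 + eB + `|lam| by rewrite -addrA ltr_pwDl// addr_ge0 ?entry_sum_ge0.
have d0 : 0 < d by rewrite divr_gt0.
have [F0 [vF0 F0P]] := vsP d0; have [G0 [vG0 G0P]] := gP d0.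
exists (leaf :: F0 ++ G0); split.
  rewrite /= all_cat vF0; apply/allP => b /(allP vG0)/andP[vb _]; exact: vb.
move=> W uW vW sub.
have lW : leaf \in W by apply: sub; rewrite mem_head.
apply: le_lt_trans (datadiff_norm uW vW lW) _.
have h1 := F0P W uW vW; have h2 := G0P [seq b <- W | b != leaf].
have {}h1 : L2norm T (fun t => \sum_(b <- W) lam ^+ ninner b *: v b t - vs t) < d.
  by apply: h1 => b bF; apply: sub; rewrite inE mem_cat bF orbT.
have {}h2 : L2norm T (fun t => \sum_(b <- [seq b <- W | b != leaf]) fterm b t - g t) < d.
  apply: h2; first by rewrite filter_uniq.
    by apply/allP => b; rewrite mem_filter => /andP[-> /(allP vW) ->].
  move=> b bG; rewrite mem_filter; have /andP[_ ->] := allP vG0 _ bG.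
  by apply: sub; rewrite inE mem_cat bG !orbT.
have -> : e = d + (eB * d + `|lam| * d) by rewrite /d; field; rewrite gt_eqF.
rewrite -[ltLHS]add0r; apply: ltr_leD => //.
by apply: lerD; apply: ler_wpM2l; rewrite ?entry_sum_ge0// ltW.
Qed.

(** Evaluation at [T] is continuous for [Snorm], and every [xsum W] vanishes there. *)
Lemma xlim_T : xlim T = 0.
Proof.
have TT : 0 <= T <= T by rewrite T0 lexx.
apply: enorm_eq0; apply/le_anti; rewrite enorm_ge0 andbT; apply/ler_addgt0Pr => e e0.
have K0 := K_gt0.
have [W0 [vW0 W0P]] := datadiff_cvg (divr_gt0 e0 K0).
have uW : uniq (undup W0) by exact: undup_uniq.
have vW : all validb (undup W0) by apply/allP => b; rewrite mem_undup => /(allP vW0).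
have h : Inorm T (datadiff (undup W0)) < e / K by apply: W0P => // b; rewrite mem_undup.
have xS : isS T (fun t => xlim t - xsum (undup W0) t).
  by apply: eqS_isS (eqS_sym (xdiff vW)) _ => //; apply: Phi0_isS => //; exact: datadiff_isL2.
have := enorm_le_Snorm T0 xS TT; rewrite xsum_T// subr0 => /le_trans; rewrite add0r; apply.
apply: le_trans (Snorm_xdiff vW) _.
by rewrite -ler_pdivlMl// mulrC ltW.
Qed.

(** For a fixed large [N], [xlim] is replaced by [xsum W], at a cost controlled by the Lipschitz
    constants of the degrees below [N]. The partial sum of F at [xsum W] is the sum of [fterm] over
    [grow W N], which contains [G0] and is therefore close to [g]. *)
Lemma xlim_nonlinear :
  (fun N => L2norm T (fun t => \sum_(p < N) F (fun _ : 'I_p => xlim) t - g t)) @ \oo --> (0 : R).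
Proof.
have K0 := K_gt0.
apply/cvgrPdist_lt => e e0; have e20 : 0 < e / 2 by rewrite divr_gt0.
have [G0 [vG0 G0P]] := gP e20.
exists (\max_(b <- G0) (size (children b)).+1)%N => // N /= GN.
rewrite sub0r normrN ger0_norm ?L2norm_ge0//.
(* A radius that contains [xlim] and every [xsum W] whose data lie within 1 of [limdata]. *)
pose rho := K * (Inorm T limdata + 1).
have I0 := Inorm_ge0 T limdata.
have rho0 : 0 <= rho by apply: mulr_ge0; [exact: ltW|rewrite addr_ge0].
have /choice[cs csP] : forall p : nat, exists c', 0 <= c' /\ forall x y, isS T x -> isS T y ->
    Snorm T x <= rho -> Snorm T y <= rho ->
    L2norm T (fun t => Fseq F (nseq p x) t - Fseq F (nseq p y) t) <=
    c' * Snorm T (fun t => x t - y t).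
  by move=> p; have [c' c'0 c'P] := Fseq_lipschitz T0 HF p rho0; exists c'.
pose C := \sum_(p < N) cs p.
have C0 : 0 <= C by apply: sumr_ge0 => p _; case: (csP p).
(* The bound 1 keeps [xsum W] in the ball of radius [rho]; the other makes [C * K * d] at most
   [e / 2]. *)
pose d := Num.min 1 (e / 2 / (1 + C * K)).
have CK : 0 <= C * K by rewrite mulr_ge0 ?(ltW K0).
have CK1 : 0 < 1 + C * K by rewrite ltr_pwDl.
have d0 : 0 < d by rewrite lt_min ltr01 divr_gt0.
have [W0 [vW0 W0P]] := datadiff_cvg d0.
(* Adding the children of the trees of [G0] puts [G0] inside [grow W N], since [N] exceeds their
   root degrees. *)
pose W := undup (W0 ++ flatten (map children G0)).
have uW : uniq W by exact: undup_uniq.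
have vW : all validb W.
  apply/allP => b; rewrite mem_undup mem_cat => /orP[/(allP vW0)//|].
  move=> /flattenP[_ /mapP[[ds] dG ->] /= bds].
  by have /andP[/andP[_ /allP h] _] := allP vG0 _ dG; exact: h.
have WI : Inorm T (datadiff W) < d.
  by apply: W0P => // b bW; rewrite mem_undup mem_cat bW.
have WS := xsum_isS vW.
have xr : Snorm T xlim <= rho.
  apply: le_trans (proj2 (normPhi0P T0 A) _ limdata_isL2) _.
  by rewrite ler_wpM2l ?(ltW K0)// lerDl.
have xWr : Snorm T (xsum W) <= rho.
  rewrite (eqS_Snorm T0 (xsum_eq vW)).
  apply: le_trans (proj2 (normPhi0P T0 A) _ (datasum_isL2 vW)) _.
  rewrite ler_wpM2l ?(ltW K0)//.
  have d1 : Inorm T (datadiff W) <= 1.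
    by apply: le_trans (ltW WI) _; rewrite /d ge_min lexx.
  apply: le_trans (lerD (lexx (Inorm T limdata)) d1).
  have e1 : (datasum W).1 = limdata.1 - (datadiff W).1.
    by rewrite /datadiff /= scaleN1r opprD opprK addrCA subrr addr0.
  rewrite /Inorm addrACA; apply: lerD.
    by rewrite e1; apply: le_trans (enormD _ _) _; rewrite enormN.
  rewrite (eq_L2norm (g := fun t => limdata.2 t - (datadiff W).2 t)); last first.
    by move=> t _; rewrite /datadiff /= scaleN1r opprD opprK addrCA subrr addr0.
  by apply: L2normB; [exact: limdata_isL2|exact: datadiff_isL2].
have FxL p : isL2 T (Fseq F (nseq p xlim)).
  by apply: (Fseq_isL2 HF); apply: allS_nseq; exact: xlim_isS.
have FWL p : isL2 T (Fseq F (nseq p (xsum W))).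
  by apply: (Fseq_isL2 HF); exact: allS_nseq.
pose Dx t := \sum_(p < N) (Fseq F (nseq p xlim) t - Fseq F (nseq p (xsum W)) t).
pose DW t := \sum_(p < N) Fseq F (nseq p (xsum W)) t.
pose DG t := \sum_(b <- grow W N) fterm b t.
have vG := valid_grow N vW.
have DxL : isL2 T Dx by apply: isL2_sum => p _; exact: isL2B.
have DWL : isL2 T DW by apply: isL2_sum => p _.
have DGL : isL2 T DG by apply: isL2_sum => b /(allP vG); exact: fterm_isL2.
rewrite (eq_L2norm (g := fun t => Dx t + (DW t - g t))); last first.
  move=> t _; rewrite /Dx /DW addrA -big_split /=; congr (_ - _); apply: eq_bigr => p _.
  by rewrite subrK Fseq_nseq.
apply: le_lt_trans (L2normD DxL (isL2B DWL gL)) _.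
rewrite [ltRHS](splitr e); apply: ler_ltD.
  apply: (@le_trans _ _ (C * (K * d))).
    apply: le_trans (L2norm_sum _) _ => [p _|]; first exact: isL2B.
    rewrite /C mulr_suml; apply: ler_sum => p _; have [cp0 cpP] := csP p.
    apply: le_trans (cpP _ _ xlim_isS WS xr xWr) _; rewrite ler_wpM2l//.
    by apply: le_trans (Snorm_xdiff vW) _; rewrite ler_wpM2l ?(ltW K0)// ltW.
  rewrite mulrA; apply: (@le_trans _ _ (C * K * (e / 2 / (1 + C * K)))).
    by rewrite ler_wpM2l// /d ge_min lexx orbT.
  rewrite mulrA ler_pdivrMr// [leRHS]mulrDr mulr1 mulrC lerDr ltW//.
rewrite (@eqL_L2norm _ _ _ _ (fun t => DG t - g t)).
- apply: G0P; first exact: uniq_grow.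
    apply/allP => -[ds] dsG; rewrite (allP vG)//= leafE /=.
    by move: dsG; rewrite mem_grow => /andP[/andP[+ _] _]; case: ds.
  move=> [ds] dG; rewrite mem_grow.
  have /andP[/andP[ds1 _] ds0] := allP vG0 _ dG.
  rewrite leafE /= -size_eq0 in ds0.
  rewrite ltn_neqAle eq_sym ds1 lt0n ds0 /=; apply/andP; split.
    by apply: leq_trans GN; rewrite (big_rem _ dG) /= leq_max leqnn.
  apply/allP => b bds; rewrite mem_undup mem_cat; apply/orP; right; apply/flattenP.
  by exists ds => //; apply/mapP; exists (Node ds).
- exact: isL2B.
- exact: isL2B.
- apply: eqLD; first exact: sum_Fseq_xsum.
  exact: eqL_refl.
Qed.

Lemma xlim_isSolNL : isSolNL T A B x0 lam F vs xlim.
Proof.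
have [xS xE] := Phi0P T0 A limdata_isL2.
split => //; exists g; split => //; split; first exact: xlim_nonlinear.
move=> t tT; apply: etrans (xE t tT) _; by congr (_ + _); apply: eq_vint => s _; rewrite addrA.
Qed.

End Limits.

(** The completeness lemma is used twice, for the weighted controls and for the [fterm]; both norm
    sums are bounded through the majorant of [amp_majorant2]. *)
Lemma control_series_steers (S : R) : 0 <= S ->
  (forall Fs, uniq Fs -> all validb Fs -> \sum_(b <- Fs) `|lam| ^+ ninner b * Inorm T (u b) <= S) ->
  `|lam| * absF T F (16 * K * S) <= S ->
  exists vs : fm R m, isL2 T vs /\ sumconv T lam v vs /\
    exists x : fn R n, isSolNL T A B x0 lam F vs x /\ x T = 0.
Proof.
move=> S0 uS small; have K0 := K_gt0; pose M := 16 * K * S.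
have M0 : 0 <= M by rewrite !mulr_ge0// ltW.
have ampM := amp_majorant2 S0 uS small.
have [||vs vsL vsP] := @L2_summable_cvg R T T0 m tree validb
    (fun b t => lam ^+ ninner b *: v b t) (L2norm T (v leaf) + c * `|lam| * absF T F M).
- by move=> b vb; apply: isL2Z; exact: control_isL2.
- move=> Fs uFs vFs.
  have -> : \sum_(b <- Fs) L2norm T (fun t => lam ^+ ninner b *: v b t) =
     \sum_(b <- Fs) `|lam| ^+ ninner b * L2norm T (v b).
    apply: eq_big_seq => b /(allP vFs) vb; rewrite L2normZ ?normrX//; exact: control_isL2.
  apply: sum_node_bound Fs uFs vFs => //.
  + by rewrite mulr_ge0.
  + exact: L2norm_ge0.
  + by rewrite /= expr0 mul1r.
  + by move=> b vb bl; exact: control_norm_node.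
have [||g gL gP] := @L2_summable_cvg R T T0 n tree (fun b => validb b && (b != leaf))
    fterm (absF T F M).
- by move=> b /andP[vb _]; exact: fterm_isL2.
- move=> Fs uFs vFs; rewrite -[leRHS]add0r -[X in 0 + X]mul1r.
  have vFs' : all validb Fs by apply/allP => b /(allP vFs)/andP[].
  apply: le_trans (@sum_node_bound (fun b => if b == leaf then 0 else
     `|lam| ^+ (ninner b).-1 * L2norm T (forcing b)) 0 1 M M0 _ _ ampM _ _ Fs uFs vFs') => //.
    rewrite big_seq [leRHS]big_seq; apply: ler_sum => b /(allP vFs)/andP[vb bl].
    by rewrite (negbTE bl) L2normZ ?normrX//; exact: forcing_isL2.
  by move=> b vb bl; rewrite (negbTE bl) mul1r; exact: forcing_norm_pred.
exists vs; split => //; split => //; exists (xlim vs g); split.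
- exact: xlim_isSolNL.
- exact: xlim_T.
Qed.

End Synthesis.

Theorem mainTheorem8 (R : realType) (n m : nat) (T : R)
    (A : 'M[R]_n) (B : 'M[R]_(n, m)) :
  (0 < n)%N -> (0 < m)%N -> 0 < T -> B != 0 ->
  kalman A B ->
  exists C C' : R, 0 < C /\ 0 < C' /\
  forall (x0 : 'cV[R]_n) (lam : R) (F : Fam R n) (v : tree -> fm R m),
    x0 != 0 -> H1 T F -> constructed T A B x0 F v ->
    let u := uof B x0 v in
    let absu := tsum (fun b => `|lam| ^+ ninner b * Inorm T (u b)) in
    let absv := tsum (fun b => `|lam| ^+ ninner b * L2norm T (v b)) in
    let q := C' * `|lam| * normPhi0 T A * (Inorm T (u leaf))^-1
               * absF T F (C * Inorm T (u leaf)) in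
    (* part (1) *)
    (q < 1 ->
       (absv < +oo)%E /\
       (absu <= (16 * Inorm T (u leaf) / (1 - q))%:E)%E) /\
    (* part (2) *)
    ((absu < +oo)%E ->
     `|lam| * (fine absu)^-1 * absF T F (16 * normPhi0 T A * fine absu) < 1 ->
     exists vs : fm R m, isL2 T vs /\ sumconv T lam v vs /\
       exists x : fn R n, isSolNL T A B x0 lam F vs x /\ x T = 0).
Proof.
move=> n0 _ T_gt0 _ kal; have [c c0 cP] := minimizer_control T_gt0 kal.
pose K := normPhi0 T A; have K0 : 0 < K := normPhi0_gt0 (ltW T_gt0) A n0.
exists (K + 1), ((1 + entry_sum B * c) * (1 + K^-1)); split; first by rewrite ltr_wpDr.
split.
  apply: mulr_gt0; last by rewrite ltr_wpDr// invr_ge0 ltW.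
  by rewrite ltr_wpDr// mulr_ge0// entry_sum_ge0.
move=> x0 lam F v x00 HF vC u absu absv q; split=> [q1|absu_fin small].
  exact: control_series_bounds n0 T_gt0 HF x00 vC c0 cP q erefl q1.
have Ul : 0 < Inorm T (u leaf) by exact: Inorm_leaf_gt0.
have absu_ge Fs : uniq Fs -> all validb Fs ->
    ((\sum_(b <- Fs) `|lam| ^+ ninner b * Inorm T (u b))%:E <= absu)%E.
  by move=> uFs vFs; apply: le_tsum.
have absuE : absu = (fine absu)%:E.
  rewrite fineK// fin_numElt absu_fin andbT.
  by apply: lt_le_trans (absu_ge [::] isT isT); rewrite ltNyr.
(* The leaf alone contributes a positive term, so the inverse of [fine absu] is a true inverse. *)
have S0 : 0 < fine absu.
  have := absu_ge [:: leaf] isT isT; rewrite absuE lee_fin big_seq1 expr0 mul1r.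
  exact: lt_le_trans.
apply: (control_series_steers n0 T_gt0 HF vC c0 cP (ltW S0)).
- by move=> Fs uFs vFs; rewrite -lee_fin -absuE; exact: absu_ge.
- by move: small; rewrite mulrAC ltr_pdivrMr// mul1r => /ltW.
Qed.
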